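(* Let $m>0$ and $1\le p\le\infty$. Consider the Cauchy problem for the one-dimensional Chern–Simons–Dirac system with coupling matrix $\alpha=I$ (the $2\times2$ identity matrix): $$ \begin{cases} i\gamma^\mu(\partial_\mu-iA_\mu)\psi=m\psi, & t>0,\ x\in\mathbb{R},\\ \partial_tA_1-\partial_xA_0=\psi^*\psi, & t>0,\ x\in\mathbb{R},\\ \partial_tA_0-\partial_xA_1=0, & t>0,\ x\in\mathbb{R},\\ \psi(0,x)=\psi_0(x),\quad \mathbb{A}(0,x)=\mathbb{A}_0(x), & x\in\mathbb{R}, \end{cases} $$ for the unknowns $\psi={}^t(\psi_1,\psi_2)$ with values in $\mathbb{C}^2$ and $\mathbb{A}={}^t(A_0,A_1)$ with values in $\mathbb{R}^2$. For any $\psi_0\in L^p(\mathbb{R})\cap L^\infty(\mathbb{R})$ and $\mathbb{A}_0\in L^p(\mathbb{R})$ there exists a unique global weak solution $(\psi,\mathbb{A})\in C([0,\infty);L^p\cap L^\infty)\times C([0,\infty);L^p)$. The map from the data $(\psi_0,\mathbb{A}_0)$ to the solution $(\psi,\mathbb{A})$ is Lipschitz continuous from $(L^p\cap L^\infty)\times L^p$ to $C([0,\infty);L^p\cap L^\infty)\times C([0,\infty);L^p)$.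
   Context: The index $\mu$ is summed over $\mu=0,1$, with $\partial_0=\partial_t$, $\partial_1=\partial_x$. The Dirac matrices are $\gamma^0=\begin{pmatrix}1&0\\0&-1\end{pmatrix}$ and $\gamma^1=\begin{pmatrix}0&1\\-1&0\end{pmatrix}$. For $\psi={}^t(\psi_1,\psi_2)$, $\psi^*={}^t\overline{\psi}=(\overline{\psi}_1,\overline{\psi}_2)$, so $\psi^*\psi=|\psi_1|^2+|\psi_2|^2$. $L^p=L^p(\mathbb{R})$ is the Lebesgue space in $x$; $\psi_0$ is $\mathbb{C}^2$-valued and $\mathbb{A}_0$ is $\mathbb{R}^2$-valued. Setting $\psi_\pm=\psi_1\pm\psi_2$ and $A_\pm=A_0\mp A_1$, the system is equivalent to $\partial_t\psi_\pm\pm\partial_x\psi_\pm=iA_\mp\psi_\pm-im\psi_\mp$, $\ \partial_tA_\pm\pm\partial_xA_\pm=\mp\psi^*\psi$. A weak solution is a pair satisfying the integral equations $$\psi_\pm(t,x)=\psi_\pm(0,x\mp t)+i\int_0^t(A_\mp\psi_\pm-m\psi_\mp)(s,x\mp(t-s))\,ds,$$ $$A_\pm(t,x)=A_\pm(0,x\mp t)\mp\int_0^t(\psi^*\psi)(s,x\mp(t-s))\,ds,$$ with $\psi_\pm(0,\cdot)$, $A_\pm(0,\cdot)$ determined by $\psi_0,\mathbb{A}_0$.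
   Formalization: Continuity in time in L^∞ (ψ in L^∞; A when p=∞) is taken weak-* with local boundedness, since norm continuity fails for step data; Lipschitz continuity is on bounded sets of data and on each [0,T], since no constant serves all data. *)

(* Defs.v *)
From mathcomp Require Import all_boot all_order all_algebra.
From mathcomp Require Import all_classical all_reals all_analysis.
From mathcomp Require Import complex.

Set Implicit Arguments.
Unset Strict Implicit.
Unset Printing Implicit Defensive.
Import Order.TTheory GRing.Theory Num.Theory.
Import numFieldNormedType.Exports.

Local Open Scope classical_set_scope.
Local Open Scope ring_scope.

(* psi = (psi_1, psi_2) is C^2-valued, A = (A_0, A_1) is R^2-valued. *)
Notation spinor R := (complex R * complex R)%type (only parsing).
Notation potential R := (R * R)%type (only parsing).

Section ChernSimonsDirac.
Context {R : realType}.
Local Notation mu := (@lebesgue_measure R).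
Local Notation C := (complex R).

(* psi^* psi = |psi_1|^2 + |psi_2|^2 *)
Definition density (z : spinor R) : R :=
  ComplexField.Normc.normc z.1 ^+ 2 + ComplexField.Normc.normc z.2 ^+ 2.

Definition spinor_norm (z : spinor R) : R := Num.sqrt (density z).

Definition potential_norm (a : potential R) : R :=
  Num.sqrt (a.1 ^+ 2 + a.2 ^+ 2).

(* Membership of vector-valued functions in a space of scalar functions is
   membership of each real coordinate. *)
Definition spinor_in T (E : set (T -> R)) (z : T -> spinor R) : Prop :=
  [/\ E (fun x => complex.Re (z x).1), E (fun x => complex.Im (z x).1),
      E (fun x => complex.Re (z x).2) & E (fun x => complex.Im (z x).2)].

Definition potential_in T (E : set (T -> R)) (a : T -> potential R) : Prop :=
  E (fun x => (a x).1) /\ E (fun x => (a x).2).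

Definition Lp (p : \bar R) : set (R -> R) := [set f | f \in Lfun mu p].

(* Continuity on [0, oo) with values in L^p.  For p < oo it is continuity in
   the L^p norm.  Translation is not norm continuous on L^oo (the norm distance
   between an indicator of an interval and any of its nontrivial translates is
   1), so for p = oo it is continuity for the weak-* topology of
   L^oo = (L^1)^*, together with boundedness on compact time intervals. *)
Definition Lp_continuous (p : \bar R) (u : R -> R -> R) : Prop :=
  if p == +oo%E then
    (forall T : R, exists M : R, forall t : R, 0 <= t <= T ->
       ('N[mu]_+oo[EFin \o u t] <= M%:E)%E) /\
    (forall g, Lp 1%E g ->
       {within `[0, +oo[, continuous (fun t => \int[mu]_x (u t x * g x))})
  else
    forall t0 : R, 0 <= t0 ->
      ('N[mu]_p[EFin \o (u t \- u t0)%R])%E @[t --> within `[0, +oo[ (nbhs t0)]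
        --> 0%E.

(* C([0, oo); L^p).  Functions of (t, x) stand for curves of classes modulo
   a.e. equality in x; every such curve has a jointly measurable
   representative, and joint measurability gives a meaning to integrals along
   characteristics. *)
Definition CLp (p : \bar R) : set (R * R -> R) :=
  [set u | [/\ measurable_fun
                (`[0, +oo[ `*` setT : set (measurableTypeR R * measurableTypeR R))
                u,
              forall t : R, 0 <= t -> Lp p (fun x => u (t, x)) &
              Lp_continuous p (fun t x => u (t, x))]].

Definition data_space (p : \bar R)
    (psi0 : R -> spinor R) (A0 : R -> potential R) : Prop :=
  spinor_in (Lp p `&` Lp +oo%E) psi0 /\ potential_in (Lp p) A0.

Definition solution_space (p : \bar R)
    (psi : R * R -> spinor R) (A : R * R -> potential R) : Prop :=
  spinor_in (CLp p `&` CLp +oo%E) psi /\ potential_in (CLp p) A.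

(* Norm of (L^p \cap L^oo) x L^p. *)
Definition data_norm (p : \bar R)
    (psi0 : R -> spinor R) (A0 : R -> potential R) : \bar R :=
  ('N[mu]_p[EFin \o (spinor_norm \o psi0)] +
   'N[mu]_+oo[EFin \o (spinor_norm \o psi0)] +
   'N[mu]_p[EFin \o (potential_norm \o A0)])%E.

(* For a sign e = 1 or e = -1: psi_e = psi_1 + e psi_2, A_e = A_0 - e A_1. *)
Definition spinor_pm (e : R) (z : spinor R) : C := z.1 + e%:C%C * z.2.
Definition potential_pm (e : R) (a : potential R) : R := a.1 - e * a.2.

Definition Cintegrable (D : set R) (f : R -> C) : Prop :=
  mu.-integrable D (fun s => (complex.Re (f s))%:E) /\
  mu.-integrable D (fun s => (complex.Im (f s))%:E).

Definition Cintegral (D : set R) (f : R -> C) : C :=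
  Complex (\int[mu]_(s in D) complex.Re (f s))
          (\int[mu]_(s in D) complex.Im (f s)).

(* The integral equation for
   d_t psi_e + e d_x psi_e = i A_{-e} psi_e - i m psi_{-e}. *)
Definition dirac_eq (m e : R) (psi0 : R -> spinor R)
    (psi : R * R -> spinor R) (A : R * R -> potential R) : Prop :=
  forall t : R, 0 <= t -> {ae mu, forall x,
    let F s := let z := (s, x - e * (t - s)) in
      (potential_pm (- e) (A z))%:C%C * spinor_pm e (psi z)
      - m%:C%C * spinor_pm (- e) (psi z) in
    Cintegrable `[0, t] F /\
    spinor_pm e (psi (t, x)) =
      spinor_pm e (psi0 (x - e * t)) + Complex 0 1 * Cintegral `[0, t] F}.

(* The integral equation for d_t A_e + e d_x A_e = - e psi^* psi. *)
Definition chern_simons_eq (e : R) (A0 : R -> potential R)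
    (psi : R * R -> spinor R) (A : R * R -> potential R) : Prop :=
  forall t : R, 0 <= t -> {ae mu, forall x,
    let F s := density (psi (s, x - e * (t - s))) in
    mu.-integrable `[0, t] (EFin \o F) /\
    potential_pm e (A (t, x)) =
      potential_pm e (A0 (x - e * t)) - e * \int[mu]_(s in `[0, t]) F s}.

Definition weak_solution (m : R)
    (psi0 : R -> spinor R) (A0 : R -> potential R)
    (psi : R * R -> spinor R) (A : R * R -> potential R) : Prop :=
  [/\ dirac_eq m 1 psi0 psi A, dirac_eq m (-1) psi0 psi A,
      chern_simons_eq 1 A0 psi A & chern_simons_eq (-1) A0 psi A].

Definition global_weak_solution (m : R) (p : \bar R)
    (psi0 : R -> spinor R) (A0 : R -> potential R)
    (psi : R * R -> spinor R) (A : R * R -> potential R) : Prop :=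
  solution_space p psi A /\ weak_solution m psi0 A0 psi A.

(* Equality of two curves of classes modulo a.e. equality. *)
Definition same_curve (V : Type) (u v : R * R -> V) : Prop :=
  forall t : R, 0 <= t -> {ae mu, forall x, u (t, x) = v (t, x)}.

End ChernSimonsDirac.

(* Main.v *)
(** Write [psi_b], [A_b] for the components attached to the sign [b]: each is
    transported along its characteristic family.  The potential [A_(-b)] driving
    [psi_b] is a free wave of the other family plus an integral of the density;
    along a characteristic of [psi_b] the free wave sweeps an interval of length
    [2 t], so its integral is controlled by its [L^p] norm, even though [A] itself
    need not be bounded.

    Since [A] is real, the term [i A psi] is orthogonal to [psi]: only the mass
    term can increase [|psi|], and a linear Gronwall inequality bounds [psi] in
    [L^p] and in [L^oo] independently of [A].  For two solutions the same
    orthogonality leaves [|A - A'| |psi'|] and a mass term, and [A - A'] is a free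
    wave plus an integral of [|psi - psi'|]; Gronwall applied to [|psi - psi'|]
    together with its integrals along both families gives the Lipschitz estimate,
    hence uniqueness.

    For existence, the real phase [int A_(-b)] serves as an integrating factor: the
    equation becomes [psi_b = e^(i phase) (psi_b(0) - i m int e^(- i phase) psi_(-b))],
    a contraction for a weighted sup norm.  Continuity in time follows from
    continuity of translations in [L^p], and for [p = oo] from its local [L^1]
    version, which with the [L^oo] bound gives weak-* continuity. *)
Require Import Defs.
From mathcomp Require Import all_boot all_order all_algebra.
From mathcomp Require Import all_classical all_reals all_analysis.
From mathcomp Require Import complex.
From mathcomp Require Import measurable_realfun ess_sup_inf.
From mathcomp Require Import ring lra.

Set Implicit Arguments.
Unset Strict Implicit.
Unset Printing Implicit Defensive.
Import Order.TTheory GRing.Theory Num.Theory.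
Import numFieldNormedType.Exports.

Local Open Scope classical_set_scope.
Local Open Scope ring_scope.


(** * Characteristics *)

(** The potential along a characteristic is merely integrable, and the equations hold only for
    almost every [x] at each time. Tonelli moves the null sets onto characteristics; there squares,
    products, sines and cosines are handled for primitives of integrable functions. Increments that
    are quadratic in those of a continuous function force constancy, so no differentiation almost
    everywhere enters. For [p < oo] Gronwall cannot start from a finite norm, since boundedness of
    the unknown says nothing about its decay. The inequality is iterated on backward light cones,
    where a crude finite bound starts the iteration and disappears in the limit; the resulting
    constant does not see the size of the cone. The Lipschitz constant may depend only on [m], [T]
    and the bound [M] on the data, whereas a weak solution brings its own, unquantified, sup bound.
    It is therefore first modified on null sets with that bound; the a priori estimate then yields a
    bound in terms of [M], with which it is modified again. *)

#[global] Instance lebesgue_ae_filter (R : realType) :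
  Filter (nbhs (almost_everywhere (@lebesgue_measure R))).
Proof. exact: (ae_filter_ringOfSetsType (@lebesgue_measure R)). Qed.

Lemma ae_mono (R : realType) (A B : R -> Prop) : (forall x, A x -> B x) ->
  {ae @lebesgue_measure R, forall x, A x} ->
  {ae @lebesgue_measure R, forall x, B x}.
Proof. by move=> AB; apply: filterS. Qed.

Lemma ae_conj (R : realType) (A B : R -> Prop) :
  {ae @lebesgue_measure R, forall x, A x} ->
  {ae @lebesgue_measure R, forall x, B x} ->
  {ae @lebesgue_measure R, forall x, A x /\ B x}.
Proof. by move=> hA hB; exact: (filterI hA hB). Qed.

Section AffineChange.
Context {R : realType}.
Local Notation mu := (@lebesgue_measure R).
Local Notation mR := (measurableTypeR R).

Lemma measurable_affine (a b : R) :
  measurable_fun [set: mR] (fun x : mR => a * x + b : mR).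
Proof.
by apply: measurable_funD => //; apply: measurable_funM.
Qed.

(** The right-hand side is itself a measure, a pushforward scaled by [|a|], so comparison on the
    intervals []c, d]] suffices. For [a < 0] the preimage is closed at the other end, which does not
    affect its length. *)
Lemma lebesgue_measure_affine (a b : R) : a != 0 ->
  forall A : set mR, measurable A ->
  mu A = (`|a|%:E * mu ((fun x : mR => (a * x + b)%R : mR) @^-1` A))%E.
Proof.
move=> a0.
have mphi := measurable_affine a b.
pose m0 : {measure set mR -> \bar R} :=
  measure_function_pushforward__canonical__measure_function_Measure mu mphi.
pose m : {measure set mR -> \bar R} := mscale (NngNum (normr_ge0 a)) m0.
move=> A mA; rewrite -[RHS]/(m A).
apply: lebesgue_measure_unique mA => _ [[c d]] _ <-.
rewrite -[RHS]/(`|a|%:E * mu ((fun x : R => (a * x + b)%R) @^-1` `]c, d]))%E.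
rewrite lebesgue_measure_itv /= lte_fin.
have [a_gt0|a_lt0|a_eq0] := ltgtP 0 a; last by rewrite -a_eq0 eqxx in a0.
- have -> : (fun x : R => a * x + b) @^-1` `]c, d] =
      `](c - b) / a, (d - b) / a]%classic.
    apply/seteqP; split => x /=; rewrite !in_itv /=;
      by rewrite ltr_pdivrMr// ler_pdivlMr// mulrC ltrBlDr lerBrDr.
  rewrite lebesgue_measure_itv /= lte_fin ltr_pM2r ?invr_gt0// ltrBlDr subrK.
  case: ifPn => _; last by rewrite mule0.
  by rewrite -!EFinD -EFinM; congr EFin; rewrite gtr0_norm//; field.
- have -> : (fun x : R => a * x + b) @^-1` `]c, d] =
      `[(d - b) / a, (c - b) / a[%classic.
    apply/seteqP; split => x /=; rewrite !in_itv /=;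
      rewrite ltr_ndivlMr// ler_ndivrMr// mulrC ltrBlDr lerBrDr;
      by rewrite andbC.
  rewrite lebesgue_measure_itv /= lte_fin ltr_nM2r ?invr_lt0// ltrBlDr subrK.
  case: ifPn => _; last by rewrite mule0.
  by rewrite -!EFinD -EFinM; congr EFin; rewrite ltr0_norm//; field.
Qed.

Lemma ge0_integral_affine (a b : R) (f : R -> \bar R) : a != 0 ->
  measurable_fun [set: mR] f -> (forall x, 0 <= f x)%E ->
  (\int[mu]_x f x = `|a|%:E * \int[mu]_x f (a * x + b)%R)%E.
Proof.
move=> a0 mf f0.
have mphi := measurable_affine a b.
pose m0 : {measure set mR -> \bar R} :=
  measure_function_pushforward__canonical__measure_function_Measure mu mphi.
transitivity (\int[mscale (NngNum (normr_ge0 a)) m0]_x f x)%E.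
  by apply: eq_measure_integral => A mA _; exact: lebesgue_measure_affine.
rewrite ge0_integral_mscale//.
congr (_ * _)%E.
by rewrite (@ge0_integral_pushforward _ _ mR mR R _ mphi mu setT)// preimage_setT.
Qed.

Lemma ge0_integral_shift (b : R) (f : R -> \bar R) :
  measurable_fun [set: mR] f -> (forall x, 0 <= f x)%E ->
  (\int[mu]_x f (x + b)%R = \int[mu]_x f x)%E.
Proof.
move=> mf f0; rewrite (ge0_integral_affine b (oner_neq0 R) mf f0) normr1 mul1e.
by apply: eq_integral => x _; rewrite mul1r.
Qed.

Lemma ae_affine (a b : R) (P : R -> Prop) : a != 0 ->
  {ae mu, forall x, P x} -> {ae mu, forall x, P (a * x + b)}.
Proof.
move=> a0 [N [mN N0 sN]].
exists ((fun x : mR => (a * x + b)%R : mR) @^-1` N); split.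
- by rewrite -[X in measurable X]setTI; exact: measurable_affine.
- have := lebesgue_measure_affine b a0 mN; rewrite N0 => /esym/eqP.
  by rewrite mule_eq0 eqe normr_eq0 (negbTE a0) /= => /eqP.
- by move=> x /= /sN.
Qed.

Lemma ae_shift (b : R) (P : R -> Prop) :
  {ae mu, forall x, P x} -> {ae mu, forall x, P (x + b)}.
Proof.
move=> /(ae_affine b (oner_neq0 R)).
by apply: filterS => x; rewrite mul1r.
Qed.

End AffineChange.

Section Characteristics.
Context {R : realType}.
Local Notation mu := (@lebesgue_measure R).
Local Notation mR := (measurableTypeR R).
Local Notation mfun2 := (measurable_fun [set: (mR * mR)%type]).

Definition sg (b : bool) : R := if b then 1 else -1.

Lemma sgN b : sg (~~ b) = - sg b.
Proof. by case: b; rewrite /sg ?opprK. Qed.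

Lemma sg_norm b : `|sg b| = 1.
Proof. by case: b; rewrite /sg ?normrN normr1. Qed.

(* The integral of [f] along the characteristic [x - sg b * t = cst], from time
   [0] up to the point [z = (t, x)]. *)
Definition J (b : bool) (f : R * R -> R) (z : R * R) : R :=
  \int[mu]_(s in `[0, z.1]) f (s, z.2 - sg b * (z.1 - s)).

(** No integrability is assumed: Tonelli applies to the positive and negative parts, and both their
    extended difference and [fine] are measurable. Hence [J b f] is measurable for every measurable
    [f]. *)
Lemma measurable_fun_integral_snd d (X : measurableType d) (g : X * mR -> R) :
  measurable_fun setT g -> measurable_fun setT (fun z => \int[mu]_s g (z, s)).
Proof.
move=> mg; rewrite /Rintegral.
apply: (measurableT_comp (@fine_measurable R _ measurableT)) => /=.
have mEg : measurable_fun setT (EFin \o g) by exact/measurable_EFinP.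
rewrite (_ : (fun z => _) = (fun z => \int[mu]_s (EFin \o g)^\+ (z, s))%E \-
   (fun z => \int[mu]_s (EFin \o g)^\- (z, s))%E)%E; last first.
  apply/funext => z; rewrite [LHS]integralE.
  by congr (_ - _)%E; apply: eq_integral => s _; rewrite ?funeposE ?funenegE.
apply: emeasurable_funB.
- have := @measurable_fun_fubini_tonelli_F _ _ X mR R mu (EFin \o g)^\+%E.
  by apply=> //; exact: measurable_funepos.
- have := @measurable_fun_fubini_tonelli_F _ _ X mR R mu (EFin \o g)^\-%E.
  by apply=> //; exact: measurable_funeneg.
Qed.

Lemma measurable_path d (X : measurableType d) (b : bool) (f : R * R -> R)
    (t x s : X -> mR) : mfun2 f ->
  measurable_fun setT t -> measurable_fun setT x -> measurable_fun setT s ->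
  measurable_fun setT (fun w => f (s w, x w - sg b * (t w - s w))).
Proof.
move=> mf mt mx ms.
apply: (measurableT_comp mf); apply: measurable_fun_pair => //=.
apply: measurable_funB => //; apply: measurable_funM => //.
exact: measurable_funB.
Qed.

(** Moving the variable endpoint into the integrand gives a fixed domain, so that measurability in
    [z] becomes measurability of a parametric integral. *)
Lemma J_mkcond b f z :
  J b f z = \int[mu]_s ((if (0 <= s) && (s <= z.1) then
                           f (s, z.2 - sg b * (z.1 - s)) else 0) : R).
Proof.
rewrite /J Rintegral_mkcond; apply: eq_Rintegral => s _.
by rewrite patchE mem_setE in_itv.
Qed.

Lemma measurable_J b f : mfun2 f -> mfun2 (J b f).
Proof.
move=> mf.
pose g (w : (mR * mR) * mR) : R := if (0 <= w.2) && (w.2 <= w.1.1) then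
  f (w.2, w.1.2 - sg b * (w.1.1 - w.2)) else 0.
rewrite (_ : J b f = fun z : mR * mR => \int[mu]_s g (z, s)); last first.
  by apply/funext => z; rewrite J_mkcond.
apply: (@measurable_fun_integral_snd _ (mR * mR)%type g).
apply: measurable_fun_ifT => //.
- by apply: measurable_and; apply: measurable_fun_ler => //;
    exact: measurableT_comp.
- apply: measurable_path => //; exact: measurableT_comp.
Qed.

Lemma ge0_integral_ae0 (h : mR -> \bar R) : measurable_fun setT h ->
  (forall x, 0 <= h x)%E -> {ae mu, forall x, h x = 0%E} ->
  (\int[mu]_x h x = 0)%E.
Proof.
move=> mh h0 aeh.
have h1 : ae_eq mu setT h (cst 0%E) by move: aeh; apply: filterS => x hx _.
rewrite -((ae_eq_integral_abs mu measurableT mh).2 h1).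
by apply: eq_integral => x _; rewrite gee0_abs.
Qed.

(** Both statements say that the complement of [E] is null for the product measure: Tonelli for its
    indicator. *)
Lemma ae_swap (E : set (mR * mR)) : measurable E ->
  {ae mu, forall s, {ae mu, forall y, E (s, y)}} ->
  {ae mu, forall y, {ae mu, forall s, E (s, y)}}.
Proof.
move=> mE sE.
pose f (z : mR * mR) : \bar R := (\1_(~` E) z)%:E.
have mf : measurable_fun setT f.
  by apply/measurable_EFinP/measurable_indic; exact: measurableC.
have f0 z : (0 <= f z)%E by rewrite lee_fin.
have E0 (z : mR * mR) : f z = 0%E -> E z.
  rewrite /f => -[]/eqP; rewrite indicE; case: (boolP (z \in ~` E)) => //=.
    by rewrite oner_eq0.
  by rewrite notin_setE => /contrapT.
have mfy (y : mR) : measurable_fun setT (fun s => f (s, y)).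
  by apply: measurableT_comp => //; exact: measurable_fun_pair.
have mfs (s : mR) : measurable_fun setT (fun y => f (s, y)).
  by apply: measurableT_comp => //; exact: measurable_fun_pair.
have fub := @fubini_tonelli _ _ mR mR R mu mu f mf f0.
have mG : measurable_fun setT (fun y : mR => \int[mu]_s f (s, y))%E.
  exact: (@measurable_fun_fubini_tonelli_G _ _ mR mR R mu f mf f0).
have mF : measurable_fun setT (fun s : mR => \int[mu]_y f (s, y))%E.
  exact: (@measurable_fun_fubini_tonelli_F _ _ mR mR R mu f mf f0).
have F0 : (\int[mu]_s \int[mu]_y f (s, y) = 0)%E.
  apply: ge0_integral_ae0 mF _ _; first by move=> s; exact: integral_ge0.
  move: sE; apply: filterS => s sE.
  apply: ge0_integral_ae0 (mfs s) _ _; first by move=> y; exact: f0.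
  move: sE; apply: filterS => y Esy.
  rewrite /f indicE (_ : ((s, y) \in ~` E) = false); first exact: erefl.
  by apply: memNset => /(_ Esy).
rewrite F0 in fub.
have /(ae_eq_integral_abs mu measurableT mG) : (\int[mu]_y `| \int[mu]_s f (s, y)| = 0)%E.
  rewrite [RHS]fub; apply: eq_integral => y _.
  by rewrite gee0_abs//; exact: integral_ge0.
apply: filterS => y /= /(_ I) Gy.
have /(ae_eq_integral_abs mu measurableT (mfy y)) : (\int[mu]_s `| f (s, y)| = 0)%E.
  by rewrite -[RHS]Gy; apply: eq_integral => s _; rewrite gee0_abs.
by apply: filterS => s /= /(_ I) /E0.
Qed.

(* A property that holds at each time for almost every [x] holds almost
   everywhere along almost every characteristic. *)
Lemma ae_char b (t : R) (E : set (mR * mR)) : measurable E ->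
  (forall s, 0 <= s <= t -> {ae mu, forall y, E (s, y)}) ->
  {ae mu, forall x, {ae mu, forall s, 0 <= s <= t ->
    E (s, x - sg b * (t - s))}}.
Proof.
move=> mE sE.
(* Times outside [[0, t]] satisfy the property vacuously. At a fixed time [s] the path is a
   translation in [x], which preserves null sets. *)
have /= := @ae_swap [set w | 0 <= w.1 <= t -> E (w.1, w.2 - sg b * (t - w.1))] _ _; apply.
- rewrite [X in measurable X](_ : _ = [set w : mR * mR | ~~ (0 <= w.1 <= t)] `|`
      ((fun w : mR * mR => (w.1, w.2 - sg b * (t - w.1)) : mR * mR) @^-1` E)).
    apply: measurableU.
      rewrite [X in measurable X](_ : _ = ~` (`[0, t]%classic `*` setT)).
        apply: measurableC; exact: measurableX.
      apply/seteqP; split => w /=; rewrite in_itv /=.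
        by move=> /negP w0 [].
      by move=> w0; apply/negP => ?; exact: w0.
    rewrite -[X in measurable X]setTI.
    suff : measurable_fun [set: mR * mR]
      (fun w : mR * mR => (w.1, w.2 - sg b * (t - w.1)) : mR * mR) by exact.
    apply: measurable_fun_pair => //=.
    apply: measurable_funB => //; apply: measurable_funM => //.
    exact: measurable_funB.
  apply/seteqP; split => w /=.
    by case: (boolP (0 <= w.1 <= t)) => w0 h; [right; exact: h|left].
  by move=> [/negP//|].
- apply: aeW => s /=.
  case: (boolP (0 <= s <= t)) => st; last exact: aeW.
  have := ae_shift (- (sg b * (t - s))) (sE s st).
  by apply: filterS => y h _.
Qed.

End Characteristics.


(** * Bounds on L^p norms *)

Section Lnorm_bound.
Context {R : realType}.
Local Notation mu := (@lebesgue_measure R).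
Local Notation mR := (measurableTypeR R).
Local Notation mfun1 := (measurable_fun [set: mR]).
Implicit Types (p : \bar R) (c d r : R) (f g : R -> R).

(** A real bound stands for the norm, so that finiteness is part of every estimate and no arithmetic
    with infinite norms arises. *)
Definition nle p c f : Prop := ('N[mu]_p[EFin \o f] <= c%:E)%E.

Lemma nle_ge0 p c f : nle p c f -> 0 <= c.
Proof. by move=> h; rewrite -lee_fin (le_trans _ h)// Lnorm_ge0. Qed.

(** The [oo] norm is an essential supremum only on a space of positive measure. *)
Lemma lebesgue_measureT_gt0 : (0 < mu [set: R])%E.
Proof. by rewrite -set_itvNyy lebesgue_measure_itv /= ltry. Qed.

Lemma nle_inftyP c f : nle +oo%E c f <-> {ae mu, forall x, `|f x| <= c}.
Proof.
rewrite /nle unlock lebesgue_measureT_gt0; split.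
  by move=> /ess_supP; apply: filterS => x /=; rewrite lee_fin.
by move=> h; apply/ess_supP; move: h; apply: filterS => x /=; rewrite lee_fin.
Qed.

Lemma nle_finP r c f : 1 <= r -> 0 <= c ->
  nle r%:E c f <-> (\int[mu]_x (`|f x| `^ r)%:E <= (c `^ r)%:E)%E.
Proof.
move=> r1 c0; have r0 : 0 < r by exact: lt_le_trans r1.
have -> : (\int[mu]_x (`|f x| `^ r)%:E = 'N[mu]_r%:E[EFin \o f] `^ r)%E.
  by rewrite poweR_Lnorm ?gt_eqF.
have N0 := Lnorm_ge0 mu r%:E (EFin \o f).
rewrite -poweR_EFin; split => h.
  by apply: gt0_ler_poweR => //; rewrite ?in_itv/= ?leey ?lee_fin ?N0 ?c0 ?ltW.
have := @gt0_ler_poweR _ r^-1 _ _ _ _ _ h.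
rewrite -!poweRrM mulfV ?gt_eqF// !poweRe1// ?lee_fin//; apply.
- by rewrite invr_ge0 ltW.
- by rewrite in_itv /= ?poweR_ge0 ?lee_fin ?powR_ge0 leey.
- by rewrite in_itv /= ?poweR_ge0 ?lee_fin ?powR_ge0 leey.
Qed.

Lemma measurable_powR_norm disp (X : measurableType disp) (h : X -> R) r :
  measurable_fun setT h -> measurable_fun setT (fun x => (`|h x| `^ r)%:E).
Proof.
move=> mh; apply/measurable_EFinP.
apply: (measurableT_comp (measurable_powR r)).
exact: measurableT_comp.
Qed.

Lemma ae_nle p c f g : (1 <= p)%E -> mfun1 f -> mfun1 g ->
  {ae mu, forall x, `|f x| <= `|g x|} -> nle p c g -> nle p c f.
Proof.
move=> p1 mf mg fg h; have c0 := nle_ge0 h.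
move: p p1 h => [r| |]//; last first.
  move=> _ /nle_inftyP h; apply/nle_inftyP; move: fg h; apply: filterS2 => x.
  exact: le_trans.
rewrite lee_fin => r1 /(nle_finP _ r1 c0) h; apply/(nle_finP _ r1 c0).
apply: le_trans h; apply: ae_ge0_le_integral => //.
- exact: measurable_powR_norm.
- exact: measurable_powR_norm.
- move: fg; apply: filterS => x fg _; rewrite lee_fin.
  by apply: ge0_ler_powR => //; rewrite ?nnegrE// (le_trans _ r1).
Qed.

Lemma nle_weak p c d f : c <= d -> nle p c f -> nle p d f.
Proof. by move=> cd /le_trans; apply; rewrite lee_fin. Qed.

Lemma nle_eps p c f : (forall e, 0 < e -> nle p (c + e) f) -> nle p c f.
Proof.
by move=> h; apply/lee_addgt0Pr => e e0; rewrite -EFinD; exact: h.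
Qed.

Lemma nle_add p c d f g : (1 <= p)%E -> mfun1 f -> mfun1 g ->
  nle p c f -> nle p d g -> nle p (c + d) (fun x => f x + g x).
Proof.
move=> p1 mf mg hf hg; rewrite /nle EFinD.
by apply: le_trans (leeD hf hg); exact: eminkowski.
Qed.

Lemma nleZ p (k : R) c f : (1 <= p)%E -> mfun1 f ->
  nle p c f -> nle p (`|k| * c) (fun x => k * f x).
Proof.
move=> p1 mf h; have c0 := nle_ge0 h; have kc0 : 0 <= `|k| * c by rewrite mulr_ge0.
move: p p1 h => [r| |]//; last first.
  move=> _ /nle_inftyP h; apply/nle_inftyP; move: h; apply: filterS => x.
  by rewrite normrM => h; rewrite ler_wpM2l.
rewrite lee_fin => r1 /(nle_finP _ r1 c0) h; apply/(nle_finP _ r1 kc0).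
rewrite powRM// EFinM.
under eq_integral do rewrite normrM powRM// EFinM.
rewrite ge0_integralZl_EFin ?lee_pmul// ?powR_ge0//.
- by apply: integral_ge0 => x _; rewrite lee_fin powR_ge0.
- exact: measurable_powR_norm.
Qed.

Lemma nle_shift p a c f : (1 <= p)%E -> mfun1 f ->
  nle p c f -> nle p c (fun x => f (x + a)).
Proof.
move=> p1 mf h; have c0 := nle_ge0 h.
move: p p1 h => [r| |]//; last first.
  by move=> _ /nle_inftyP h; apply/nle_inftyP; exact: (ae_shift a h).
rewrite lee_fin => r1 /(nle_finP _ r1 c0) h; apply/(nle_finP _ r1 c0).
rewrite (@ge0_integral_shift _ a (fun x => (`|f x| `^ r)%:E))//.
- exact: measurable_powR_norm.
Qed.

Lemma nle0 p c : (1 <= p)%E -> 0 <= c -> nle p c (fun=> 0).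
Proof.
move=> p1 c0; rewrite /nle (_ : EFin \o _ = cst 0%E)// Lnorm0 ?lee_fin//.
by rewrite gt_eqF// (lt_le_trans _ p1).
Qed.

End Lnorm_bound.

(** * Minkowski's integral inequality *)

Section Minkowski_integral.
Context {R : realType}.
Local Notation mu := (@lebesgue_measure R).
Local Notation mR := (measurableTypeR R).
Local Notation mfun1 := (measurable_fun [set: mR]).
Local Notation mfun2 := (measurable_fun [set: (mR * mR)%type]).

Lemma integral_indicM (I : set mR) (g : mR -> R) :
  (\int[mu]_(s in I) (g s)%:E = \int[mu]_s (g s * \1_I s)%:E)%E.
Proof.
rewrite integral_mkcond; apply: eq_integral => s _.
by rewrite /patch indicE; case: ifPn => _; rewrite ?mulr1// mulr0.
Qed.

(** Hölder for the factors [f * phi]^ (- a)[and]phi [^ a] with [a = (r - 1) / r]. The weight is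
    meant to be a bound on the norm of the slice at time [s]: after integration in [x] each slice
    then contributes at most [phi s]. *)
Lemma weighted_jensen (r : R) (I : set mR) (phi f : mR -> R) (Phi : R) :
  1 <= r -> measurable I -> mfun1 phi -> mfun1 f ->
  (forall s, 0 < phi s) -> (forall s, 0 <= f s) ->
  (\int[mu]_(s in I) (phi s)%:E = Phi%:E)%E ->
  ((\int[mu]_(s in I) (f s)%:E) `^ r <=
   (Phi `^ (r - 1))%:E *
     \int[mu]_(s in I) (f s `^ r * phi s `^ (1 - r))%:E)%E.
Proof.
move=> r1 mI mphi mf phi0 f0 ePhi.
have Phi0 : 0 <= Phi.
  by rewrite -lee_fin -ePhi; apply: integral_ge0 => s _; rewrite lee_fin ltW.
(* The exponent [1] has no finite conjugate exponent and is treated apart. *)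
move: r1; rewrite le_eqVlt => /predU1P[<-|r1].
  rewrite subrr powRr0 mul1e poweRe1; last first.
    by apply: integral_ge0 => s _; rewrite lee_fin.
  by under [leRHS]eq_integral do rewrite powRr1// powRr0 mulr1.
have r0 : 0 < r by exact: lt_trans r1.
have rn0 : r != 0 by rewrite gt_eqF.
have r10 : r - 1 != 0 by rewrite gt_eqF// subr_gt0.
pose q := r / (r - 1).
have q0 : 0 < q by rewrite divr_gt0// subr_gt0.
pose a := (r - 1) / r.
pose F s := f s * phi s `^ (- a) * \1_I s.
pose G s := phi s `^ a * \1_I s.
have mpow (c : R) : mfun1 (fun s => phi s `^ c).
  by apply: (measurableT_comp (measurable_powR c)).
have mF : mfun1 F.
  by apply: measurable_funM; [apply: measurable_funM|exact: measurable_indic].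
have mG : mfun1 G by apply: measurable_funM => //; exact: measurable_indic.
have pq : r^-1 + q^-1 = 1 by rewrite /q invf_div; field.
have := hoelder mu mF mG r0 q0 pq.
have -> : ('N[mu]_1[EFin \o (F \* G)%R] = \int[mu]_(s in I) (f s)%:E)%E.
  rewrite Lnorm1 (integral_indicM I); apply: eq_integral => s _ /=; congr EFin.
  rewrite /F /G ger0_norm; last by rewrite !mulr_ge0// ?powR_ge0// indicE.
  rewrite powRN; have := phi0 s => /(powR_gt0 a); set u := _ `^ _ => u0.
  rewrite indicE; case: (s \in I) => /=; rewrite ?mulr0// !mulr1.
  by field; rewrite gt_eqF.
move=> hoe.
have := @gt0_ler_poweR _ r (ltW r0) _ _ _ _ hoe.
rewrite !in_itv/= !leey !andbT => /(_ _ _)/le_trans; apply => //.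
- by apply: integral_ge0 => s _; rewrite lee_fin.
- by rewrite mule_ge0// Lnorm_ge0.
rewrite poweRM ?Lnorm_ge0// muleC.
have -> : ('N[mu]_q%:E[EFin \o G] = (Phi `^ q^-1)%:E)%E.
  rewrite unlock -poweR_EFin -ePhi (integral_indicM I); congr (_ `^ _)%E.
  apply: eq_integral => s _; rewrite /= ger0_norm; last first.
    by rewrite mulr_ge0// ?powR_ge0// indicE.
  congr EFin; rewrite /G powRM ?powR_ge0 ?indicE// -powRrM.
  rewrite (_ : a * q = 1); last by rewrite /a /q; field; rewrite rn0 r10.
  rewrite powRr1 ?ltW//; case: (s \in I); rewrite ?powR1// powR0//.
  by rewrite gt_eqF.
rewrite poweR_EFin -powRrM (_ : q^-1 * r = r - 1); last first.
  by rewrite /q invf_div; field.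
apply: lee_wpmul2l; first by rewrite lee_fin powR_ge0.
rewrite poweR_Lnorm// (integral_indicM I) le_eqVlt; apply/orP; left; apply/eqP.
apply: eq_integral => s _; rewrite /= ger0_norm; last first.
  by rewrite !mulr_ge0// ?powR_ge0// indicE.
congr EFin; rewrite /F !powRM ?mulr_ge0 ?powR_ge0 ?indicE// -powRrM.
rewrite (_ : - a * r = 1 - r); last by rewrite /a; field.
by congr (_ * _); case: (s \in I); rewrite ?powR1// powR0.
Qed.

(** Minkowski's inequality with slice bounds [phi] in place of slice norms, so that no measurability
    of the norm in [s] is required. Positivity of [phi] allows its negative powers as weights. *)
Lemma nle_int (p : \bar R) (I : set mR) (phi : mR -> R) (Phi : R)
    (f : R * R -> R) (F : R -> R) :
  (1 <= p)%E -> measurable I -> mfun1 phi -> (forall s, 0 < phi s) ->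
  (\int[mu]_(s in I) (phi s)%:E = Phi%:E)%E ->
  mfun2 f -> (forall z, 0 <= f z) ->
  (forall s, I s -> nle p (phi s) (fun x => f (s, x))) ->
  mfun1 F ->
  {ae mu, forall x, (`|F x|%:E <= \int[mu]_(s in I) (f (s, x))%:E)%E} ->
  nle p Phi F.
Proof.
move=> p1 mI mphi phi0 ePhi mf f0 hf mF hF.
have Phi0 : 0 <= Phi.
  by rewrite -lee_fin -ePhi; apply: integral_ge0 => s _; rewrite lee_fin ltW.
have mfx (x : mR) : mfun1 (fun s => f (s, x)).
  by apply: (measurableT_comp mf); exact: measurable_fun_pair.
have mfs (s : mR) : mfun1 (fun x => f (s, x)).
  by apply: (measurableT_comp mf); exact: measurable_fun_pair.
case: p p1 hf => [r| |]//; last first.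
  move=> _ hf; apply/nle_inftyP.
  (* For [p = oo] the slice bounds hold for almost every [x] at each [s]; the quantifiers are
     exchanged before integrating in [s]. *)
  have := @ae_swap R [set w | I w.1 -> f w <= phi w.1] _ _.
  have mE : measurable [set w : mR * mR | I w.1 -> f w <= phi w.1].
    rewrite (_ : mkset _ = (~` (I `*` setT)) `|` [set w | f w <= phi w.1]).
      apply: measurableU; first by apply: measurableC; exact: measurableX.
      rewrite -[X in measurable X]setTI; apply: measurable_fun_le => //.
      exact: (measurableT_comp mphi).
    apply/seteqP; split => w /=.
      have [Iw h|nI _] := pselect (I w.1); first by right; exact: h.
      by left => -[].
    by move=> [h Iw|//]; exfalso; apply: h.
  move=> /(_ mE) sw; have {}sw := sw _.
  have /sw : {ae mu, forall s, {ae mu, forall y, I s -> f (s, y) <= phi s}}.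
    apply: aeW => s; have [Is|nIs] := pselect (I s); last exact: aeW.
    have /nle_inftyP := hf s Is; apply: filterS => y h _.
    exact: le_trans (ler_norm _) h.
  move: hF; apply: filterS2 => x hx fx.
  rewrite -lee_fin (le_trans hx)// -ePhi.
  apply: ae_ge0_le_integral => //.
  - by move=> s _; rewrite lee_fin.
  - by apply/measurable_EFinP; exact: measurable_funS (mfx x).
  - by move=> s _; rewrite lee_fin ltW.
  - by apply/measurable_EFinP; exact: measurable_funS mphi.
rewrite lee_fin => r1 hf; have r0 : 0 < r by exact: lt_le_trans r1.
apply/(nle_finP _ r1 Phi0).
pose h (z : mR * mR) := f z `^ r * phi z.1 `^ (1 - r) * \1_I z.1.
have h0 z : 0 <= h z by rewrite /h !mulr_ge0 ?powR_ge0.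
have mh : mfun2 h.
  apply: measurable_funM; last first.
    by apply: (measurableT_comp (measurable_indic mI)).
  apply: measurable_funM; first exact: (measurableT_comp (measurable_powR r)).
  apply: (measurableT_comp (measurable_powR _)).
  exact: (measurableT_comp mphi).
have mEh : measurable_fun [set: mR * mR] (EFin \o h) by exact/measurable_EFinP.
have mEh0 z : (0 <= (EFin \o h) z)%E by rewrite lee_fin.
have mG : measurable_fun setT (fun x : mR => \int[mu]_s (EFin \o h) (s, x))%E.
  exact: (@measurable_fun_fubini_tonelli_G _ _ mR mR R mu _ mEh mEh0).
apply: (@le_trans _ _ ((Phi `^ (r - 1))%:E *
    \int[mu]_x \int[mu]_s (EFin \o h) (s, x))%E).
  rewrite -ge0_integralZl_EFin ?powR_ge0//; last first.
    by move=> x _; exact: integral_ge0.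
  apply: ae_ge0_le_integral => //.
  - exact: measurable_powR_norm.
  - move=> x _; rewrite mule_ge0 ?lee_fin ?powR_ge0//.
    by apply: integral_ge0 => s _.
  - exact: measurable_funeM.
  - move: hF; apply: filterS => x hx _.
    have := @weighted_jensen r I phi _ Phi r1 mI mphi (mfx x) phi0 _ ePhi.
    move=> /(_ (fun s => f0 (s, x))); rewrite [X in (_ <= _ * X)%E](integral_indicM I).
    apply: le_trans; rewrite -poweR_EFin.
    apply: gt0_ler_poweR => //.
    + exact: ltW.
    + by rewrite in_itv/= leey lee_fin normr_ge0.
    + rewrite in_itv/= leey andbT.
      by apply: integral_ge0 => s _; rewrite lee_fin.
have <- := @fubini_tonelli _ _ mR mR R mu mu _ mEh mEh0.
have -> : Phi `^ r = Phi `^ (r - 1) * Phi.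
  by rewrite mulrC mulr_powRB1.
rewrite EFinM; apply: lee_wpmul2l; first by rewrite lee_fin powR_ge0.
rewrite -ePhi (integral_indicM I); apply: ge0_le_integral => //.
- by move=> s _; apply: integral_ge0.
- exact: (@measurable_fun_fubini_tonelli_F _ _ mR mR R mu _ mEh mEh0).
- by apply/measurable_EFinP/measurable_funM => //; exact: measurable_indic.
move=> s _; rewrite /h /=.
have [Is|nIs] := pselect (I s); last first.
  rewrite indicE memNset// mulr0 integral0_eq// => x _.
  by rewrite mulr0.
rewrite indicE mem_set// mulr1.
under eq_integral do rewrite mulr1 mulrC EFinM.
rewrite ge0_integralZl_EFin ?powR_ge0//; last 2 first.
- by move=> x _; rewrite lee_fin powR_ge0.
- apply/measurable_EFinP; exact: (measurableT_comp (measurable_powR r)).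
have /(nle_finP _ r1 (ltW (phi0 s))) hs := hf s Is.
apply: (@le_trans _ _ ((phi s `^ (1 - r))%:E * (phi s `^ r)%:E)%E).
  apply: lee_wpmul2l; first by rewrite lee_fin powR_ge0.
  apply: le_trans hs; rewrite le_eqVlt; apply/orP; left; apply/eqP.
  by apply: eq_integral => x _; rewrite ger0_norm.
rewrite -EFinM lee_fin -powRD; first by rewrite subrK powRr1// ltW.
by rewrite (gt_eqF (phi0 s)) implybT.
Qed.

End Minkowski_integral.


(** * Gronwall inequality in L^p *)

Section Gronwall.
Context {R : realType}.
Local Notation mu := (@lebesgue_measure R).
Local Notation mR := (measurableTypeR R).
Local Notation mfun1 := (measurable_fun [set: mR]).
Local Notation mfun2 := (measurable_fun [set: (mR * mR)%type]).

Lemma integral_expR (l t : R) : 0 < l -> 0 <= t ->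
  (\int[mu]_(s in `[0%R, t]) (expR (l * s))%:E = ((expR (l * t) - 1) / l)%:E)%E.
Proof.
move=> l0; rewrite le_eqVlt => /predU1P[<-|t0].
  by rewrite set_itv1 integral_set1 mulr0 expR0 subrr mul0r.
have dF (x : R) : is_derive x 1 (fun s : R => expR (l * s) / l) (expR (l * x)).
  have h1 : is_derive x 1 (l \*: (@id R)) (l *: (1 : R)).
    by apply: is_deriveZ; exact: is_derive_id.
  have h2 := is_derive1_comp (is_derive_expR ((l \*: (@id R)) x)) h1.
  have h3 := is_deriveZ l^-1 h2.
  rewrite [X in is_derive _ _ X _](_ : _ = l^-1 \*: (expR \o (l \*: (@id R)))).
    rewrite (_ : expR (l * x) = l^-1 *: (expR ((l \*: (@id R)) x) * (l *: (1 : R))))//.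
    by rewrite /GRing.scale /= mulr1; field; rewrite gt_eqF.
  by apply/funext => s; rewrite /= /GRing.scale /= mulrC.
have cF (x : R) : {for x, continuous (fun s : R => expR (l * s) / l)}.
  apply: differentiable_continuous; exact/derivable1_diffP.
have cf (x : R) : {for x, continuous (fun s : R => expR (l * s))}.
  apply: continuous_comp; last exact: continuous_expR.
  exact: mulrl_continuous.
rewrite (@continuous_FTC2 _ (fun s => expR (l * s)) (fun s => expR (l * s) / l))//.
- by rewrite mulr0 expR0 -EFinB mulrBl.
- exact: continuous_subspaceT.
- split.
  + move=> x _; exact: ex_derive.
  + by apply: cvg_at_right_filter; exact: cF.
  + by apply: cvg_at_left_filter; exact: cF.
- by move=> x _; rewrite derive1E; exact: derive_val.
Qed.

Lemma bounded_integrable (a b K : R) (f : R -> R) : mfun1 f ->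
  (forall s : R, a <= s <= b -> `|f s| <= K) ->
  mu.-integrable `[a, b] (EFin \o f).
Proof.
move=> mf fK; apply: measurable_bounded_integrable => //.
- by rewrite /= lebesgue_measure_itv /=; case: ifP => _ //; rewrite -EFinD ltry.
- exact: measurable_funS mf.
- exists K; split; first exact: num_real.
  move=> M KM s /=; rewrite in_itv/= => /fK; move/le_trans; apply; exact: ltW.
Qed.

Lemma measurable_char (b : bool) (f : R * R -> R) (t x : R) : mfun2 f ->
  mfun1 (fun s => f (s, x - sg b * (t - s))).
Proof. by move=> mf; apply: measurable_path. Qed.

Lemma integrable_char (b : bool) (f : R * R -> R) (K : R) (z : R * R) :
  mfun2 f -> (forall s y : R, 0 <= s <= z.1 -> `|f (s, y)| <= K) ->
  mu.-integrable `[0, z.1] (fun s => (f (s, z.2 - sg b * (z.1 - s)))%:E).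
Proof.
move=> mf fK.
apply: (@bounded_integrable 0 z.1 K (fun s => f (s, z.2 - sg b * (z.1 - s)))).
  exact: measurable_char.
by move=> s sz; exact: fK.
Qed.

Lemma EFin_J (b : bool) (f : R * R -> R) (K : R) (z : R * R) :
  mfun2 f -> (forall s y : R, 0 <= s <= z.1 -> `|f (s, y)| <= K) ->
  ((J b f z)%:E = \int[mu]_(s in `[0%R, z.1]) (f (s, z.2 - sg b * (z.1 - s)))%:E)%E.
Proof.
by move=> mf fK; rewrite /J fineK//; apply: integrable_fin_num => //;
  exact: integrable_char fK.
Qed.

Lemma J_ge0 b (f : R * R -> R) z : (forall z, 0 <= f z) -> 0 <= J b f z.
Proof. by move=> f0; apply: Rintegral_ge0 => s _. Qed.

(** Along the characteristics ending at time [t], the slice at time [s] is only translated by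
    [sg b * (t - s)], which changes no norm; Minkowski's inequality does the rest. *)
Lemma nle_J (p : \bar R) b (t : R) (phi : R -> R) (Phi : R) (f : R * R -> R) (F : R -> R) :
  (1 <= p)%E -> mfun1 phi -> (forall s, 0 < phi s) ->
  (\int[mu]_(s in `[0%R, t]) (phi s)%:E = Phi%:E)%E ->
  mfun2 f -> (forall s : R, 0 <= s <= t -> nle p (phi s) (fun x => f (s, x))) ->
  mfun1 F ->
  {ae mu, forall x, (`|F x|%:E <=
    \int[mu]_(s in `[0%R, t]) `|f (s, x - sg b * (t - s))|%:E)%E} ->
  nle p Phi F.
Proof.
move=> p1 mphi phi0 ePhi mf hf mF hF.
apply: (@nle_int R p `[0, t]%classic phi Phi
  (fun w => `|f (w.1, w.2 - sg b * (t - w.1))|)) => //.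
- apply: measurableT_comp => //.
  apply: (measurableT_comp mf); apply: measurable_fun_pair => //=.
  apply: measurable_funB => //; apply: measurable_funM => //.
  exact: measurable_funB.
- move=> s /=; rewrite in_itv/= => st.
  have mfs : mfun1 (fun x => f (s, x)).
    by apply: (measurableT_comp mf); exact: measurable_fun_pair.
  have mfs' : mfun1 (fun x => f (s, x - sg b * (t - s))).
    apply: (measurableT_comp mfs); exact: measurable_funB.
  apply: (@ae_nle R p (phi s) _ (fun x => f (s, x + - (sg b * (t - s))))) => //.
  + by apply: measurableT_comp.
  + by apply: aeW => x /=; rewrite normr_id.
  + apply: (@nle_shift R p (- (sg b * (t - s))) (phi s) (fun x => f (s, x))) => //.
    exact: hf.
Qed.

(* Picard-type iteration in the weighted norm [sup_t e^(- lam t) |.|]: each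
   round halves the part of the bound that does not come from [G]. *)
Lemma weighted_iteration (n : R -> R -> Prop) (T lam G B : R) :
  0 <= T -> 0 <= lam -> 0 <= G -> 0 <= B ->
  (forall t c d, c <= d -> n t c -> n t d) ->
  (forall t c, (forall e : R, 0 < e -> n t (c + e)) -> n t c) ->
  (forall t : R, 0 <= t <= T -> n t B) ->
  (forall beta : R, 0 < beta ->
     (forall s : R, 0 <= s <= T -> n s (beta * expR (lam * s))) ->
     forall t : R, 0 <= t <= T -> n t ((G + beta / 2) * expR (lam * t))) ->
  forall t : R, 0 <= t <= T -> n t (2 * G * expR (lam * t)).
Proof.
move=> T0 lam0 G0 B0 mono eps bnd step.
have B10 : 0 < B + 1 by rewrite ltr_wpDl.
(* [2 * G] is the fixed point of [beta -> G + beta / 2], and the distance to it is halved in each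
   round. [B + 1] keeps [beta] positive even if [G] and [B] vanish. *)
have it k : forall t, 0 <= t <= T -> n t ((2 * G + (B + 1) / 2 ^+ k) * expR (lam * t)).
  elim: k => [|k IH] t tT.
    rewrite expr0 divr1; apply: mono (bnd t tT).
    rewrite -[leLHS]mulr1; apply: ler_pM => //.
      by rewrite -[leLHS]add0r lerD ?mulr_ge0// lerDl.
    by rewrite -[leLHS]expR0 ler_expR mulr_ge0//; case/andP: tT.
  have := step (2 * G + (B + 1) / 2 ^+ k) _ IH t tT.
  have -> : G + (2 * G + (B + 1) / 2 ^+ k) / 2 = 2 * G + (B + 1) / 2 ^+ k.+1.
    rewrite exprS; field; exact: expf_neq0.
  by apply; rewrite ltr_wpDl ?mulr_ge0// divr_gt0// exprn_gt0.
move=> t tT; apply: eps => e e0.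
have [k hk] : exists k, (B + 1) / 2 ^+ k * expR (lam * t) <= e.
  pose c := (B + 1) * expR (lam * t) / e.
  exists (Num.bound c).
  have c0 : 0 <= c by rewrite divr_ge0 ?ltW// mulr_gt0// expR_gt0.
  have h : c <= 2 ^+ Num.bound c.
    apply: (le_trans (ltW (archi_boundP c0))).
    rewrite -natrX ler_nat; exact/ltnW/ltn_expl.
  rewrite mulrAC ler_pdivrMr ?exprn_gt0//.
  by rewrite [leRHS]mulrC -ler_pdivrMr.
apply: mono (it k t tT); rewrite mulrDl lerD//.
Qed.

(** Integrating the exponential weight gains [1 / lam]; this gain is what lets a large rate absorb
    the constant of a Gronwall inequality. *)
Lemma nle_J_expR (p : \bar R) b (t T K beta lam : R) (f : R * R -> R) :
  (1 <= p)%E -> 0 < beta -> 0 < lam -> 0 <= t <= T -> mfun2 f ->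
  (forall z, 0 <= f z) -> (forall s y : R, 0 <= s <= T -> f (s, y) <= K) ->
  (forall s : R, 0 <= s <= T ->
    nle p (beta * expR (lam * s)) (fun x => f (s, x))) ->
  nle p (beta * expR (lam * t) / lam) (fun x => J b f (t, x)).
Proof.
move=> p1 beta0 lam0 /andP[t0 tT] mf f0 fK hf.
apply: (@nle_weak _ p (beta * ((expR (lam * t) - 1) / lam))).
  by rewrite mulrA ler_pM2r ?invr_gt0// ler_pM2l// gerBl.
have mexp : mfun1 (fun s => expR (lam * s)).
  by apply: (measurableT_comp (@measurable_expR R)); exact: measurable_funM.
have fK' (s y : R) : 0 <= s <= t -> `|f (s, y)| <= K.
  move=> /andP[s0 st]; rewrite ger0_norm//; apply: fK.
  by rewrite s0 (le_trans st).
apply: (@nle_J p b t (fun s => beta * expR (lam * s)) _ f) => //.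
- exact: measurable_funM.
- by move=> s; rewrite mulr_gt0// expR_gt0.
- under eq_integral do rewrite EFinM.
  rewrite ge0_integralZl_EFin ?(ltW beta0)//.
  + by rewrite integral_expR// EFinM.
  + by apply/measurable_EFinP; exact: measurable_funS mexp.
- by move=> s /andP[s0 st]; apply: hf; rewrite s0 (le_trans st).
- by apply: (measurableT_comp (measurable_J b mf)); exact: measurable_fun_pair.
- apply: aeW => x; rewrite ger0_norm ?J_ge0// (@EFin_J b f K)//.
  apply: ge0_le_integral => //.
  + by move=> s _; rewrite lee_fin.
  + by apply/measurable_EFinP; apply: measurable_funS (measurable_char b t x mf).
  + apply/measurable_EFinP; apply: measurable_funS (measurableT_comp _ (measurable_char b t x mf)) => //.
  + by move=> s _; rewrite lee_fin ler_norm.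
Qed.

(* For [p < oo] the norm of [w] is not known to be finite; it is on a backward
   light cone [D], and restricting to [D] is compatible with [J]. *)
Lemma gronwall_backward_closed (p : \bar R) (T C G K B : R) (w g : R * R -> R)
    (D : set (mR * mR)) :
  (1 <= p)%E -> 0 <= T -> 0 < C -> mfun2 w -> (forall z, 0 <= w z <= K) ->
  measurable D ->
  (forall b (t x s : R), 0 <= s <= t -> D (t, x) -> D (s, x - sg b * (t - s))) ->
  (forall t : R, 0 <= t <= T -> mfun1 (fun x => g (t, x)) /\
     nle p G (fun x => g (t, x))) ->
  (forall t : R, 0 <= t <= T -> {ae mu, forall x,
     w (t, x) <= g (t, x) + C * (J true w (t, x) + J false w (t, x))}) ->
  (forall t : R, 0 <= t <= T -> nle p B (fun x => w (t, x) * \1_D (t, x))) ->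
  forall t : R, 0 <= t <= T ->
    nle p (2 * G * expR (4 * C * t)) (fun x => w (t, x) * \1_D (t, x)).
Proof.
move=> p1 T0 C0 mw wK mD hD hg hw hB.
have w0 z : 0 <= w z by case/andP: (wK z).
pose v (z : R * R) : R := w z * \1_D z.
have mv : mfun2 v by apply: measurable_funM => //; exact: measurable_indic.
have v0 z : 0 <= v z by rewrite /v mulr_ge0.
have vK z : v z <= K.
  rewrite /v indicE; case: (z \in D); rewrite ?mulr1 ?mulr0; first by case/andP: (wK z).
  by case/andP: (wK z); exact: le_trans.
have T00 : 0 <= (0 : R) <= T by rewrite lexx.
have lam0 : 0 < 4 * C by rewrite mulr_gt0.
have Kp (s y : R) : 0 <= s <= T -> v (s, y) <= K by [].
(* At rate [4 * C] each of the two families costs [C * beta / (4 * C) = beta / 4], together the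
   required [beta / 2]. *)
apply: (@weighted_iteration (fun t c => nle p c (fun x => v (t, x))) T (4 * C) G B).
- exact: T0.
- exact: ltW.
- exact: nle_ge0 (hg 0 T00).2.
- exact: nle_ge0 (hB 0 T00).
- by move=> t c d; exact: nle_weak.
- by move=> t c; exact: nle_eps.
- exact: hB.
move=> beta beta0 IH t tT.
have [mg ng] := hg t tT.
have mJ b : mfun1 (fun x => J b v (t, x)).
  by apply: (measurableT_comp (measurable_J b mv)); exact: measurable_fun_pair.
have nJ b := @nle_J_expR p b t T K beta (4 * C) v p1 beta0 lam0 tT mv v0 Kp IH.
have mgn : mfun1 (fun x => `|g (t, x)|) by exact: measurableT_comp.
have mS : mfun1 (fun x => J true v (t, x) + J false v (t, x)).
  exact: measurable_funD.
apply: (@ae_nle _ p _ _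
    (fun x => `|g (t, x)| + C * (J true v (t, x) + J false v (t, x)))) => //.
- by apply: (measurableT_comp mv); exact: measurable_fun_pair.
- by apply: measurable_funD => //; exact: measurable_funM.
- move: (hw t tT); apply: filterS => x hx.
  have r0 : 0 <= `|g (t, x)| + C * (J true v (t, x) + J false v (t, x)).
    by rewrite addr_ge0// mulr_ge0 ?(ltW C0)// addr_ge0// J_ge0.
  rewrite ger0_norm// ger0_norm// /v indicE.
  case: (boolP ((t, x) \in D)) => [|_]; last by rewrite mulr0.
  rewrite inE => Dtx; rewrite mulr1 (le_trans hx)// lerD ?ler_norm//.
  have eqJ b : J b w (t, x) = J b v (t, x).
    rewrite /J; apply: eq_Rintegral => s; rewrite inE /= in_itv/= => st.
    by rewrite /v indicE mem_set ?mulr1//; exact: (hD b t x s st Dtx).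
  by rewrite !eqJ.
- apply: (@nle_weak _ p (G + `|C| * (beta * expR (4 * C * t) / (4 * C) + beta * expR (4 * C * t) / (4 * C)))).
    rewrite (gtr0_norm C0) [leRHS]mulrDl.
    have -> : C * (beta * expR (4 * C * t) / (4 * C) + beta * expR (4 * C * t) / (4 * C)) =
      beta / 2 * expR (4 * C * t) by field; rewrite gt_eqF.
    rewrite lerD// -[leLHS]mulr1 ler_pM//; first exact: nle_ge0 ng.
    by rewrite -[leLHS]expR0 ler_expR mulr_ge0// ?(ltW lam0)//; case/andP: tT.
  apply: nle_add => //.
  + exact: measurable_funM.
  + by apply: ae_nle ng => //; apply: aeW => x; rewrite normr_id.
  + by apply: nleZ => //; exact: nle_add.
Qed.

End Gronwall.

(** * Removal of the cone; local and transversal bounds *)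

Section Gronwall_Lp.
Context {R : realType}.
Local Notation mu := (@lebesgue_measure R).
Local Notation mR := (measurableTypeR R).
Local Notation mfun1 := (measurable_fun [set: mR]).
Local Notation mfun2 := (measurable_fun [set: (mR * mR)%type]).

Lemma le_of_poweR_le (r d : R) (X : \bar R) : 0 < r -> (0 <= X)%E -> 0 <= d ->
  (X `^ r <= (d `^ r)%:E)%E -> (X <= d%:E)%E.
Proof.
move=> r0 X0 d0; rewrite -poweR_EFin => h.
have := @gt0_ler_poweR _ r^-1 _ _ _ _ _ h.
rewrite -!poweRrM mulfV ?gt_eqF// !poweRe1// ?lee_fin//; apply.
- by rewrite invr_ge0 ltW.
- by rewrite in_itv /= ?poweR_ge0 leey.
- by rewrite in_itv /= ?poweR_ge0 ?lee_fin ?powR_ge0 leey.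
Qed.

Lemma lebesgue_measure_cc (a b : R) : a <= b -> mu `[a, b]%classic = (b - a)%:E.
Proof.
move=> ab; rewrite lebesgue_measure_itv /= lte_fin.
by move: ab; rewrite le_eqVlt => /predU1P[->|->]; rewrite ?ltxx ?subrr// EFinB.
Qed.

(** Monotone convergence over growing intervals: a bound uniform in [N] is a bound on the line. *)
Lemma nle_fin_exhaust (r c : R) (f : R -> R) : 1 <= r -> 0 <= c -> mfun1 f ->
  (forall N : nat, (\int[mu]_(x in `[(- N%:R)%R, N%:R%R]) (`|f x| `^ r)%:E <= (c `^ r)%:E)%E) ->
  nle r%:E c f.
Proof.
move=> r1 c0 mf hN; apply/(nle_finP _ r1 c0).
pose F (N : nat) : set mR := `[- N%:R, N%:R]%classic.
have mp := measurable_powR_norm r mf.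
have := @ge0_nondecreasing_set_cvg_integral _ mR R F (fun x => (`|f x| `^ r)%:E) mu.
have -> : \bigcup_i F i = setT.
  apply/seteqP; split=> // x _; exists (Num.bound `|x|) => //.
  rewrite /F /= in_itv/= -ler_norml ltW// archi_boundP//.
have nF : {homo F : n m / (n <= m)%N >-> (n <= m)%O}.
  move=> n m nm; rewrite subsetEset => x; rewrite /F /= !in_itv/= => /andP[h1 h2].
  have : n%:R <= m%:R :> R by rewrite ler_nat.
  by move=> h; rewrite (le_trans _ h1) ?lerN2// (le_trans h2).
move=> /(_ nF) h; have {}h := h _ _ _.
have {}h : (\int[mu]_(x in F i) (`|f x| `^ r)%:E)%E @[i --> \oo] -->
    (\int[mu]_x (`|f x| `^ r)%:E)%E.
  apply: h => [i|i|i x _]; [exact: measurable_itv|exact: measurable_funS mp|].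
  by rewrite lee_fin powR_ge0.
rewrite -(cvg_lim _ h)//; apply: lime_le; first by apply/cvg_ex; eexists; exact: h.
by apply: nearW => N; exact: hN.
Qed.

Lemma gronwall (p : \bar R) (T C G K : R) (w g : R * R -> R) :
  (1 <= p)%E -> 0 <= T -> 0 < C -> mfun2 w -> (forall z, 0 <= w z <= K) ->
  (forall t : R, 0 <= t <= T -> mfun1 (fun x => g (t, x)) /\
     nle p G (fun x => g (t, x))) ->
  (forall t : R, 0 <= t <= T -> {ae mu, forall x,
     w (t, x) <= g (t, x) + C * (J true w (t, x) + J false w (t, x))}) ->
  forall t : R, 0 <= t <= T ->
    nle p (2 * G * expR (4 * C * t)) (fun x => w (t, x)).
Proof.
move=> p1 T0 C0 mw wK hg hw t tT.
have mwt (s : R) : mfun1 (fun x => w (s, x)).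
  by apply: (measurableT_comp mw); exact: measurable_fun_pair.
have K0 : 0 <= K by case/andP: (wK (0, 0)); exact: le_trans.
have G0 : 0 <= 2 * G * expR (4 * C * t).
  have T00 : 0 <= (0 : R) <= T by rewrite lexx.
  by rewrite mulr_ge0 ?expR_ge0// mulr_ge0//; exact: nle_ge0 (hg 0 T00).2.
case: p p1 hg => [r| |]//; last first.
  move=> p1 hg.
  (* For [p = oo] the whole plane serves as [D], and [K] itself starts the iteration. *)
  have e1 s : (fun x => w (s, x) * \1_[set: mR * mR] (s, x)) = (fun x => w (s, x)).
    by apply/funext => x; rewrite indicE in_setT mulr1.
  rewrite -e1; apply: (@gronwall_backward_closed R +oo%E T C G K K w g) => //.
  move=> s sT; rewrite e1; apply/nle_inftyP; apply: aeW => x.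
  by rewrite ger0_norm; case/andP: (wK (s, x)).
rewrite lee_fin => r1 hg; apply: nle_fin_exhaust => // N.
(* A backward cone: for [0 <= t <= T] its slice contains [[-N, N]] and lies in the bounded interval
   [I]. The bound [B] below depends on [N], but it only starts the iteration and is absent from the
   conclusion. *)
pose D : set (mR * mR) := [set z | `|z.2| + z.1 <= N%:R + T].
have mD : measurable D.
  rewrite -[X in measurable X]setTI; apply: measurable_fun_le => //.
  by apply: measurable_funD => //; exact: measurableT_comp.
pose I : set mR := `[- (N%:R + T), N%:R + T]%classic.
have NT0 : 0 <= N%:R + T by rewrite addr_ge0.
have NT : - (N%:R + T) <= N%:R + T by rewrite (le_trans _ NT0)// oppr_le0.
pose B := (K `^ r * ((N%:R + T) - - (N%:R + T))) `^ r^-1.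
have r0 : 0 < r by exact: lt_le_trans r1.
have hB (s : R) : 0 <= s <= T -> nle r%:E B (fun x => w (s, x) * \1_D (s, x)).
  move=> /andP[s0 sT]; apply/nle_finP => //; first exact: powR_ge0.
  rewrite -powRrM mulVf ?gt_eqF// powRr1; last first.
    by rewrite mulr_ge0 ?powR_ge0// opprK addr_ge0.
  apply: (@le_trans _ _ (\int[mu]_(x in I) (K `^ r)%:E)%E); last first.
    rewrite integral_cst; last exact: measurable_itv.
    by rewrite EFinM -(lebesgue_measure_cc NT).
  rewrite [leRHS]integral_mkcond; apply: ge0_le_integral => //.
  - by apply: measurable_powR_norm; apply: measurable_funM => //;
     apply: (measurableT_comp (measurable_indic mD)); exact: measurable_fun_pair.
  - apply/(measurable_restrictT _ _).1 => //; exact: measurable_itv.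
  move=> x _; rewrite /patch indicE.
  case: (boolP ((s, x) \in D)) => [|_]; last first.
    rewrite mulr0 normr0 powR0 ?gt_eqF//.
    by case: ifP => _; rewrite ?lee_fin ?powR_ge0.
  rewrite inE /D /= => Dsx; rewrite mem_set; last first.
    by rewrite /I /= in_itv/= -ler_norml (le_trans _ Dsx)// lerDl.
  rewrite mulr1 lee_fin ger0_norm; last by case/andP: (wK (s, x)).
  by apply: ge0_ler_powR; rewrite ?nnegrE ?(ltW r0)//; case/andP: (wK (s, x)).
have hD b (u x s : R) : 0 <= s <= u -> D (u, x) -> D (s, x - sg b * (u - s)).
  move=> /andP[s0 su]; rewrite /D /=; apply: le_trans.
  have : `|x - sg b * (u - s)| <= `|x| + (u - s).
    apply: (le_trans (ler_normB _ _)); rewrite lerD2l normrM.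
    by rewrite sg_norm mul1r ger0_norm// subr_ge0.
  lra.
have p1 : (1 <= r%:E)%E by rewrite lee_fin.
have /(nle_finP _ r1 G0) := @gronwall_backward_closed R r%:E T C G K B w g D
  p1 T0 C0 mw wK mD hD hg hw hB t tT.
apply: le_trans.
rewrite [leLHS]integral_mkcond; apply: ge0_le_integral => //.
- by move=> x _; rewrite /patch; case: ifP => // _; rewrite lee_fin powR_ge0.
- apply/(measurable_restrictT _ _).1; first exact: measurable_itv.
  by apply: measurable_funS (measurable_powR_norm r (mwt t)).
- by apply: measurable_powR_norm; apply: measurable_funM => //;
    apply: (measurableT_comp (measurable_indic mD)); exact: measurable_fun_pair.
move=> x _; rewrite /patch; case: ifPn => [|_]; last by rewrite lee_fin powR_ge0.
rewrite inE /= in_itv/= -ler_norml => xN; rewrite indicE mem_set ?mulr1//.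
by rewrite /D /= lerD//; case/andP: tT.
Qed.

(** Hölder on an interval; [1 + (b - a)] dominates every factor [(b - a) ^ (1 - 1 / p)], so one
    constant serves all [p]. *)
Lemma nle_loc (p : \bar R) (c a b : R) (f : R -> R) : (1 <= p)%E -> mfun1 f ->
  a <= b -> nle p c f ->
  (\int[mu]_(x in `[a, b]) `|f x|%:E <= ((1 + (b - a)) * c)%:E)%E.
Proof.
move=> p1 mf ab h; have c0 := nle_ge0 h.
have mI : measurable (`[a, b]%classic : set mR) by exact: measurable_itv.
have ba0 : 0 <= b - a by rewrite subr_ge0.
have mfn : mfun1 (fun x => `|f x|) by exact: measurableT_comp.
case: p p1 h => [r| |]//; last first.
  move=> _ /nle_inftyP h.
  apply: (@le_trans _ _ (c%:E * mu `[a, b]%classic)%E).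
    apply: (@integral_le_bound _ mR R mu _ (fun x => (f x)%:E) c%:E) => //.
      by apply/measurable_EFinP; exact: measurable_funS mf.
    by move: h; apply: filterS => x hx _; rewrite lee_fin.
  rewrite [X in (_ * X)%E](lebesgue_measure_cc ab).
  by rewrite -EFinM lee_fin mulrC ler_wpM2r// lerDr.
rewrite lee_fin => r1 /(nle_finP _ r1 c0) h; have r0 : 0 < r by exact: lt_le_trans r1.
apply: (@le_of_poweR_le r) => //.
- by apply: integral_ge0 => x _; rewrite lee_fin.
- by rewrite mulr_ge0// addr_ge0.
have := @weighted_jensen R r `[a, b]%classic (fun=> 1) (fun x => `|f x|) (b - a) r1 mI _ mfn.
have I1 : (\int[mu]_(s in `[a, b]) 1%:E = (b - a)%:E)%E.
  by rewrite integral_cst// mul1e -(lebesgue_measure_cc ab).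
move=> /(_ (measurable_cst _) (fun=> ltr01) (fun=> normr_ge0 _) I1)/le_trans; apply.
apply: (@le_trans _ _ ((b - a) `^ (r - 1) * c `^ r)%:E).
  rewrite EFinM; apply: lee_wpmul2l; first by rewrite lee_fin powR_ge0.
  apply: le_trans h; under eq_integral do rewrite powR1 mulr1.
  apply: ge0_subset_integral => //; first exact: measurable_powR_norm.
have ba1 : 0 <= 1 + (b - a) by rewrite addr_ge0.
rewrite lee_fin (powRM _ ba1 c0); apply: ler_pM; rewrite ?powR_ge0//.
apply: (@le_trans _ _ ((1 + (b - a)) `^ (r - 1))).
  by apply: ge0_ler_powR; rewrite ?subr_ge0// ?nnegrE ?addr_ge0// lerDr.
by apply: ler_powR; rewrite ?lerDl// lerBlDr lerDl.
Qed.

(* Along a characteristic of one family, a free wave of the other family runs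
   through an interval of length [2 * t]. *)
Lemma transversal_bound (p : \bar R) (c t x : R) (b : bool) (a : R -> R) :
  (1 <= p)%E -> mfun1 a -> nle p c a -> 0 <= t ->
  (\int[mu]_(s in `[0%R, t]) `|a (x - sg b * (t - s) + sg b * s)|%:E <=
   ((1 + 2 * t) * c)%:E)%E.
Proof.
move=> p1 ma ha t0.
pose I : set mR := `[x - t, x + t]%classic.
have mI : measurable I by exact: measurable_itv.
pose h (y : mR) : \bar R := (`|a y| * \1_I y)%:E.
have mh : measurable_fun setT h.
  apply/measurable_EFinP/measurable_funM; last exact: measurable_indic.
  exact: measurableT_comp.
have h0 y : (0 <= h y)%E by rewrite lee_fin mulr_ge0.
(* As a function of [s] the argument of [a] has slope [2 * sg b] and stays in [I]; the Jacobian
   factor [1 / 2] is given away below. *)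
have sg0 : 2 * @sg R b != 0 by rewrite /sg; case: b; rewrite ?mulrN1 ?oppr_eq0 ?mulr1.
have nsg : `|2 * sg b| = 2 :> R by rewrite normrM sg_norm mulr1 ger0_norm.
have := ge0_integral_affine (x - sg b * t) sg0 mh h0.
have -> : (\int[mu]_y h y = \int[mu]_(y in I) `|a y|%:E)%E.
  by rewrite -(integral_indicM I (fun y => `|a y|)).
rewrite nsg => eh.
have xt : x - t <= x + t by lra.
have := nle_loc p1 ma xt ha; rewrite -/I eh.
have -> : x + t - (x - t) = 2 * t by ring.
apply: le_trans.
apply: (@le_trans _ _ (\int[mu]_y h (2 * sg b * y + (x - sg b * t))%R)%E); last first.
  rewrite -[leLHS]mul1e; apply: lee_wpmul2r; last by rewrite lee_fin ler1n.
  exact: integral_ge0.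
rewrite [leLHS]integral_mkcond; apply: ge0_le_integral => //.
- by move=> s _; rewrite /patch; case: ifP.
- apply/(measurable_restrictT _ _).1; first exact: measurable_itv.
  apply: (@measurable_funS _ _ mR _ setT) => //.
  apply/measurable_EFinP/measurableT_comp => //; apply: (measurableT_comp ma).
  rewrite (_ : (fun s : mR => _) = (fun s => 2 * sg b * s + (x - sg b * t))).
    exact: measurable_affine.
  by apply/funext => s; ring.
- by apply: (measurableT_comp mh); exact: measurable_affine.
move=> s _; rewrite /patch; case: ifPn => [|_]; last exact: h0.
rewrite inE /= in_itv/= => /andP[s0 st].
have -> : 2 * sg b * s + (x - sg b * t) = x - sg b * (t - s) + sg b * s by ring.
rewrite /h indicE mem_set ?mulr1// /I /= in_itv/= /sg.
by case: (b); apply/andP; split; lra.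
Qed.

End Gronwall_Lp.


(** * Absolutely continuous functions *)

Section Primitive.
Context {R : realType}.
Local Notation mu := (@lebesgue_measure R).
Local Notation mR := (measurableTypeR R).
Implicit Types (t : R) (f g F G : R -> R).

Lemma within_continuous_comp (A : set R) f g :
  {within A, continuous f} -> continuous g -> {within A, continuous (g \o f)}.
Proof.
move=> cf cg x.
have h : (g \o f) @ (x : subspace A) --> (g (f x)).
  by apply: (@cvg_comp _ _ _ f g); [exact: (cf x)|exact: (cg (f x))].
exact: h.
Qed.

Lemma within_continuousD (A : set R) f g :
  {within A, continuous f} -> {within A, continuous g} ->
  {within A, continuous (fun x => f x + g x)}.
Proof. by move=> cf cg x; exact: (cvgD (cf x) (cg x)). Qed.

(** Absolute continuity of [F] with density [f], in integral form. The density is only integrable,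
    as is the potential along a characteristic. *)
Definition prim t F f : Prop := mu.-integrable `[0, t] (EFin \o f) /\
  forall s : R, 0 <= s <= t -> F s = F 0 + \int[mu]_(r in `[0, s]) f r.

Lemma measurable_itvR (i : interval R) : measurable ([set` i] : set mR).
Proof. exact: measurable_itv. Qed.

Lemma integrableZR (D : set mR) (c : R) f : measurable D ->
  mu.-integrable D (EFin \o f) -> mu.-integrable D (EFin \o (fun x => c * f x)).
Proof.
move=> mD If; have := integrableZl mD c If.
by apply: eq_integrable => // r _; rewrite /= EFinM.
Qed.

Lemma integrableMbounded (D : set mR) f g : measurable D ->
  mu.-integrable D (EFin \o f) -> measurable_fun D g -> [bounded g x | x in D] ->
  mu.-integrable D (EFin \o (fun x => f x * g x)).
Proof.
move=> mD If mg bg; have := integrableMl mD If mg bg.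
by apply: eq_integrable => // r _; rewrite /= EFinM.
Qed.

Lemma integrableDR (D : set mR) f g : measurable D ->
  mu.-integrable D (EFin \o f) -> mu.-integrable D (EFin \o g) ->
  mu.-integrable D (EFin \o (fun x => f x + g x)).
Proof.
move=> mD If Ig; have := integrableD mD If Ig.
by apply: eq_integrable => // r _; rewrite /= EFinD.
Qed.

Lemma integrableBR (D : set mR) f g : measurable D ->
  mu.-integrable D (EFin \o f) -> mu.-integrable D (EFin \o g) ->
  mu.-integrable D (EFin \o (fun x => f x - g x)).
Proof.
move=> mD If Ig; have := integrableB mD If Ig.
by apply: eq_integrable => // r _; rewrite /= EFinB.
Qed.

Lemma ae_le_Rintegral (D : set mR) f g : measurable D ->
  mu.-integrable D (EFin \o f) -> mu.-integrable D (EFin \o g) ->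
  {ae mu, forall x, D x -> f x <= g x} ->
  \int[mu]_(x in D) f x <= \int[mu]_(x in D) g x.
Proof.
move=> mD If Ig fg; rewrite -subr_ge0 -RintegralB//.
have Igf := integrableBR mD Ig If.
rewrite /Rintegral (_ : (\int[mu]_(x in D) (g x - f x)%:E =
    \int[mu]_(x in D) `|g x - f x|%:E)%E).
  by rewrite fine_ge0//; apply: integral_ge0 => x _; rewrite lee_fin.
have mgf := measurable_int _ Igf.
apply: ae_eq_integral => //.
  by apply/measurable_EFinP/measurableT_comp => //; exact/measurable_EFinP.
by move: fg; apply: filterS => x fg Dx; rewrite ger0_norm// subr_ge0 fg.
Qed.

(* Cut [0, t] where [V] takes [n] equal steps: the increments of [H] add up to
   at most [K * D ^+ 2 / n], where [D] is the total increment of [V]. *)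
Lemma quadratic_increment_cst t (K : R) (V H : R -> R) : 0 <= t ->
  {within `[0, t], continuous V} ->
  (forall a b : R, 0 <= a -> a <= b -> b <= t ->
     `|H b - H a| <= K * (V b - V a) ^+ 2) ->
  H t = H 0.
Proof.
move=> t0 cV hH; pose D := V t - V 0.
have step (n k : nat) : (k <= n.+1)%N -> exists s : R, [/\ 0 <= s <= t,
    V s = V 0 + D * k%:R / n.+1%:R &
    `|H s - H 0| <= k%:R * (K * (D / n.+1%:R) ^+ 2)].
  elim: k => [|k IH] kn.
    by exists 0; rewrite lexx t0 mulr0 mul0r addr0 subrr normr0 mul0r.
  have [s [/andP[s0 st] Vs Hs]] := IH (ltnW kn).
  have cV' : {within `[s, t], continuous V}.
    apply: continuous_subspaceW cV => x /=; rewrite !in_itv/= => /andP[sx ->].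
    by rewrite (le_trans s0).
  pose v := V 0 + D * k.+1%:R / n.+1%:R.
  have n0 : n.+1%:R != 0 :> R by [].
  have Vt : V t = V 0 + D by rewrite /D addrC subrK.
  have vE : v - V s = D / n.+1%:R.
    by rewrite /v Vs -natr1; field; rewrite addrC natr1.
  have vE' : V t - v = D * ((n.+1 - k.+1)%:R / n.+1%:R).
    rewrite Vt /v natrB//; field; by rewrite addrC natr1.
  (* [V] is not assumed monotone, so the total increment [D] may have either sign. *)
  have vb : Num.min (V s) (V t) <= v <= Num.max (V s) (V t).
    rewrite ge_min le_max.
    have [D0|D0] := leP 0 D.
      have -> : V s <= v by rewrite -subr_ge0 vE divr_ge0.
      have -> : v <= V t by rewrite -subr_ge0 vE' mulr_ge0// divr_ge0.
      by rewrite orbT.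
    have -> : v <= V s by rewrite -subr_le0 vE pmulr_lle0 ?invr_gt0// ltW.
    have -> : V t <= v.
      by rewrite -subr_ge0 -opprB vE' -mulNr mulr_ge0 ?divr_ge0// oppr_ge0 ltW.
    by rewrite orbT.
  have [c] := IVT st cV' vb; rewrite in_itv/= => /andP[sc ct] Vc.
  exists c; split; [by rewrite ct (le_trans s0)|exact: Vc|].
  have -> : H c - H 0 = (H c - H s) + (H s - H 0) by rewrite addrA subrK.
  rewrite (le_trans (ler_normD _ _))//.
  rewrite -natr1 mulrDl mul1r [leRHS]addrC lerD//.
  by rewrite (le_trans (hH s c s0 sc ct))// Vc vE.
have bnd n : `|H t - H 0| <= K * D ^+ 2 / n.+1%:R.
  (* The final value of [V] may be reached before [t]; the hypothesis then forces [H t = H s], since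
     [V] has no increment left. *)
  have [s [/andP[s0 st] Vs Hs]] := step n n.+1 (leqnn _).
  have Vst : V s = V t by rewrite Vs mulfK// /D addrC subrK.
  have := hH s t s0 st (lexx t); rewrite Vst subrr expr0n mulr0 normr_le0 subr_eq0.
  move=> /eqP ->; apply: (le_trans Hs); rewrite le_eqVlt; apply/orP; left; apply/eqP.
  by field; rewrite addrC natr1.
apply/eqP; rewrite -subr_eq0 -normr_le0; apply/ler_addgt0Pr => e e0; rewrite add0r.
have K0 : 0 <= K * D ^+ 2 by have := bnd 0%N; rewrite divr1; exact: le_trans.
apply: (le_trans (bnd (Num.bound (K * D ^+ 2 / e)))).
move: K0 => {bnd}; set X := K * D ^+ 2 => X0.
have h : 0 <= X / e by rewrite divr_ge0// ltW.
rewrite ler_pdivrMr// [leRHS]mulrC -ler_pdivrMr//.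
by rewrite ltW// (lt_trans (archi_boundP h))// ltr_nat.
Qed.

Lemma prim_integrable t F f (s : R) : prim t F f -> s <= t ->
  mu.-integrable `[0, s] (EFin \o f).
Proof.
move=> [If _] st; apply: integrableS If => //; apply: subset_itvl.
by rewrite bnd_simp.
Qed.

Lemma integrable_sub (a b c d : R) f : mu.-integrable `[a, b] (EFin \o f) ->
  a <= c -> d <= b -> mu.-integrable `]c, d] (EFin \o f).
Proof.
move=> If ac db; apply: integrableS If => // x /=; rewrite !in_itv/=.
by move=> /andP[cx xd]; rewrite (le_trans ac (ltW cx)) (le_trans xd db).
Qed.

Lemma Rintegral_increment t f (a b : R) : mu.-integrable `[0, t] (EFin \o f) ->
  0 <= a -> a <= b -> b <= t ->
  \int[mu]_(r in `[0, b]) f r - \int[mu]_(r in `[0, a]) f r =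
  \int[mu]_(r in `]a, b]) f r.
Proof.
move=> If a0 ab bt; rewrite Rintegral_itvB ?bnd_simp//.
by apply: integrableS If => //; apply: subset_itvl; rewrite bnd_simp.
Qed.

Lemma prim_increment t F f (a b : R) : prim t F f -> 0 <= a -> a <= b -> b <= t ->
  F b - F a = \int[mu]_(r in `]a, b]) f r.
Proof.
move=> [If hF] a0 ab bt.
rewrite hF ?(le_trans a0)// (hF a) ?a0 ?(le_trans ab)//.
by rewrite opprD addrACA subrr add0r (Rintegral_increment If).
Qed.

Lemma prim_continuous t F f : 0 <= t -> prim t F f -> {within `[0, t], continuous F}.
Proof.
move=> t0 [If hF].
have h := parameterized_integral_continuous t0 If.
apply: (@subspace_eq_continuous _ _ _
    (fun s => F 0 + parameterized_integral mu 0 s f)).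
  by move=> s; rewrite inE /= in_itv/= => st; rewrite -hF.
move=> s; apply: cvgD; [exact: cvg_cst|exact: h].
Qed.

Lemma integrable_norm_itv (i : interval R) f : mu.-integrable [set` i] (EFin \o f) ->
  mu.-integrable [set` i] (EFin \o (fun s => `|f s|)).
Proof. by move=> If; exact: integrable_norm. Qed.

(** Chain rule without differentiating [F]. The defect [H = Theta (F u) - \int f * theta (F)] has
    increments at most [2 * L] times the square of those of [V = \int |f|], hence is constant. The
    two hypotheses make [theta] Lipschitz and the Taylor remainder of [Theta] quadratic. *)
Lemma prim_comp t (L : R) (Theta theta : R -> R) F f : 0 <= t -> 0 <= L ->
  (forall x y, `|theta y - theta x| <= L * `|y - x|) ->
  (forall x y, `|Theta y - Theta x - (y - x) * theta x| <= L * (y - x) ^+ 2) ->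
  prim t F f -> prim t (Theta \o F) (fun s => f s * theta (F s)).
Proof.
move=> t0 L0 hth hTh pF; have [If hF] := pF.
have If' := integrable_norm_itv If.
pose V s := \int[mu]_(r in `[0, s]) `|f r|.
have cV : {within `[0, t], continuous V} by exact: (parameterized_integral_continuous t0 If').
have dV a b : 0 <= a -> a <= b -> b <= t ->
    V b - V a = \int[mu]_(r in `]a, b]) `|f r|.
  by move=> a0 ab bt; rewrite /V (Rintegral_increment If').
have dF a b : 0 <= a -> a <= b -> b <= t -> `|F b - F a| <= V b - V a.
  move=> a0 ab bt; rewrite (prim_increment pF)// dV//.
  apply: le_normr_Rintegral => //; exact: integrable_sub If a0 bt.
have V_mono a b : 0 <= a -> a <= b -> b <= t -> V a <= V b.
  by move=> a0 ab bt; rewrite -subr_ge0 (le_trans _ (dF a b a0 ab bt)).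
have L1 : 0 < L + 1 by rewrite ltr_wpDl.
have cth : continuous theta.
  move=> x; apply/cvgrPdist_le => e e0.
  near=> y; rewrite distrC (le_trans (hth _ _))//.
  apply: (@le_trans _ _ ((L + 1) * `|y - x|)).
    by rewrite ler_wpM2r// lerDl.
  rewrite mulrC -ler_pdivlMr// distrC; near: y.
  exists (e / (L + 1)); first by rewrite /= divr_gt0.
  by move=> z /= /ltW.
have mthF : measurable_fun `[0, t] (theta \o F : mR -> mR).
  apply: subspace_continuous_measurable_fun; first exact: measurable_itv.
  by apply: within_continuous_comp cth; exact: (prim_continuous t0 pF).
have bthF : [bounded (theta \o F) x | x in (`[0, t]%classic : set mR)].
  exists (`|theta (F 0)| + L * V t); split; first exact: num_real.
  move=> M KM s /=; rewrite in_itv/= => /andP[s0 st].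
  rewrite (le_trans _ (ltW KM))// -[theta (F s)](subrK (theta (F 0))) addrC.
  rewrite (le_trans (ler_normD _ _))// lerD// (le_trans (hth _ _))//.
  apply: ler_wpM2l => //; rewrite (le_trans (dF 0 s _ _ _))//.
  have -> : V 0 = 0 by rewrite /V set_itv1 Rintegral_set1.
  by rewrite subr0 V_mono.
have IfF : mu.-integrable `[0, t] (EFin \o (fun s => f s * theta (F s))).
  exact: integrableMbounded If mthF bthF.
split => // s /andP[s0 st].
pose H u := Theta (F u) - \int[mu]_(r in `[0, u]) (f r * theta (F r)).
suff : H s = H 0.
  by rewrite /H set_itv1 Rintegral_set1 subr0 /= => <-; rewrite subrK.
apply: (@quadratic_increment_cst s (2 * L) V) => //.
  by apply: continuous_subspaceW cV; apply: subset_itvl; rewrite bnd_simp.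
move=> a b a0 ab bs; have bt := le_trans bs st.
have Iab g : mu.-integrable `[0, t] (EFin \o g) -> mu.-integrable `]a, b] (EFin \o g).
  by move=> Ig; exact: integrable_sub Ig a0 bt.
have IZ c g : mu.-integrable `[0, t] (EFin \o g) ->
    mu.-integrable `]a, b] (EFin \o (fun r => g r * c)).
  move=> /Iab /(integrableZR c (measurable_itvR _)).
  by apply: eq_integrable => // r _; rewrite /= mulrC.
(* A Taylor remainder at [F a], minus the integral of [f] against the oscillation of [theta] along
   [F]; each is at most [L * (V b - V a) ^+ 2]. *)
have -> : H b - H a = (Theta (F b) - Theta (F a) - (F b - F a) * theta (F a)) -
   \int[mu]_(r in `]a, b]) (f r * (theta (F r) - theta (F a))).
  have -> : \int[mu]_(r in `]a, b]) (f r * (theta (F r) - theta (F a))) =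
     \int[mu]_(r in `]a, b]) (f r * theta (F r)) -
     \int[mu]_(r in `]a, b]) (f r * theta (F a)).
    rewrite -RintegralB//; first by apply: eq_Rintegral => r _; rewrite mulrBr.
      exact: Iab.
    exact: IZ.
  rewrite RintegralZr//; last exact: Iab.
  rewrite -(prim_increment pF)// -(Rintegral_increment IfF)// /H; ring.
have VV0 : 0 <= V b - V a by rewrite subr_ge0 V_mono.
rewrite (le_trans (ler_normB _ _))//.
have -> : 2 * L * (V b - V a) ^+ 2 = L * (V b - V a) ^+ 2 + L * (V b - V a) ^+ 2 by ring.
apply: lerD.
  rewrite (le_trans (hTh _ _))// ler_wpM2l//.
  by rewrite -(real_normK (num_real (F b - F a))) lerXn2r ?nnegrE// dF.
have Ith : mu.-integrable `]a, b] (EFin \o (fun r => f r * (theta (F r) - theta (F a)))).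
  have := integrableBR (measurable_itvR _) (Iab _ IfF) (IZ (theta (F a)) _ If).
  by apply: eq_integrable => // r _; rewrite /= mulrBr.
rewrite (le_trans (le_normr_Rintegral _ _))//.
rewrite expr2 mulrA [leRHS]mulrC [in leRHS]dV// -RintegralZr//; last exact: Iab.
apply: le_Rintegral => //.
- exact: integrable_norm_itv.
- by apply: (@eq_integrable _ mR R mu _ _ _ _ _
      (IZ (\int[mu]_(r in `]a, b]) `|f r| * L) _ If')) => // r _; rewrite /= mulrA mulrAC mulrA.
move=> r /=; rewrite in_itv/= => /andP[ar rb].
rewrite normrM ler_wpM2l// (le_trans (hth _ _))// ler_wpM2l//.
rewrite (le_trans (dF a r _ _ _))// ?(ltW ar)// ?(le_trans rb)//.
rewrite -dV// lerB// V_mono// (le_trans a0)//; exact: ltW.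
Unshelve. all: by end_near. Qed.

Lemma prim_lin t (a b : R) F f G g : prim t F f -> prim t G g ->
  prim t (fun s => a * F s + b * G s) (fun s => a * f s + b * g s).
Proof.
move=> pF pG; have [If hF] := pF; have [Ig hG] := pG.
have Z c h (s : R) := @integrableZR _ c h (measurable_itvR `[0, s]).
split.
  exact: integrableDR (measurable_itvR _) (Z _ _ _ If) (Z _ _ _ Ig).
move=> s /[dup] /hF -> /[dup] /hG -> /andP[s0 st].
have Ifs := prim_integrable pF st; have Igs := prim_integrable pG st.
rewrite RintegralD//; [|exact: Z|exact: Z].
by rewrite !RintegralZl//; ring.
Qed.

Lemma prim_sqr t F f : 0 <= t -> prim t F f ->
  prim t (fun s => F s ^+ 2) (fun s => f s * (2 * F s)).
Proof.
move=> t0; apply: (@prim_comp t 2 (fun x => x ^+ 2) (fun x => 2 * x)) => //.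
- by move=> x y; rewrite -mulrBr normrM ger0_norm.
- move=> x y.
  have -> : y ^+ 2 - x ^+ 2 - (y - x) * (2 * x) = (y - x) ^+ 2 by ring.
  by rewrite ger0_norm ?sqr_ge0// -[leLHS]mul1r ler_wpM2r ?sqr_ge0// ler1n.
Qed.

Lemma eq_prim t F F' f f' : F =1 F' -> f =1 f' -> prim t F f -> prim t F' f'.
Proof. by move=> /funext <- /funext <-. Qed.

(** By polarization, [F * G = ((F + G) ^+ 2 - (F - G) ^+ 2) / 4], so the chain rule in one variable
    is enough. *)
Lemma prim_mul t F f G g : 0 <= t -> prim t F f -> prim t G g ->
  prim t (fun s => F s * G s) (fun s => f s * G s + F s * g s).
Proof.
move=> t0 pF pG.
have p1 := prim_sqr t0 (prim_lin 1 1 pF pG).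
have p2 := prim_sqr t0 (prim_lin 1 (-1) pF pG).
apply: eq_prim (prim_lin (4^-1) (- 4^-1) p1 p2) => s /=; by field.
Qed.

Lemma sin_cos_lip (x y : R) :
  `|cos y - cos x| <= `|y - x| /\ `|sin y - sin x| <= `|y - x|.
Proof.
wlog xy : x y / x <= y.
  move=> h; have [|/ltW] := leP x y; first exact: h.
  by move=> /h; rewrite !(distrC y) (distrC (cos x)) (distrC (sin x)).
split.
  have cc : {within `[x, y], continuous (@cos R)}.
    by apply: continuous_subspaceT; exact: continuous_cos.
  have [c _ ->] := MVT_segment xy (fun z _ => is_derive_cos z) cc.
  rewrite normrM -[leRHS]mul1r ler_wpM2r// normrN ler_norml.
  by rewrite sin_geN1 sin_le1.
have cs : {within `[x, y], continuous (@sin R)}.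
  by apply: continuous_subspaceT; exact: continuous_sin.
have [c _ ->] := MVT_segment xy (fun z _ => is_derive_sin z) cs.
by rewrite normrM -[leRHS]mul1r ler_wpM2r// ler_norml cos_geN1 cos_le1.
Qed.

(** The mean value theorem gives slope [df c] with [c] between [x] and [y], and [df] is
    1-Lipschitz. *)
Lemma taylor1_lip (f df : R -> R) (x y : R) :
  (forall z : R, is_derive z 1 f (df z)) -> continuous f ->
  (forall u v, `|df v - df u| <= `|v - u|) ->
  `|f y - f x - (y - x) * df x| <= 1 * (y - x) ^+ 2.
Proof.
move=> hf cf ldf; rewrite mul1r.
have aux (a b : R) : a <= b -> exists2 c, `|c - a| <= b - a /\ `|c - b| <= b - a &
    f b - f a = df c * (b - a).
  move=> ab; have cf' : {within `[a, b], continuous f} by exact: continuous_subspaceT.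
  have [c] := MVT_segment ab (fun z _ => hf z) cf'.
  rewrite in_itv/= => /andP[ac cb] e; exists c => //.
  by rewrite ger0_norm ?subr_ge0// ler0_norm ?subr_le0//; split; lra.
have main (c : R) : f y - f x = df c * (y - x) -> `|c - x| <= `|y - x| ->
    `|f y - f x - (y - x) * df x| <= (y - x) ^+ 2.
  move=> -> cx; rewrite [X in `|X|](_ : _ = (df c - df x) * (y - x)); last by ring.
  rewrite normrM -(ger0_norm (sqr_ge0 (y - x))) normrX expr2 ler_wpM2r//.
  exact: le_trans (ldf _ _) cx.
have [xy|/ltW yx] := leP x y.
  have [c [h1 h2] e] := aux x y xy; apply: (main c) => //.
  by rewrite (@ger0_norm _ (y - x)) ?subr_ge0.
have [c [h1 h2] e] := aux y x yx; apply: (main c).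
  by rewrite -(opprB (f x)) e; ring.
by rewrite (distrC y) (@ger0_norm _ (x - y)) ?subr_ge0.
Qed.

Lemma prim_cos t F f : 0 <= t -> prim t F f ->
  prim t (cos \o F) (fun s => f s * - sin (F s)).
Proof.
move=> t0; apply: (@prim_comp t 1 cos (fun x => - sin x)) => // x y.
  by rewrite opprK addrC distrC mul1r; exact: (sin_cos_lip x y).2.
apply: (taylor1_lip _ _ (fun z => is_derive_cos z) (@continuous_cos R)) => u v.
by rewrite opprK addrC distrC; exact: (sin_cos_lip u v).2.
Qed.

Lemma prim_sin t F f : 0 <= t -> prim t F f ->
  prim t (sin \o F) (fun s => f s * cos (F s)).
Proof.
move=> t0; apply: (@prim_comp t 1 sin cos) => // x y.
  by rewrite mul1r; exact: (sin_cos_lip x y).1.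
apply: (taylor1_lip _ _ (fun z => is_derive_sin z) (@continuous_sin R)) => u v.
exact: (sin_cos_lip u v).1.
Qed.

(* A forcing term orthogonal to [U] up to [h] acts on the length of [U] only
   through [h]; the argument runs on [|U|^2] at the point where it is maximal. *)
Lemma orthogonal_forcing t (U1 F1 U2 F2 h : R -> R) : 0 <= t ->
  prim t U1 F1 -> prim t U2 F2 -> mu.-integrable `[0, t] (EFin \o h) ->
  (forall s : R, 0 <= h s) ->
  {ae mu, forall s : R, 0 <= s <= t ->
     U1 s * F1 s + U2 s * F2 s <= (`|U1 s| + `|U2 s|) * h s} ->
  `|U1 t| + `|U2 t| <=
    2 * (`|U1 0| + `|U2 0|) + 4 * \int[mu]_(s in `[0, t]) h s.
Proof.
move=> t0 p1 p2 Ih h0 UF.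
pose n s := `|U1 s| + `|U2 s|.
have cn : {within `[0, t], continuous n}.
  apply: within_continuousD.
    by apply: within_continuous_comp (@norm_continuous _ _); exact: (prim_continuous t0 p1).
  by apply: within_continuous_comp (@norm_continuous _ _); exact: (prim_continuous t0 p2).
have [c] := EVT_max t0 cn; rewrite in_itv/= => /andP[c0 ct] hc.
have n0 s : 0 <= n s by rewrite addr_ge0.
have Ih0 : 0 <= \int[mu]_(s in `[0, t]) h s by apply: Rintegral_ge0.
have nt : n t <= n c by apply: hc; rewrite in_itv/= t0 lexx.
have n0c : n 0 <= n c by apply: hc; rewrite in_itv/= lexx t0.
suff : n c <= 2 * n 0 + 4 * \int[mu]_(s in `[0, t]) h s by exact: le_trans.
have [nc0|nc0] := eqVneq (n c) 0.
  by rewrite nc0 addr_ge0// mulr_ge0.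
have nc : 0 < n c by rewrite lt_def nc0 n0.
(* At the maximum [c], [n c ^+ 2] is at most twice the squared length, hence at most
   [2 * n 0 * n c + 4 * n c * \int h]; the factor [n c] cancels. This avoids differentiating a
   length where it may vanish. *)
rewrite -(ler_pM2l nc).
have pE := prim_lin 1 1 (prim_sqr t0 p1) (prim_sqr t0 p2).
have EE := pE.2 c; rewrite c0 ct in EE; have {}EE := EE isT; cbv beta in EE.
have hint : \int[mu]_(r in `[0, c]) (1 * (F1 r * (2 * U1 r)) + 1 * (F2 r * (2 * U2 r)))
    <= (2 * n c) * \int[mu]_(s in `[0, t]) h s.
  have Ihc : mu.-integrable `[0, c] (EFin \o h).
    by apply: integrableS Ih => //; apply: subset_itvl; rewrite bnd_simp.
  apply: (@le_trans _ _ (\int[mu]_(r in `[0, c]) (2 * n c * h r))).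
    apply: ae_le_Rintegral => //; first exact: prim_integrable pE ct.
      exact: integrableZR (measurable_itvR _) Ihc.
    move: UF; apply: filterS => s UF /=; rewrite in_itv/= => /andP[s0 sc].
    have st := le_trans sc ct.
    have ns : n s <= n c by apply: hc; rewrite in_itv/= s0 st.
    have := UF; rewrite s0 st => /(_ isT) {}UF.
    have := ler_wpM2r (h0 s) ns; rewrite /n in ns *; nra.
  rewrite RintegralZl//; apply: ler_wpM2l; first by rewrite mulr_ge0.
  rewrite /Rintegral fine_le//.
  - exact: integrable_fin_num.
  - exact: integrable_fin_num.
  apply: ge0_subset_integral => //.
  - by apply: (measurable_int mu); exact: Ih.
  - by move=> x _; rewrite lee_fin.
  - by apply: subset_itvl; rewrite bnd_simp.
have hq : n c * n c <= 2 * (1 * U1 c ^+ 2 + 1 * U2 c ^+ 2).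
  rewrite /n -(real_normK (num_real (U1 c))) -(real_normK (num_real (U2 c))).
  have := sqr_ge0 (`|U1 c| - `|U2 c|); nra.
have hq0 : 1 * U1 0 ^+ 2 + 1 * U2 0 ^+ 2 <= n 0 * n c.
  rewrite -(real_normK (num_real (U1 0))) -(real_normK (num_real (U2 0))).
  apply: (@le_trans _ _ (n 0 * n 0)); last exact: ler_wpM2l.
  have := normr_ge0 (U1 0); have := normr_ge0 (U2 0); rewrite /n; nra.
move: hq; rewrite EE => hq; nra.
Qed.

End Primitive.


(** * The system in real components *)

Section RealSystem.
Context {R : realType}.
Local Notation mu := (@lebesgue_measure R).
Local Notation mR := (measurableTypeR R).
Local Notation mfun1 := (measurable_fun [set: mR]).
Local Notation mfun2 := (measurable_fun [set: (mR * mR)%type]).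

Lemma measurable_slice (f : R * R -> R) (t : R) : mfun2 f -> mfun1 (fun x => f (t, x)).
Proof. by move=> mf; apply: (measurableT_comp mf); exact: measurable_fun_pair. Qed.

(** Up to time [T] the operator [J] only sees times in [[0, T]], so [w] may be replaced by zero
    elsewhere to obtain a global bound. *)
Lemma gronwall_strip (p : \bar R) (T C G K : R) (w g : R * R -> R) :
  (1 <= p)%E -> 0 <= T -> 0 < C -> mfun2 w ->
  (forall z : R * R, 0 <= z.1 <= T -> 0 <= w z <= K) ->
  (forall t : R, 0 <= t <= T -> mfun1 (fun x => g (t, x)) /\
     nle p G (fun x => g (t, x))) ->
  (forall t : R, 0 <= t <= T -> {ae mu, forall x,
     w (t, x) <= g (t, x) + C * (J true w (t, x) + J false w (t, x))}) ->
  forall t : R, 0 <= t <= T ->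
    nle p (2 * G * expR (4 * C * t)) (fun x => w (t, x)).
Proof.
move=> p1 T0 C0 mw wK hg hw t tT.
pose v (z : R * R) : R := if 0 <= z.1 <= T then w z else 0.
have mv : mfun2 v.
  apply: measurable_fun_ifT => //.
  by apply: measurable_and; apply: measurable_fun_ler => //.
have K0 : 0 <= K.
  have T00 : 0 <= ((0, 0) : R * R).1 <= T by rewrite /= lexx.
  by have /andP[] := wK _ T00; exact: le_trans.
have vE s x : 0 <= s <= T -> v (s, x) = w (s, x) by rewrite /v /= => ->.
have JE b s x : 0 <= s <= T -> J b w (s, x) = J b v (s, x).
  move=> /andP[s0 sT]; rewrite /J; apply: eq_Rintegral => r.
  by rewrite inE /= in_itv/= => /andP[r0 rs]; rewrite vE// r0 (le_trans rs).
rewrite (_ : (fun x => w (t, x)) = (fun x => v (t, x))); last first.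
  by apply/funext => x; rewrite vE.
apply: (@gronwall R p T C G K v g) => //.
- by move=> z; rewrite /v; case: ifP => [/wK//|_]; rewrite lexx K0.
- move=> s sT; move: (hw s sT); apply: filterS => x.
  by rewrite !JE// vE.
Qed.

(** All points of a characteristic lie on the same one, so along it [J b f] is an ordinary
    primitive. *)
Lemma J_char b (f : R * R -> R) (t x s : R) :
  J b f (s, x - sg b * (t - s)) =
  \int[mu]_(r in `[0, s]) f (r, x - sg b * (t - r)).
Proof.
by rewrite /J /=; apply: eq_Rintegral => r _; congr (f (_, _)); ring.
Qed.

Definition integrable_along b (f : R * R -> R) (z : R * R) :=
  mu.-integrable `[0, z.1] (EFin \o (fun s => f (s, z.2 - sg b * (z.1 - s)))).

Lemma prim_J b (f : R * R -> R) (c t x : R) : 0 <= t ->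
  integrable_along b f (t, x) ->
  prim t (fun s => c + J b f (s, x - sg b * (t - s)))
         (fun s => f (s, x - sg b * (t - s))).
Proof.
move=> t0 If; split => // s /andP[s0 st].
by rewrite !J_char set_itv1 Rintegral_set1 addr0.
Qed.

Lemma bounded_along b (f : R * R -> R) (K : R) (z : R * R) :
  mfun2 f -> (forall s y : R, 0 <= s <= z.1 -> `|f (s, y)| <= K) ->
  integrable_along b f z.
Proof. by move=> mf fK; exact: integrable_char fK. Qed.

Lemma alongD b (f g : R * R -> R) z : integrable_along b f z ->
  integrable_along b g z -> integrable_along b (fun z => f z + g z) z.
Proof. by move=> If Ig; exact: (integrableDR (measurable_itvR _) If Ig). Qed.

Lemma alongB b (f g : R * R -> R) z : integrable_along b f z ->
  integrable_along b g z -> integrable_along b (fun z => f z - g z) z.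
Proof. by move=> If Ig; exact: (integrableBR (measurable_itvR _) If Ig). Qed.

Lemma alongZ b (c : R) (f : R * R -> R) z : integrable_along b f z ->
  integrable_along b (fun z => c * f z) z.
Proof. by move=> If; exact: (integrableZR c (measurable_itvR _) If). Qed.

Lemma along_norm b (f : R * R -> R) z : integrable_along b f z ->
  integrable_along b (fun z => `|f z|) z.
Proof. by move=> If; exact: (integrable_norm_itv If). Qed.

Lemma alongM b (f g : R * R -> R) (K : R) z : mfun2 g ->
  (forall s y : R, 0 <= s <= z.1 -> `|g (s, y)| <= K) ->
  integrable_along b f z -> integrable_along b (fun z => f z * g z) z.
Proof.
move=> mg gK If.
apply: (integrableMbounded (g := fun s => g (s, z.2 - sg b * (z.1 - s))) (measurable_itvR _) If).
  exact: measurable_funS (measurable_char b z.1 z.2 mg).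
exists K; split; first exact: num_real.
move=> M KM s /=; rewrite in_itv/= => sz; exact: le_trans (gK _ _ sz) (ltW KM).
Qed.

Lemma JD b (f g : R * R -> R) z : integrable_along b f z -> integrable_along b g z ->
  J b (fun z => f z + g z) z = J b f z + J b g z.
Proof. by move=> If Ig; rewrite /J RintegralD. Qed.

Lemma JB b (f g : R * R -> R) z : integrable_along b f z -> integrable_along b g z ->
  J b (fun z => f z - g z) z = J b f z - J b g z.
Proof. by move=> If Ig; rewrite /J RintegralB. Qed.

Lemma JZ b (c : R) (f : R * R -> R) z : integrable_along b f z ->
  J b (fun z => c * f z) z = c * J b f z.
Proof. by move=> If; rewrite /J RintegralZl. Qed.

Lemma le_J b (f g : R * R -> R) z : integrable_along b f z -> integrable_along b g z ->
  (forall s y : R, 0 <= s <= z.1 -> f (s, y) <= g (s, y)) -> J b f z <= J b g z.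
Proof.
move=> If Ig fg; apply: le_Rintegral => // s /=; rewrite in_itv/=.
exact: fg.
Qed.

Lemma norm_J b (f : R * R -> R) z : integrable_along b f z ->
  `|J b f z| <= J b (fun z => `|f z|) z.
Proof. by move=> If; exact: le_normr_Rintegral. Qed.

Lemma J_cst b (c : R) z : 0 <= z.1 -> J b (fun=> c) z = c * z.1.
Proof.
move=> z0; rewrite /J Rintegral_cst//.
by rewrite [X in fine X](lebesgue_measure_cc z0) subr0.
Qed.

Lemma J_bound b (f : R * R -> R) (K : R) z : mfun2 f -> 0 <= z.1 ->
  (forall s y : R, 0 <= s <= z.1 -> `|f (s, y)| <= K) -> `|J b f z| <= K * z.1.
Proof.
move=> mf z0 fK; have If := bounded_along b mf fK.
apply: (le_trans (norm_J If)); rewrite -(J_cst b K z0).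
apply: le_J => //; first exact: along_norm.
apply: (@bounded_along _ _ `|K|) => //; exact: measurable_cst.
Qed.

Variable m : R.
Hypothesis m0 : 0 <= m.

(* With [psi_b = P b + i * Q b], [rho] is the charge density. *)
Definition rho (P Q : bool -> R * R -> R) (z : R * R) : R :=
  2^-1 * (P true z ^+ 2 + Q true z ^+ 2 + (P false z ^+ 2 + Q false z ^+ 2)).

(** The Chern-Simons equation solved for [A_b]: the potential becomes a functional of the spinor and
    is no longer an unknown. *)
Definition gauge (B0 : bool -> R -> R) (P Q : bool -> R * R -> R) b (z : R * R) : R :=
  B0 b (z.2 - sg b * z.1) - sg b * J b (rho P Q) z.

(** [forceP] and [forceQ] are the real and imaginary parts of [i A_(-b) psi_b - i m psi_(-b)]. *)
Definition forceP (B P Q : bool -> R * R -> R) b (z : R * R) : R :=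
  - (B (~~ b) z * Q b z) + m * Q (~~ b) z.

Definition forceQ (B P Q : bool -> R * R -> R) b (z : R * R) : R :=
  B (~~ b) z * P b z - m * P (~~ b) z.

(** The bound is required at every point, so that integrals exist along every characteristic rather
    than almost every one. *)
Definition bounded_state (T K : R) (P Q : bool -> R * R -> R) :=
  forall b, [/\ mfun2 (P b), mfun2 (Q b) &
    forall z : R * R, 0 <= z.1 <= T -> `|P b z| <= K /\ `|Q b z| <= K].

Definition real_solution (T : R) (P0 Q0 B0 : bool -> R -> R) (P Q : bool -> R * R -> R) :=
  forall b (t : R), 0 <= t <= T -> {ae mu, forall x,
    P b (t, x) = P0 b (x - sg b * t) + J b (forceP (gauge B0 P Q) P Q b) (t, x) /\
    Q b (t, x) = Q0 b (x - sg b * t) + J b (forceQ (gauge B0 P Q) P Q b) (t, x)}.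

Lemma bounded_state_ge0 T K P Q : 0 <= T -> bounded_state T K P Q -> 0 <= K.
Proof.
move=> T0 st; have [_ _ /(_ (0, 0))] := st true.
by rewrite /= lexx T0 => /(_ isT)[h _]; exact: le_trans h.
Qed.

Definition mod1 (P Q : bool -> R * R -> R) b (z : R * R) : R := `|P b z| + `|Q b z|.
Definition mod2 P Q (z : R * R) : R := mod1 P Q true z + mod1 P Q false z.

Lemma mod1_ge0 P Q b z : 0 <= mod1 P Q b z.
Proof. by rewrite addr_ge0. Qed.

Lemma mod2_ge0 P Q z : 0 <= mod2 P Q z.
Proof. by rewrite addr_ge0// mod1_ge0. Qed.

Lemma mod1_le_mod2 P Q b z : mod1 P Q b z <= mod2 P Q z.
Proof.
by rewrite /mod2; case: b; [rewrite lerDl|rewrite lerDr]; exact: mod1_ge0.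
Qed.

Lemma measurable_rho P Q T K : bounded_state T K P Q -> mfun2 (rho P Q).
Proof.
move=> st; apply: measurable_funM => //.
have h b : mfun2 (fun z => P b z ^+ 2 + Q b z ^+ 2).
  by have [mP mQ _] := st b; apply: measurable_funD; exact: measurable_funX.
exact: measurable_funD.
Qed.

Lemma rho_bound T K P Q z : bounded_state T K P Q -> 0 <= z.1 <= T ->
  `|rho P Q z| <= 2 * K ^+ 2.
Proof.
move=> st zT.
have h b : P b z ^+ 2 + Q b z ^+ 2 <= 2 * K ^+ 2.
  have [_ _ /(_ z zT)[h1 h2]] := st b.
  have K0 : 0 <= K by exact: le_trans h1.
  rewrite -(real_normK (num_real (P b z))) -(real_normK (num_real (Q b z))).
  have := lerXn2r 2 (normr_ge0 _) K0 h1; have := lerXn2r 2 (normr_ge0 _) K0 h2.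
  by rewrite /= => ? ?; lra.
rewrite ger0_norm; last by rewrite mulr_ge0// !addr_ge0// sqr_ge0.
by rewrite /rho; have := h true; have := h false; lra.
Qed.

Lemma measurable_free (a : R -> R) (c : R) : mfun1 a ->
  mfun2 (fun z => a (z.2 - c * z.1)).
Proof.
move=> ma; apply: (measurableT_comp ma).
by apply: measurable_funB => //; apply: measurable_funM.
Qed.

Lemma measurable_gauge B0 P Q T K b : (forall b, mfun1 (B0 b)) ->
  bounded_state T K P Q -> mfun2 (gauge B0 P Q b).
Proof.
move=> mB st; apply: measurable_funB; first exact: measurable_free.
by apply: measurable_funM => //; apply: measurable_J; exact: measurable_rho st.
Qed.

Lemma transversal_integrable p (c : R) (a : R -> R) b (z : R * R) : (1 <= p)%E ->
  mfun1 a -> nle p c a -> 0 <= z.1 ->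
  integrable_along b (fun z => a (z.2 + sg b * z.1)) z.
Proof.
move=> p1 ma ha z0.
have mf : mfun1 (fun s => a (z.2 - sg b * (z.1 - s) + sg b * s)).
  rewrite (_ : (fun s => _) = (fun s => a (2 * sg b * s + (z.2 - sg b * z.1)))).
    by apply: (measurableT_comp ma); exact: measurable_affine.
  by apply/funext => s; congr (a _); ring.
apply/integrableP; split.
  by apply/measurable_EFinP; exact: measurable_funS mf.
by rewrite (le_lt_trans (transversal_bound z.2 b p1 ma ha z0))// ltry.
Qed.

(** The opposite sign [~~ b] is essential: the free wave of the other family crosses the
    characteristic transversally, which gives integrability for data merely in [L^p]. The density
    part is bounded. *)
Lemma gauge_integrable p (c : R) B0 P Q T K b (z : R * R) : (1 <= p)%E ->
  (forall b, mfun1 (B0 b)) -> (forall b, nle p c (B0 b)) ->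
  bounded_state T K P Q -> 0 <= z.1 <= T ->
  integrable_along b (gauge B0 P Q (~~ b)) z.
Proof.
move=> p1 mB nB st /andP[z0 zT].
apply: alongB.
  have := transversal_integrable b p1 (mB (~~ b)) (nB (~~ b)) z0.
  rewrite (_ : (fun z => _) = (fun z : R * R => B0 (~~ b) (z.2 - sg (~~ b) * z.1)))//.
  by apply/funext => u; rewrite sgN mulNr opprK.
apply: alongZ; apply: (@bounded_along _ _ (2 * K ^+ 2 * z.1)).
  by apply: measurable_J; exact: measurable_rho st.
move=> s y /andP[s0 sz]; have mr := measurable_rho st.
have Kz : 0 <= 2 * K ^+ 2 by rewrite mulr_ge0// sqr_ge0.
apply: (@le_trans _ _ (2 * K ^+ 2 * s)); last exact: ler_wpM2l.
apply: (@J_bound _ _ _ (s, y)) => // r u /= /andP[r0 rs].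
by apply: (rho_bound st); rewrite /= r0 (le_trans rs)// (le_trans sz).
Qed.

End RealSystem.


(** * Stability *)

Section Stability.
Context {R : realType}.
Local Notation mu := (@lebesgue_measure R).
Local Notation mR := (measurableTypeR R).
Local Notation mfun1 := (measurable_fun [set: mR]).
Local Notation mfun2 := (measurable_fun [set: (mR * mR)%type]).
Variables (m : R) (p : \bar R).
Hypotheses (m0 : 0 <= m) (p1 : (1 <= p)%E).

Lemma measurable_eq_set (f g : R * R -> R) : mfun2 f -> mfun2 g ->
  measurable [set z : mR * mR | f z = g z].
Proof.
move=> mf mg.
rewrite (_ : mkset _ = [set z | f z <= g z] `&` [set z | g z <= f z]).
  by apply: measurableI; rewrite -[X in measurable X]setTI; exact: measurable_fun_le.
apply/seteqP; split => z /=; first by move=> ->; rewrite lexx.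
by move=> [h1 h2]; apply/eqP; rewrite eq_le h1.
Qed.

Lemma force_measurable B0 T K (P Q : bool -> R * R -> R) b : (forall b, mfun1 (B0 b)) ->
  bounded_state T K P Q ->
  mfun2 (forceP m (gauge B0 P Q) P Q b) /\ mfun2 (forceQ m (gauge B0 P Q) P Q b).
Proof.
move=> mB st; have mg := measurable_gauge (~~ b) mB st.
have [mP mQ _] := st b; have [mPn mQn _] := st (~~ b).
split.
  apply: measurable_funD; last exact: measurable_funM.
  by apply: measurableT_comp => //; exact: measurable_funM.
by apply: measurable_funB; exact: measurable_funM.
Qed.

Lemma force_integrable B0 (c T K : R) (P Q : bool -> R * R -> R) b (z : R * R) :
  (forall b, mfun1 (B0 b)) -> (forall b, nle p c (B0 b)) ->
  bounded_state T K P Q -> 0 <= z.1 <= T ->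
  integrable_along b (forceP m (gauge B0 P Q) P Q b) z /\
  integrable_along b (forceQ m (gauge B0 P Q) P Q b) z.
Proof.
move=> mB nB st zT; have Ig := gauge_integrable b p1 mB nB st zT.
have [mP mQ KPQ] := st b; have [mPn mQn KPQn] := st (~~ b).
have sT (s : R) : 0 <= s <= z.1 -> 0 <= s <= T.
  by move=> /andP[-> sz]; case/andP: zT => _; exact: le_trans.
have bd b' (f : R * R -> R) : mfun2 f ->
    (forall u : R * R, 0 <= u.1 <= T -> `|f u| <= K) -> integrable_along b' f z.
  by move=> mf fK; apply: (@bounded_along _ _ _ K) => // s y /sT sT'; exact: (fK (s, y)).
split.
  have IBQ : integrable_along b (fun z => gauge B0 P Q (~~ b) z * Q b z) z.
    by apply: (@alongM _ _ _ _ K) => // s y /sT sT'; exact: (KPQ (s, y) sT').2.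
  have ImQ : integrable_along b (fun z => m * Q (~~ b) z) z.
    by apply: alongZ; apply: bd => // u uT; exact: (KPQn u uT).2.
  have := alongD (alongZ (-1) IBQ) ImQ; rewrite /forceP.
  rewrite (_ : (fun z => _ + _) = (fun z => - (gauge B0 P Q (~~ b) z * Q b z) + m * Q (~~ b) z))//.
  by apply/funext => u; rewrite mulN1r.
have IBP : integrable_along b (fun z => gauge B0 P Q (~~ b) z * P b z) z.
  by apply: (@alongM _ _ _ _ K) => // s y /sT sT'; exact: (KPQ (s, y) sT').1.
have ImP : integrable_along b (fun z => m * P (~~ b) z) z.
  by apply: alongZ; apply: bd => // u uT; exact: (KPQn u uT).1.
exact: alongB IBP ImP.
Qed.

Section two_solutions.
Variables (T K c c' : R) (P0 Q0 B0 P0' Q0' B0' : bool -> R -> R).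
Variables (P Q P' Q' : bool -> R * R -> R).
Hypotheses (mP0 : forall b, mfun1 (P0 b)) (mQ0 : forall b, mfun1 (Q0 b)).
Hypotheses (mP0' : forall b, mfun1 (P0' b)) (mQ0' : forall b, mfun1 (Q0' b)).
Hypotheses (mB : forall b, mfun1 (B0 b)) (nB : forall b, nle p c (B0 b)).
Hypotheses (mB' : forall b, mfun1 (B0' b)) (nB' : forall b, nle p c' (B0' b)).
Hypotheses (st : bounded_state T K P Q) (st' : bounded_state T K P' Q').
Hypotheses (sol : real_solution m T P0 Q0 B0 P Q).
Hypotheses (sol' : real_solution m T P0' Q0' B0' P' Q').

Let dP b (z : R * R) : R := P b z - P' b z.
Let dQ b (z : R * R) : R := Q b z - Q' b z.
Let dB b (z : R * R) : R := gauge B0 P Q b z - gauge B0' P' Q' b z.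

(** The part of the forcing of a difference that survives orthogonality: the difference of
    potentials acts on the second solution, and the mass couples to the other sign. *)
Definition coupling b (z : R * R) : R := `|dB (~~ b) z| * mod1 P' Q' b z + m * mod1 dP dQ (~~ b) z.

Lemma coupling_integrable b (z : R * R) : 0 <= z.1 <= T -> integrable_along b (coupling b) z.
Proof.
move=> zT.
have sT (s : R) : 0 <= s <= z.1 -> 0 <= s <= T.
  by move=> /andP[-> sz]; case/andP: zT => _; exact: le_trans.
have IdB : integrable_along b (dB (~~ b)) z.
  apply: alongB; first exact: gauge_integrable p1 mB nB st zT.
  exact: gauge_integrable p1 mB' nB' st' zT.
have [mP mQ KPQ] := st (~~ b); have [mP' mQ' KPQ'] := st' (~~ b).
have [mPb' mQb' KPQb'] := st' b.
apply: alongD.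
  apply: (@alongM _ _ _ _ (K + K)) (along_norm IdB).
    by apply: measurable_funD; exact: measurableT_comp.
  move=> s y /sT sT'; have [h1 h2] := KPQb' (s, y) sT'.
  by rewrite ger0_norm ?mod1_ge0// lerD.
apply: alongZ; apply: (@bounded_along _ _ _ (2 * (K + K))).
  by apply: measurable_funD; apply: measurableT_comp => //; exact: measurable_funB.
move=> s y /sT sT'; have [h1 h2] := KPQ (s, y) sT'; have [h3 h4] := KPQ' (s, y) sT'.
rewrite ger0_norm ?mod1_ge0// /mod1 /dP /dQ.
have := ler_normB (P (~~ b) (s, y)) (P' (~~ b) (s, y)).
have := ler_normB (Q (~~ b) (s, y)) (Q' (~~ b) (s, y)).
lra.
Qed.

(** The difference of the forces is [B] times the rotated difference [(- Y, X)], plus [B - B'] times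
    the rotated second solution, plus mass terms. The first is orthogonal to [(X, Y)], so no size of
    [B] enters. *)
Lemma forcing_orthogonality (B B' x x' y y' u u' v v' : R) :
  (x - x') * ((- (B * y) + m * v) - (- (B' * y') + m * v')) +
  (y - y') * ((B * x - m * u) - (B' * x' - m * u')) <=
  (`|x - x'| + `|y - y'|) *
    (`|B - B'| * (`|x'| + `|y'|) + m * (`|u - u'| + `|v - v'|)).
Proof.
set X := x - x'; set Y := y - y'; set D := B - B'; set U := u - u'; set V := v - v'.
have -> : X * (- (B * y) + m * v - (- (B' * y') + m * v')) +
    Y * (B * x - m * u - (B' * x' - m * u')) =
    D * (Y * x' - X * y') + m * (X * V - Y * U).
  by rewrite /X /Y /D /U /V; ring.
have n1 : D * (Y * x' - X * y') <= `|D| * (`|Y| * `|x'| + `|X| * `|y'|).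
  rewrite (le_trans (ler_norm _))// normrM ler_wpM2l//.
  by rewrite (le_trans (ler_normB _ _))// !normrM.
have n2 : X * V - Y * U <= `|X| * `|V| + `|Y| * `|U|.
  by rewrite (le_trans (ler_norm _))// (le_trans (ler_normB _ _))// !normrM.
have := ler_wpM2l m0 n2.
have pos (a b : R) : 0 <= `|a| * `|b| by rewrite mulr_ge0.
have := mulr_ge0 (normr_ge0 D) (addr_ge0 (pos X x') (pos Y y')).
have := mulr_ge0 m0 (addr_ge0 (pos X U) (pos Y V)).
lra.
Qed.

Lemma transport_inequality b (t : R) : 0 <= t <= T ->
  {ae mu, forall x, mod1 dP dQ b (t, x) <=
    2 * (`|P0 b (x - sg b * t) - P0' b (x - sg b * t)| +
         `|Q0 b (x - sg b * t) - Q0' b (x - sg b * t)|) +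
    4 * J b (coupling b) (t, x)}.
Proof.
move=> /[dup] tT /andP[t0 tleT].
have [mFP mFQ] := force_measurable b mB st.
have [mFP' mFQ'] := force_measurable b mB' st'.
have [mP mQ _] := st b; have [mP' mQ' _] := st' b.
have sT (s : R) : 0 <= s <= t -> 0 <= s <= T.
  by move=> /andP[-> st1]; exact: le_trans tleT.
have key (u f : R * R -> R) (a : R -> R) : mfun2 u -> mfun2 f -> mfun1 a ->
    (forall s : R, 0 <= s <= t ->
       {ae mu, forall y, u (s, y) = a (y - sg b * s) + J b f (s, y)}) ->
    {ae mu, forall x, {ae mu, forall s, 0 <= s <= t ->
       u (s, x - sg b * (t - s)) = a (x - sg b * (t - s) - sg b * s) +
         J b f (s, x - sg b * (t - s))}}.
  move=> mu_ mf ma.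
  have mrhs : mfun2 (fun z => a (z.2 - sg b * z.1) + J b f z).
    by apply: measurable_funD; [exact: measurable_free|exact: measurable_J].
  exact: (@ae_char R b t _ (measurable_eq_set mu_ mrhs)).
have e1 := key _ _ _ mP mFP (mP0 b) (fun s h => ae_mono (fun x hx => proj1 hx) (sol b (sT s h))).
have e2 := key _ _ _ mQ mFQ (mQ0 b) (fun s h => ae_mono (fun x hx => proj2 hx) (sol b (sT s h))).
have e3 := key _ _ _ mP' mFP' (mP0' b) (fun s h => ae_mono (fun x hx => proj1 hx) (sol' b (sT s h))).
have e4 := key _ _ _ mQ' mFQ' (mQ0' b) (fun s h => ae_mono (fun x hx => proj2 hx) (sol' b (sT s h))).
have e12 := ae_conj e1 e2; have e34 := ae_conj e3 e4.
(* The equations at time [t] are added separately: a statement for almost every [s] says nothing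
   about the endpoint [s = t]. *)
have e1234 := ae_conj e12 e34; have ee := ae_conj (sol b tT) (sol' b tT).
move: (ae_conj e1234 ee); apply: filterS => x [[[{}e1 {}e2] [{}e3 {}e4]] [[eP eQ] [eP' eQ']]].
have zT : 0 <= ((t, x) : R * R).1 <= T by [].
have [IFP IFQ] := force_integrable b (z := (t, x)) mB nB st zT.
have [IFP' IFQ'] := force_integrable b (z := (t, x)) mB' nB' st' zT.
pose y := x - sg b * t.
(* The right-hand sides of the equations are absolutely continuous along the whole characteristic;
   the differences of solutions agree with them for almost every [s] and at [t]. *)
pose u1 s := 1 * (P0 b y + J b (forceP m (gauge B0 P Q) P Q b) (s, x - sg b * (t - s))) +
  (-1) * (P0' b y + J b (forceP m (gauge B0' P' Q') P' Q' b) (s, x - sg b * (t - s))).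
pose u2 s := 1 * (Q0 b y + J b (forceQ m (gauge B0 P Q) P Q b) (s, x - sg b * (t - s))) +
  (-1) * (Q0' b y + J b (forceQ m (gauge B0' P' Q') P' Q' b) (s, x - sg b * (t - s))).
have p1' := prim_lin 1 (-1) (prim_J (P0 b y) t0 IFP) (prim_J (P0' b y) t0 IFP').
have p2' := prim_lin 1 (-1) (prim_J (Q0 b y) t0 IFQ) (prim_J (Q0' b y) t0 IFQ').
have Ih : mu.-integrable `[0, t] (EFin \o (fun s => coupling b (s, x - sg b * (t - s)))).
  exact: (coupling_integrable b (z := (t, x))).
have h0 s : 0 <= coupling b (s, x - sg b * (t - s)).
  by rewrite addr_ge0// mulr_ge0// mod1_ge0.
have := @orthogonal_forcing R t u1 _ u2 _ (fun s => coupling b (s, x - sg b * (t - s))) t0 p1' p2' Ih h0.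
have -> : \int[mu]_(s in `[0, t]) coupling b (s, x - sg b * (t - s)) = J b (coupling b) (t, x) by [].
have path0 s : x - sg b * (t - s) - sg b * s = y by rewrite /y; ring.
have J0 f : J b f (0, x - sg b * (t - 0)) = 0.
  by rewrite /J /= set_itv1 Rintegral_set1.
have -> : u1 0 = P0 b y - P0' b y by rewrite /u1 !J0; ring.
have -> : u2 0 = Q0 b y - Q0' b y by rewrite /u2 !J0; ring.
have -> : u1 t = dP b (t, x).
  by rewrite /u1 /dP eP eP' subrr mulr0 subr0 -/y; ring.
have -> : u2 t = dQ b (t, x).
  by rewrite /u2 /dQ eQ eQ' subrr mulr0 subr0 -/y; ring.
apply.
move: (ae_conj (ae_conj e1 e2) (ae_conj e3 e4)); apply: filterS => s [[{}e1 {}e2] [{}e3 {}e4]] h.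
have := e1 h; have := e2 h; have := e3 h; have := e4 h => {e1 e2 e3 e4} /= e4 e3 e2 e1.
rewrite !path0 in e1 e2 e3 e4.
rewrite /u1 /u2 -e1 -e2 -e3 -e4 !mul1r !mulN1r.
exact: forcing_orthogonality.
Qed.

Lemma le_rho (z : R * R) : 0 <= z.1 <= T ->
  `|rho P Q z - rho P' Q' z| <= K * mod2 dP dQ z.
Proof.
move=> zT.
have sq (a a' : R) : `|a| <= K -> `|a'| <= K -> `|a ^+ 2 - a' ^+ 2| <= 2 * K * `|a - a'|.
  move=> h1 h2; rewrite subr_sqr normrM mulrC ler_wpM2r//.
  by have := ler_normD a a'; lra.
have [_ _ /(_ z zT)[a1 a2]] := st true; have [_ _ /(_ z zT)[a3 a4]] := st false.
have [_ _ /(_ z zT)[b1 b2]] := st' true; have [_ _ /(_ z zT)[b3 b4]] := st' false.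
have := sq _ _ a1 b1; have := sq _ _ a2 b2; have := sq _ _ a3 b3; have := sq _ _ a4 b4.
rewrite /rho /mod2 /mod1 /dP /dQ.
set X1 := _ ^+ 2 - _ ^+ 2; set X2 := _ ^+ 2 - _ ^+ 2.
set X3 := _ ^+ 2 - _ ^+ 2; set X4 := _ ^+ 2 - _ ^+ 2 => h1 h2 h3 h4.
rewrite [X in `|X|](_ : _ = 2^-1 * ((X4 + X3) + (X2 + X1))); last first.
  by rewrite /X1 /X2 /X3 /X4; field.
rewrite normrM ger0_norm//.
have := ler_normD (X4 + X3) (X2 + X1); have := ler_normD X4 X3; have := ler_normD X2 X1.
lra.
Qed.

Lemma measurable_mod2 : mfun2 (mod2 dP dQ).
Proof.
apply: measurable_funD; apply: measurable_funD; apply: measurableT_comp => //;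
apply: measurable_funB.
- by have [] := st true.
- by have [] := st' true.
- by have [] := st true.
- by have [] := st' true.
- by have [] := st false.
- by have [] := st' false.
- by have [] := st false.
- by have [] := st' false.
Qed.

Lemma mod2_bound (z : R * R) : 0 <= z.1 <= T -> `|mod2 dP dQ z| <= 8 * K.
Proof.
move=> zT.
have [_ _ /(_ z zT)[a1 a2]] := st true; have [_ _ /(_ z zT)[a3 a4]] := st false.
have [_ _ /(_ z zT)[b1 b2]] := st' true; have [_ _ /(_ z zT)[b3 b4]] := st' false.
rewrite ger0_norm ?mod2_ge0// /mod2 /mod1 /dP /dQ.
have := ler_normB (P true z) (P' true z); have := ler_normB (Q true z) (Q' true z).
have := ler_normB (P false z) (P' false z); have := ler_normB (Q false z) (Q' false z).
lra.
Qed.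

Lemma gauge_difference b (z : R * R) : 0 <= z.1 <= T ->
  `|dB b z| <= `|B0 b (z.2 - sg b * z.1) - B0' b (z.2 - sg b * z.1)| +
     K * J b (mod2 dP dQ) z.
Proof.
move=> /[dup] zT /andP[z0 zleT].
have sT (s : R) : 0 <= s <= z.1 -> 0 <= s <= T.
  by move=> /andP[-> sz]; exact: le_trans zleT.
have Ir : integrable_along b (rho P Q) z.
  apply: (@bounded_along _ _ _ (2 * K ^+ 2)); first exact: measurable_rho st.
  by move=> s y /sT; exact: (rho_bound (z := (s, y)) st).
have Ir' : integrable_along b (rho P' Q') z.
  apply: (@bounded_along _ _ _ (2 * K ^+ 2)); first exact: measurable_rho st'.
  by move=> s y /sT; exact: (rho_bound (z := (s, y)) st').
have Im : integrable_along b (mod2 dP dQ) z.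
  apply: (@bounded_along _ _ _ (8 * K)); first exact: measurable_mod2.
  by move=> s y /sT; exact: (mod2_bound (z := (s, y))).
rewrite /dB /gauge.
have -> : B0 b (z.2 - sg b * z.1) - sg b * J b (rho P Q) z -
    (B0' b (z.2 - sg b * z.1) - sg b * J b (rho P' Q') z) =
  (B0 b (z.2 - sg b * z.1) - B0' b (z.2 - sg b * z.1)) -
    sg b * (J b (rho P Q) z - J b (rho P' Q') z) by ring.
rewrite (le_trans (ler_normB _ _))// lerD2l normrM.
rewrite sg_norm mul1r -JB// (le_trans (norm_J (alongB Ir Ir')))// -JZ//.
apply: le_J; [exact: along_norm (alongB Ir Ir')|exact: alongZ|].
by move=> s y /sT; exact: (le_rho (z := (s, y))).
Qed.

End two_solutions.

End Stability.

(** * A priori bounds and the Lipschitz estimate *)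

Section Estimates.
Context {R : realType}.
Local Notation mu := (@lebesgue_measure R).
Local Notation mR := (measurableTypeR R).
Local Notation mfun1 := (measurable_fun [set: mR]).
Local Notation mfun2 := (measurable_fun [set: (mR * mR)%type]).

Lemma EFin_J_along b (f : R * R -> R) z : integrable_along b f z ->
  ((J b f z)%:E = \int[mu]_(s in `[0%R, z.1]) (f (s, z.2 - sg b * (z.1 - s)))%:E)%E.
Proof. by move=> If; rewrite /J fineK//; exact: integrable_fin_num. Qed.

Lemma nle_J_cst (q : \bar R) b (t c : R) (f : R * R -> R) : (1 <= q)%E -> 0 <= t ->
  mfun2 f -> (forall x, integrable_along b f (t, x)) ->
  (forall s : R, 0 <= s <= t -> nle q c (fun x => f (s, x))) ->
  nle q (t * c) (fun x => J b f (t, x)).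
Proof.
move=> q1 t0 mf If hf.
have T00 : 0 <= (0 : R) <= t by rewrite lexx.
have c0 := nle_ge0 (hf 0 T00).
(* The weight in [nle_J] must be positive, while [c] may be zero. *)
apply: nle_eps => e e0.
have t1 : 0 < t + 1 by rewrite ltr_wpDl.
have e1 : 0 < e / (t + 1) by exact: divr_gt0.
apply: (@nle_weak _ _ (t * (c + e / (t + 1)))).
  rewrite mulrDr lerD2l mulrCA ler_piMr ?(ltW e0)//.
  by rewrite ler_pdivrMr// mul1r lerDl.
apply: (@nle_J _ q b t (fun=> c + e / (t + 1)) _ f) => //.
- by move=> s; rewrite ltr_wpDl.
- by rewrite integral_cst// [X in (_ * X)%E](lebesgue_measure_cc t0) subr0 -EFinM mulrC.
- by move=> s /hf; apply: nle_weak; rewrite lerDl ltW.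
- by apply: measurable_slice; exact: measurable_J.
- apply: aeW => x.
  apply: (@le_trans _ _ (J b (fun z => `|f z|) (t, x))%:E).
    by rewrite lee_fin; exact: norm_J.
  by rewrite EFin_J_along//; exact: along_norm.
Qed.

Lemma nle_sum2 (q : \bar R) (c : R) (f : bool -> R -> R) : (1 <= q)%E ->
  (forall b, mfun1 (f b)) -> (forall b, nle q c (f b)) ->
  nle q (2 * c) (fun x => f true x + f false x).
Proof.
move=> q1 mf hf.
by rewrite (_ : 2 * c = c + c); [exact: nle_add|ring].
Qed.

Lemma nle_norm (q : \bar R) (c : R) (f : R -> R) : (1 <= q)%E -> mfun1 f ->
  nle q c f -> nle q c (fun x => `|f x|).
Proof.
move=> q1 mf; apply: ae_nle => //; first exact: measurableT_comp.
by apply: aeW => x; rewrite normr_id.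
Qed.

Lemma nle_pZ (q : \bar R) (k c : R) (f : R -> R) : (1 <= q)%E -> mfun1 f ->
  0 <= k -> nle q c f -> nle q (k * c) (fun x => k * f x).
Proof. by move=> q1 mf k0 /(nleZ k q1 mf); rewrite ger0_norm. Qed.

Lemma measurable_mod1 T K (P Q : bool -> R * R -> R) b :
  bounded_state T K P Q -> mfun2 (mod1 P Q b).
Proof.
by move=> st; have [mP mQ _] := st b; apply: measurable_funD;
  exact: measurableT_comp.
Qed.

Lemma mod1_bound T K (P Q : bool -> R * R -> R) b (z : R * R) :
  bounded_state T K P Q -> 0 <= z.1 <= T -> `|mod1 P Q b z| <= 2 * K.
Proof.
move=> st zT; have [_ _ /(_ z zT)[h1 h2]] := st b.
by rewrite ger0_norm ?mod1_ge0// /mod1; lra.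
Qed.

Lemma mod1_integrable T K (P Q : bool -> R * R -> R) b b' (z : R * R) :
  bounded_state T K P Q -> 0 <= z.1 <= T -> integrable_along b (mod1 P Q b') z.
Proof.
move=> st /andP[z0 zT]; apply: (@bounded_along _ _ _ (2 * K)).
  exact: measurable_mod1 st.
move=> s y /andP[s0 sz]; apply: (mod1_bound b' (z := (s, y)) st).
by rewrite /= s0 (le_trans sz).
Qed.

Lemma data_measurable (P0 Q0 : bool -> R -> R) (t : R) b :
  mfun1 (P0 b) -> mfun1 (Q0 b) ->
  mfun1 (fun x => 2 * (`|P0 b (x - sg b * t)| + `|Q0 b (x - sg b * t)|)).
Proof.
move=> mP mQ; apply: measurable_funM => //.
have sh (a : R -> R) : mfun1 a -> mfun1 (fun x => a (x - sg b * t)).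
  by move=> ma; apply: (measurableT_comp ma); exact: measurable_funB.
by apply: measurable_funD; apply: measurableT_comp => //; exact: sh.
Qed.

Lemma data_nle (q : \bar R) (d : R) (P0 Q0 : bool -> R -> R) (t : R) b :
  (1 <= q)%E -> mfun1 (P0 b) -> mfun1 (Q0 b) -> nle q d (P0 b) -> nle q d (Q0 b) ->
  nle q (4 * d) (fun x => 2 * (`|P0 b (x - sg b * t)| + `|Q0 b (x - sg b * t)|)).
Proof.
move=> q1 mP mQ hP hQ.
have sh (a : R -> R) : mfun1 a -> mfun1 (fun x => a (x - sg b * t)).
  by move=> ma; apply: (measurableT_comp ma); exact: measurable_funB.
have sn (a : R -> R) : mfun1 a -> nle q d a -> nle q d (fun x => `|a (x - sg b * t)|).
  move=> ma ha; apply: nle_norm => //; first exact: sh.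
  exact: (nle_shift (- (sg b * t)) q1 ma ha).
rewrite (_ : 4 * d = 2 * (d + d)); last by ring.
have msn (a : R -> R) : mfun1 a -> mfun1 (fun x => `|a (x - sg b * t)|).
  by move=> ma; apply: measurableT_comp => //; exact: sh.
apply: nle_pZ => //; first by apply: measurable_funD; exact: msn.
by apply: nle_add => //; [exact: msn|exact: msn|exact: sn|exact: sn].
Qed.

(** [16] is [2] from Gronwall, [2] for the two signs and [4] from [data_nle]. The Gronwall constant
    is [4 * m + 1], where [1] keeps it positive for [m = 0]. *)
Definition apriori_cst (m T : R) : R := 16 * expR (4 * (4 * m + 1) * T).

Lemma apriori_gronwall (q : \bar R) (m T K d : R) (P0 Q0 : bool -> R -> R)
    (P Q : bool -> R * R -> R) : 0 <= m -> (1 <= q)%E -> 0 <= T ->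
  (forall b, mfun1 (P0 b)) -> (forall b, mfun1 (Q0 b)) ->
  (forall b, nle q d (P0 b)) -> (forall b, nle q d (Q0 b)) ->
  bounded_state T K P Q ->
  (forall b (t : R), 0 <= t <= T -> {ae mu, forall x, mod1 P Q b (t, x) <=
     2 * (`|P0 b (x - sg b * t)| + `|Q0 b (x - sg b * t)|) +
     4 * (m * J b (mod1 P Q (~~ b)) (t, x))}) ->
  forall t : R, 0 <= t <= T -> nle q (apriori_cst m T * d) (fun x => mod2 P Q (t, x)).
Proof.
move=> m0 q1 T0 mP0 mQ0 nP nQ st hyp t tT.
pose g0 b (z : R * R) : R := 2 * (`|P0 b (z.2 - sg b * z.1)| + `|Q0 b (z.2 - sg b * z.1)|).
pose g (z : R * R) : R := g0 true z + g0 false z.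
have d0 : 0 <= d := nle_ge0 (nP true).
have C0 : 0 < 4 * m + 1 by rewrite ltr_wpDl// mulr_ge0.
have mw : mfun2 (mod2 P Q) by apply: measurable_funD; exact: measurable_mod1 st.
apply: (@nle_weak _ _ (2 * (2 * (4 * d)) * expR (4 * (4 * m + 1) * t))).
  rewrite /apriori_cst (_ : 2 * (2 * (4 * d)) = 16 * d); last by ring.
  rewrite mulrAC ler_wpM2r// ler_wpM2l// ler_expR ler_wpM2l//; last by case/andP: tT.
  by rewrite mulr_ge0// ltW.
apply: (@gronwall_strip R q T (4 * m + 1) _ (4 * K) (mod2 P Q) g) => //.
- move=> z zT; rewrite mod2_ge0 /=.
  have := mod1_bound true st zT; have := mod1_bound false st zT.
  by rewrite !ger0_norm ?mod1_ge0// /mod2; lra.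
- move=> s sT; split.
    by apply: measurable_funD; exact: data_measurable.
  apply: (@nle_sum2 q (4 * d) (fun b x => g0 b (s, x))) => // b.
    exact: data_measurable.
  exact: data_nle.
move=> s sT; move: (ae_conj (hyp true s sT) (hyp false s sT)); apply: ae_mono => x [ht hf].
have Iw b : integrable_along b (mod2 P Q) (s, x).
  by apply: alongD; exact: (mod1_integrable _ _ (z := (s, x)) st sT).
have J1 b : J b (mod1 P Q (~~ b)) (s, x) <= J b (mod2 P Q) (s, x).
  apply: le_J => //; first exact: (mod1_integrable _ _ (z := (s, x)) st sT).
  by move=> r y _; exact: mod1_le_mod2.
have J0 b : 0 <= J b (mod2 P Q) (s, x) by apply: J_ge0 => z; exact: mod2_ge0.
have := ler_wpM2l m0 (J1 true); have := ler_wpM2l m0 (J1 false).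
have := J0 true; have := J0 false.
rewrite (_ : mod2 P Q (s, x) = mod1 P Q true (s, x) + mod1 P Q false (s, x))// /g /g0 /=.
move: ht hf; rewrite /=; lra.
Qed.

Lemma zero_solution (m T K : R) : 0 <= K ->
  bounded_state T K (fun _ _ => 0) (fun _ _ => 0) /\
  real_solution m T (fun _ _ => 0) (fun _ _ => 0) (fun _ _ => 0)
    (fun _ _ => 0) (fun _ _ => 0).
Proof.
move=> K0; split; first by move=> b; split => // z _; rewrite normr0.
move=> b t tT; apply: aeW => x; rewrite !add0r.
have Z (f : R * R -> R) : (forall z, f z = 0) -> J b f (t, x) = 0.
  move=> f0; rewrite /J (@eq_Rintegral _ _ _ mu _ (fun=> 0)); last by move=> s _.
  by rewrite Rintegral_cst// mul0r.
by split; rewrite Z// => z; rewrite /forceP /forceQ ?mulr0 ?oppr0 ?addr0 ?subr0.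
Qed.

(** Comparison with the zero solution: in [coupling] the difference of potentials is multiplied by
    the modulus of zero, so the potential drops out. Hence [q] is independent of the exponent [p] of
    the potential, which only ensures integrability of the forces. *)
Lemma apriori_solution (q p : \bar R) (m T K c d : R) (P0 Q0 B0 : bool -> R -> R)
    (P Q : bool -> R * R -> R) : 0 <= m -> (1 <= q)%E -> (1 <= p)%E -> 0 <= T ->
  (forall b, mfun1 (P0 b)) -> (forall b, mfun1 (Q0 b)) -> (forall b, mfun1 (B0 b)) ->
  (forall b, nle q d (P0 b)) -> (forall b, nle q d (Q0 b)) ->
  (forall b, nle p c (B0 b)) ->
  bounded_state T K P Q -> real_solution m T P0 Q0 B0 P Q ->
  forall t : R, 0 <= t <= T -> nle q (apriori_cst m T * d) (fun x => mod2 P Q (t, x)).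
Proof.
move=> m0 q1 p1 T0 mP0 mQ0 mB nP nQ nB st sol.
apply: (apriori_gronwall m0 q1 T0 mP0 mQ0 nP nQ st) => b t tT.
have K0 : 0 <= K := bounded_state_ge0 T0 st.
have [st0 sol0] := zero_solution m T K0.
have c0 := nle_ge0 (nB true).
have nB0 (b' : bool) : nle p c ((fun _ _ => 0) b') by exact: nle0.
have mc b' : mfun1 ((fun (_ : bool) (_ : R) => 0 : R) b') by [].
have := transport_inequality m0 p1 mP0 mQ0 mc mc mB nB mc nB0 st st0 sol sol0 b tT.
apply: ae_mono => x.
have -> : mod1 (fun b z => P b z - 0) (fun b z => Q b z - 0) b (t, x) = mod1 P Q b (t, x).
  by rewrite /mod1 !subr0.
rewrite !subr0; congr (_ <= _ + 4 * _).
rewrite -JZ; last exact: (mod1_integrable _ _ (z := (t, x)) st tT).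
rewrite /J; apply: eq_Rintegral => s _.
by rewrite /coupling {1}/mod1 normr0 addr0 mulr0 add0r /mod1 !subr0.
Qed.

(** The prefactor is Gronwall's [2] times the data term: free spinor waves, and free potential waves
    weighted by [8 * K] and the transversal length [1 + 2 * T]. In the rate, [8 * K ^+ 2 + 4 * m]
    comes from four times [coupling], and [1] from the integrals of [w0] contained in the
    unknown. *)
Definition stability_cst (m K T : R) : R :=
  2 * (8 + 16 * K * (1 + 2 * T)) * expR (4 * (8 * K ^+ 2 + 4 * m + 1) * T).

Section stability.
Variables (p : \bar R) (m T K c c' d : R) (P0 Q0 B0 P0' Q0' B0' : bool -> R -> R).
Variables (P Q P' Q' : bool -> R * R -> R).
Hypotheses (m0 : 0 <= m) (p1 : (1 <= p)%E) (T0 : 0 <= T).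
Hypotheses (mP0 : forall b, mfun1 (P0 b)) (mQ0 : forall b, mfun1 (Q0 b)).
Hypotheses (mP0' : forall b, mfun1 (P0' b)) (mQ0' : forall b, mfun1 (Q0' b)).
Hypotheses (mB : forall b, mfun1 (B0 b)) (nB : forall b, nle p c (B0 b)).
Hypotheses (mB' : forall b, mfun1 (B0' b)) (nB' : forall b, nle p c' (B0' b)).
Hypotheses (st : bounded_state T K P Q) (st' : bounded_state T K P' Q').
Hypotheses (sol : real_solution m T P0 Q0 B0 P Q).
Hypotheses (sol' : real_solution m T P0' Q0' B0' P' Q').

Let dP b (z : R * R) : R := P b z - P' b z.
Let dQ b (z : R * R) : R := Q b z - Q' b z.
Let w0 := mod2 dP dQ.

Hypothesis ndB : forall b, nle p d (fun x => B0 b x - B0' b x).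

(* The integrals of [w0] are part of the unknown because they bound the
   difference of the gauge fields. *)
Lemma stability_estimate (q : \bar R) : q = p \/ q = +oo%E ->
  (forall b, nle q d (fun x => P0 b x - P0' b x)) ->
  (forall b, nle q d (fun x => Q0 b x - Q0' b x)) ->
  forall t : R, 0 <= t <= T -> nle q (stability_cst m K T * d)
    (fun x => w0 (t, x) + (J true w0 (t, x) + J false w0 (t, x))).
Proof.
move=> hq nP nQ t tT.
have q1 : (1 <= q)%E by case: hq => ->//; rewrite leey.
have K0 : 0 <= K := bounded_state_ge0 T0 st.
have d0 : 0 <= d := nle_ge0 (ndB true).
pose dB0 b x := B0 b x - B0' b x.
have mdB b : mfun1 (dB0 b) by exact: measurable_funB.
(* The free potential wave acting on component [b]; its sign is [sg (~~ b) = - sg b], hence the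
   plus. *)
pose a b (z : R * R) : R := `|dB0 (~~ b) (z.2 + sg b * z.1)|.
have ma b : mfun2 (a b).
  apply: measurableT_comp => //; apply: (measurableT_comp (mdB _)).
  by apply: measurable_funD => //; exact: measurable_funM.
have Ia b (z : R * R) : 0 <= z.1 -> integrable_along b (a b) z.
  by move=> z0; apply: along_norm; exact: transversal_integrable p1 (mdB _) (ndB _) z0.
have mw0 : mfun2 w0 by exact: measurable_mod2 st st'.
have w0b (z : R * R) : 0 <= z.1 <= T -> `|w0 z| <= 8 * K by move=> zT; exact: (mod2_bound st st' zT).
have w00 z : 0 <= w0 z by exact: mod2_ge0.
have sub (z : R * R) (s : R) : 0 <= z.1 <= T -> 0 <= s <= z.1 -> 0 <= s <= T.
  by move=> /andP[_ zT] /andP[-> sz]; exact: le_trans zT.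
have Iw0 b (z : R * R) : 0 <= z.1 <= T -> integrable_along b w0 z.
  move=> zT; apply: (@bounded_along _ _ _ (8 * K)) => // s y sz.
  exact: (w0b (s, y) (sub z s zT sz)).
have Jb b (z : R * R) : 0 <= z.1 <= T -> 0 <= J b w0 z <= 8 * K * T.
  move=> zT; rewrite J_ge0//= (le_trans (ler_norm _))//.
  apply: (@le_trans _ _ (8 * K * z.1)).
    apply: J_bound => //; first by case/andP: zT.
    by move=> s y sz; exact: (w0b (s, y) (sub z s zT sz)).
  by apply: ler_wpM2l; [rewrite mulr_ge0|case/andP: zT].
pose w (z : R * R) : R := w0 z + (J true w0 z + J false w0 z).
have mJ b : mfun2 (J b w0) by exact: measurable_J.
have mw : mfun2 w by apply: measurable_funD => //; exact: measurable_funD.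
have IJ b b' (z : R * R) : 0 <= z.1 <= T -> integrable_along b (J b' w0) z.
  move=> zT; apply: (@bounded_along _ _ _ (8 * K * T)) => // s y sz.
  have /andP[h1 h2] := Jb b' (s, y) (sub z s zT sz).
  by rewrite ger0_norm.
have Iw b (z : R * R) : 0 <= z.1 <= T -> integrable_along b w z.
  by move=> zT; apply: alongD; [exact: Iw0|apply: alongD; exact: IJ].
pose g0 b (z : R * R) : R := 2 * (`|P0 b (z.2 - sg b * z.1) - P0' b (z.2 - sg b * z.1)| +
  `|Q0 b (z.2 - sg b * z.1) - Q0' b (z.2 - sg b * z.1)|) + 8 * K * J b (a b) z.
pose g (z : R * R) : R := g0 true z + g0 false z.
pose C : R := 8 * K ^+ 2 + 4 * m + 1.
have C0 : 0 < C by rewrite /C ltr_wpDl// addr_ge0// mulr_ge0// sqr_ge0.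
have dPm b : mfun1 (fun x => P0 b x - P0' b x) by exact: measurable_funB.
have dQm b : mfun1 (fun x => Q0 b x - Q0' b x) by exact: measurable_funB.
have K8 : 0 <= 8 * K by rewrite mulr_ge0.
have mdat s b := @data_measurable (fun b x => P0 b x - P0' b x) (fun b x => Q0 b x - Q0' b x)
  s b (dPm b) (dQm b).
have mJa s b : mfun1 (fun x => 8 * K * J b (a b) (s, x)).
  by apply: measurable_funM => //; apply: measurable_slice; exact: measurable_J.
pose G : R := 2 * (4 * d + 8 * K * ((1 + 2 * T) * d)).
have hg (s : R) : 0 <= s <= T -> mfun1 (fun x => g (s, x)) /\ nle q G (fun x => g (s, x)).
  move=> /andP[s0 sT].
  have mg0 b : mfun1 (fun x => g0 b (s, x)) by apply: measurable_funD; [exact: mdat|exact: mJa].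
  split; first exact: measurable_funD.
  apply: (@nle_sum2 q _ (fun b x => g0 b (s, x))) => // b.
  apply: nle_add => //; first exact: mdat.
    exact: (@data_nle q d (fun b x => P0 b x - P0' b x) (fun b x => Q0 b x - Q0' b x) s b).
  apply: nle_pZ => //; first by apply: measurable_slice; exact: measurable_J.
  (* For [q = p] the slices have norm at most [d] and are integrated over time. For [q = oo] they
     need not be bounded, and the transversal bound is used pointwise instead. *)
  case: hq => [->|->].
    apply: (@nle_weak _ _ (s * d)).
      by apply: ler_wpM2r => //; lra.
    apply: nle_J_cst => //; first by move=> x; exact: Ia.
    move=> r rs; apply: nle_norm => //.
      apply: (measurableT_comp (mdB _)) => /=.
      by apply: measurable_funD => //; exact: measurable_cst.
    exact: (nle_shift (sg b * r) p1 (mdB (~~ b)) (ndB (~~ b))).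
  apply/nle_inftyP; apply: aeW => x.
  rewrite ger0_norm; last by apply: J_ge0 => z; exact: normr_ge0.
  rewrite -lee_fin EFin_J_along; last exact: Ia.
  apply: (le_trans (transversal_bound x b p1 (mdB (~~ b)) (ndB (~~ b)) s0)).
  by rewrite lee_fin ler_wpM2r// lerD2l ler_wpM2l.
apply: (@nle_weak _ _ (2 * G * expR (4 * C * t))).
  have -> : 2 * G = 2 * (8 + 16 * K * (1 + 2 * T)) * d by rewrite /G; ring.
  rewrite /stability_cst mulrAC ler_wpM2r// ler_wpM2l//.
    by rewrite mulr_ge0// addr_ge0// mulr_ge0 ?addr_ge0 ?mulr_ge0.
  by rewrite ler_expR ler_wpM2l ?mulr_ge0 ?(ltW C0)//; case/andP: tT.
apply: (@gronwall_strip R q T C G (8 * K + (8 * K * T + 8 * K * T)) w g) => //.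
  move=> z zT; have /andP[j1 j2] := Jb true z zT; have /andP[j3 j4] := Jb false z zT.
  rewrite addr_ge0 ?w00 ?addr_ge0//=.
  by rewrite lerD ?lerD// (le_trans (ler_norm _))// w0b.
move=> s sT; have s0 : 0 <= s by case/andP: sT.
have zT x : 0 <= ((s, x) : R * R).1 <= T by [].
move: (ae_conj (transport_inequality m0 p1 mP0 mQ0 mP0' mQ0' mB nB mB' nB' st st' sol sol' true sT)
  (transport_inequality m0 p1 mP0 mQ0 mP0' mQ0' mB nB mB' nB' st st' sol sol' false sT)).
apply: ae_mono => x [ht hf].
have JJw b : J b w0 (s, x) <= J b w (s, x).
  by apply: le_J => // [||r y _]; [exact: Iw0|exact: Iw|rewrite /w lerDl addr_ge0// J_ge0].
(* The iterated integrals from the difference of potentials cause no new unknown, because [J b' w0]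
   is a summand of [w]. *)
have JJ b b' : J b (J b' w0) (s, x) <= J b w (s, x).
  apply: le_J => // [||r y _]; [exact: IJ|exact: Iw|].
  rewrite /w; case: b'; last by rewrite addrA lerDr addr_ge0// J_ge0.
  by rewrite addrCA lerDl addr_ge0// J_ge0.
have Jc b : J b (coupling m B0 B0' P Q P' Q' b) (s, x) <=
    2 * K * J b (a b) (s, x) + 2 * K ^+ 2 * J b w (s, x) + m * J b w (s, x).
  apply: (@le_trans _ _ (J b (fun z => 2 * K * a b z + (2 * K ^+ 2 * J (~~ b) w0 z + m * w0 z)) (s, x))).
    apply: le_J.
    - exact: (coupling_integrable m p1 mB nB mB' nB' st st' b (zT x)).
    - apply: alongD; first by apply: alongZ; exact: Ia.
      by apply: alongD; apply: alongZ; [exact: IJ|exact: Iw0].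
    move=> r y rs; have rT := sub (s, x) r (zT x) rs.
    rewrite /coupling.
    have [_ _ /(_ (r, y) rT)[h1 h2]] := st' b.
    have hm : mod1 P' Q' b (r, y) <= 2 * K by rewrite /mod1; lra.
    have := gauge_difference B0 B0' st st' (~~ b) (z := (r, y)) rT.
    rewrite sgN mulNr opprK /=; set D := `|_ - _| => hD.
    have := mod1_le_mod2 (fun b z => P b z - P' b z) (fun b z => Q b z - Q' b z) (~~ b) (r, y).
    move=> /(ler_wpM2l m0) hm2.
    have hD2 : D * mod1 P' Q' b (r, y) <= (a b (r, y) + K * J (~~ b) w0 (r, y)) * (2 * K).
      by apply: ler_pM; [exact: normr_ge0|exact: mod1_ge0|exact: hD|exact: hm].
    rewrite (le_trans (lerD hD2 hm2))// le_eqVlt; apply/orP; left; apply/eqP.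
    by rewrite /w0; ring.
  rewrite JD; [|by apply: alongZ; exact: Ia|by apply: alongD; apply: alongZ; [exact: IJ|exact: Iw0]].
  rewrite JD; [|by apply: alongZ; exact: IJ|by apply: alongZ; exact: Iw0].
  rewrite !JZ; [|exact: Iw0|exact: IJ|exact: Ia].
  rewrite -addrA lerD2l lerD// ler_wpM2l//.
  by rewrite mulr_ge0// sqr_ge0.
have e1 := Jc true; have e2 := Jc false; have e3 := JJw true; have e4 := JJw false.
have w0E : w0 (s, x) = mod1 dP dQ true (s, x) + mod1 dP dQ false (s, x) by [].
rewrite {1}/w w0E /g /g0 /C /=.
move: ht hf; rewrite -/dP -/dQ => ht hf.
move: e1 e2 e3 e4 ht hf; rewrite /=.
set A1 := J true (a true) _; set A2 := J false (a false) _.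
set W1 := J true w _; set W2 := J false w _.
set X1 := J true w0 _; set X2 := J false w0 _.
set Y1 := J true (coupling _ _ _ _ _ _ _ _) _; set Y2 := J false (coupling _ _ _ _ _ _ _ _) _.
move=> e1 e2 e3 e4 ht hf; lra.
Qed.

(** The density part of the difference is controlled by [K * J b w0], and [J b w0] is a summand of
    the quantity already estimated in [stability_estimate]. *)
Lemma gauge_stability : (forall b, nle p d (fun x => P0 b x - P0' b x)) ->
  (forall b, nle p d (fun x => Q0 b x - Q0' b x)) ->
  forall b (t : R), 0 <= t <= T -> nle p ((1 + K * stability_cst m K T) * d)
    (fun x => gauge B0 P Q b (t, x) - gauge B0' P' Q' b (t, x)).
Proof.
move=> nP nQ b t tT.
have K0 : 0 <= K := bounded_state_ge0 T0 st.
have est := stability_estimate (or_introl erefl) nP nQ tT.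
have mw0 : mfun2 w0 by exact: measurable_mod2 st st'.
have mJ b' : mfun2 (J b' w0) by exact: measurable_J.
have w00 z : 0 <= w0 z by exact: mod2_ge0.
have mw : mfun1 (fun x => w0 (t, x) + (J true w0 (t, x) + J false w0 (t, x))).
  by apply: measurable_funD; [exact: measurable_slice|apply: measurable_funD; exact: measurable_slice].
have mdB : mfun1 (fun x => B0 b x - B0' b x) by exact: measurable_funB.
have msh : mfun1 (fun x => B0 b (x - sg b * t) - B0' b (x - sg b * t)).
  by apply: (measurableT_comp mdB); exact: measurable_funB.
have mshn : mfun1 (fun x => `|B0 b (x - sg b * t) - B0' b (x - sg b * t)|).
  exact: measurableT_comp.
apply: (@ae_nle _ p _ _ (fun x => `|B0 b (x - sg b * t) - B0' b (x - sg b * t)| +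
  K * (w0 (t, x) + (J true w0 (t, x) + J false w0 (t, x))))) => //.
- by apply: measurable_funB; apply: measurable_slice; [exact: measurable_gauge st|exact: measurable_gauge st'].
- by apply: measurable_funD => //; exact: measurable_funM.
- apply: aeW => x.
  have r0 : 0 <= w0 (t, x) + (J true w0 (t, x) + J false w0 (t, x)).
    by rewrite !addr_ge0// J_ge0.
  rewrite [leRHS]ger0_norm; last by rewrite addr_ge0// mulr_ge0.
  apply: (le_trans (gauge_difference B0 B0' st st' b (z := (t, x)) tT)).
  rewrite /= lerD2l ler_wpM2l// -/w0.
  have j1 : 0 <= J true w0 (t, x) by exact: J_ge0.
  have j2 : 0 <= J false w0 (t, x) by exact: J_ge0.
  by have := w00 (t, x); case: (b); lra.
rewrite mulrDl mul1r -mulrA; apply: nle_add => //.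
- exact: measurable_funM.
- by apply: nle_norm => //; exact: (nle_shift (- (sg b * t)) p1 mdB (ndB b)).
- exact: nle_pZ.
Qed.

End stability.

End Estimates.


(** * Fixed point *)

Section PhaseMap.
Context {R : realType}.
Local Notation mu := (@lebesgue_measure R).
Local Notation mR := (measurableTypeR R).
Local Notation mfun1 := (measurable_fun [set: mR]).
Local Notation mfun2 := (measurable_fun [set: (mR * mR)%type]).

(** Pointwise counterpart of [nle_J_expR], for the weighted sup norm of the fixed point. *)
Lemma J_expR_bound b (f : R * R -> R) (gam lam : R) (z : R * R) : mfun2 f ->
  0 < lam -> 0 <= gam -> 0 <= z.1 ->
  (forall s y : R, 0 <= s <= z.1 -> `|f (s, y)| <= gam * expR (lam * s)) ->
  `|J b f z| <= gam * expR (lam * z.1) / lam.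
Proof.
move=> mf lam0 gam0 z0 hf.
have mexp : mfun2 (fun w => gam * expR (lam * w.1)).
  apply: measurable_funM => //; apply: (measurableT_comp (@measurable_expR R)).
  exact: measurable_funM.
have eb (s : R) : 0 <= s <= z.1 -> gam * expR (lam * s) <= gam * expR (lam * z.1).
  by move=> /andP[s0 sz]; rewrite ler_wpM2l// ler_expR ler_wpM2l// ltW.
have If : integrable_along b f z.
  apply: (@bounded_along _ _ _ (gam * expR (lam * z.1))) => // s y sz.
  exact: le_trans (hf s y sz) (eb s sz).
have Ie : integrable_along b (fun w => gam * expR (lam * w.1)) z.
  apply: (@bounded_along _ _ _ (gam * expR (lam * z.1))) => // s y sz.
  by rewrite ger0_norm ?mulr_ge0 ?expR_ge0//; exact: eb.
apply: (le_trans (norm_J If)).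
apply: (@le_trans _ _ (J b (fun w => gam * expR (lam * w.1)) z)).
  by apply: le_J => //; exact: along_norm.
rewrite -lee_fin EFin_J_along//=.
under eq_integral do rewrite EFinM.
rewrite ge0_integralZl_EFin//; last first.
  apply/measurable_EFinP; apply: (@measurable_funS _ _ mR _ setT) => //.
  by apply: (measurableT_comp (@measurable_expR R)); exact: measurable_funM.
rewrite integral_expR// -EFinM lee_fin mulrA ler_pM2r ?invr_gt0//.
by rewrite ler_wpM2l// gerBl.
Qed.

Variables (m K0 c : R) (p : \bar R) (P0 Q0 B0 : bool -> R -> R).
Hypotheses (m0 : 0 <= m) (p1 : (1 <= p)%E) (K00 : 0 <= K0).
Hypotheses (mP0 : forall b, mfun1 (P0 b)) (mQ0 : forall b, mfun1 (Q0 b)).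
Hypotheses (bP0 : forall b x, `|P0 b x| <= K0) (bQ0 : forall b x, `|Q0 b x| <= K0).
Hypotheses (mB : forall b, mfun1 (B0 b)) (nB : forall b, nle p c (B0 b)).

Definition phase (P Q : bool -> R * R -> R) b (z : R * R) : R :=
  J b (gauge B0 P Q (~~ b)) z.

(* [twP + i * twQ = e^(- i * phase) * psi_(~~ b)]. *)
Definition twP (P Q : bool -> R * R -> R) b (z : R * R) : R :=
  cos (phase P Q b z) * P (~~ b) z + sin (phase P Q b z) * Q (~~ b) z.
Definition twQ (P Q : bool -> R * R -> R) b (z : R * R) : R :=
  cos (phase P Q b z) * Q (~~ b) z - sin (phase P Q b z) * P (~~ b) z.
Definition duhP (P Q : bool -> R * R -> R) b (z : R * R) : R :=
  P0 b (z.2 - sg b * z.1) + m * J b (twQ P Q b) z.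
Definition duhQ (P Q : bool -> R * R -> R) b (z : R * R) : R :=
  Q0 b (z.2 - sg b * z.1) - m * J b (twP P Q b) z.

(* Integrating factor form of the Dirac equation,
   [psi_b = e^(i * phase) * (psi_b(0) - i * m * J b (e^(- i * phase) * psi_(~~ b)))]:
   since [A] is real, it enters only through a factor of modulus one. *)
Definition stepP (P Q : bool -> R * R -> R) b (z : R * R) : R :=
  cos (phase P Q b z) * duhP P Q b z - sin (phase P Q b z) * duhQ P Q b z.
Definition stepQ (P Q : bool -> R * R -> R) b (z : R * R) : R :=
  sin (phase P Q b z) * duhP P Q b z + cos (phase P Q b z) * duhQ P Q b z.

Let lam : R := 8 * m + 1.
(** The data contribute [K0 = beta / 4] and the mass term another quarter, so each component of
    [duh] stays below half the bound; a rotation at most adds the two components. *)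
Let beta : R := 4 * K0.

(* The rate [lam] is so large that the mass term contributes at most a quarter
   of the bound, so that the step preserves it. *)
Definition tame (P Q : bool -> R * R -> R) := forall b,
  [/\ mfun2 (P b), mfun2 (Q b) & forall z : R * R, 0 <= z.1 ->
    `|P b z| <= beta * expR (lam * z.1) /\ `|Q b z| <= beta * expR (lam * z.1)].

Let lam0 : 0 < lam.
Proof. by rewrite /lam ltr_wpDl// mulr_ge0. Qed.
Let beta0 : 0 <= beta.
Proof. by rewrite /beta mulr_ge0. Qed.

Lemma tame_bounded P Q (T : R) : tame P Q -> bounded_state T (beta * expR (lam * T)) P Q.
Proof.
move=> tPQ b; have [mP mQ h] := tPQ b; split => // z /andP[z0 zT].
have e : beta * expR (lam * z.1) <= beta * expR (lam * T).
  by rewrite ler_wpM2l// ler_expR ler_wpM2l// ltW.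
by have [h1 h2] := h z z0; split; [exact: le_trans h1 e|exact: le_trans h2 e].
Qed.

Lemma measurable_phase P Q b : tame P Q -> mfun2 (phase P Q b).
Proof.
by move=> tPQ; apply: measurable_J; exact: measurable_gauge (tame_bounded 0 tPQ).
Qed.

Lemma measurable_cos_phase P Q b : tame P Q -> mfun2 (fun z => cos (phase P Q b z)).
Proof.
move=> tPQ; apply: (measurableT_comp (f := @cos R)); last exact: measurable_phase.
by apply: continuous_measurable_fun; exact: continuous_cos.
Qed.

Lemma measurable_sin_phase P Q b : tame P Q -> mfun2 (fun z => sin (phase P Q b z)).
Proof.
move=> tPQ; apply: (measurableT_comp (f := @sin R)); last exact: measurable_phase.
by apply: continuous_measurable_fun; exact: continuous_sin.
Qed.

Lemma measurable_tw P Q b : tame P Q -> mfun2 (twP P Q b) /\ mfun2 (twQ P Q b).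
Proof.
move=> tPQ; have [mP mQ _] := tPQ (~~ b).
have mc := measurable_cos_phase b tPQ; have ms := measurable_sin_phase b tPQ.
by split; [apply: measurable_funD|apply: measurable_funB]; exact: measurable_funM.
Qed.

Lemma measurable_duh P Q b : tame P Q -> mfun2 (duhP P Q b) /\ mfun2 (duhQ P Q b).
Proof.
move=> tPQ; have [h1 h2] := measurable_tw b tPQ.
by split; [apply: measurable_funD|apply: measurable_funB];
  (try exact: measurable_free); apply: measurable_funM => //; exact: measurable_J.
Qed.

Lemma rotation_bound (t x y : R) :
  `|cos t * x + sin t * y| <= `|x| + `|y| /\ `|cos t * x - sin t * y| <= `|x| + `|y|.
Proof.
have c1 : `|cos t| <= 1 by rewrite ler_norml cos_geN1 cos_le1.
have s1 : `|sin t| <= 1 by rewrite ler_norml sin_geN1 sin_le1.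
have h (u v : R) : `|u| <= 1 -> `|u * v| <= `|v|.
  by move=> u1; rewrite normrM ler_piMl.
split; [rewrite (le_trans (ler_normD _ _))//|rewrite (le_trans (ler_normB _ _))//];
  by apply: lerD; exact: h.
Qed.

Lemma tw_bound P Q b (z : R * R) : tame P Q -> 0 <= z.1 ->
  `|twP P Q b z| <= 2 * beta * expR (lam * z.1) /\
  `|twQ P Q b z| <= 2 * beta * expR (lam * z.1).
Proof.
move=> tPQ z0; have [_ _ /(_ z z0)[h1 h2]] := tPQ (~~ b).
have r1 := (rotation_bound (phase P Q b z) (P (~~ b) z) (Q (~~ b) z)).1.
have r2 := (rotation_bound (phase P Q b z) (Q (~~ b) z) (P (~~ b) z)).2.
by rewrite /twP /twQ; split; lra.
Qed.

Lemma duh_bound P Q b (z : R * R) : tame P Q -> 0 <= z.1 ->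
  `|duhP P Q b z| <= beta / 2 * expR (lam * z.1) /\
  `|duhQ P Q b z| <= beta / 2 * expR (lam * z.1).
Proof.
move=> tPQ z0; have [m1 m2] := measurable_tw b tPQ.
have tb s y : 0 <= s <= z.1 -> `|twP P Q b (s, y)| <= 2 * beta * expR (lam * s).
  by move=> /andP[s0 _]; exact: (tw_bound b (z := (s, y)) tPQ s0).1.
have tb' s y : 0 <= s <= z.1 -> `|twQ P Q b (s, y)| <= 2 * beta * expR (lam * s).
  by move=> /andP[s0 _]; exact: (tw_bound b (z := (s, y)) tPQ s0).2.
have b20 : 0 <= 2 * beta by rewrite mulr_ge0.
have j1 := J_expR_bound b m1 lam0 b20 z0 tb.
have j2 := J_expR_bound b m2 lam0 b20 z0 tb'.
have e1 : 1 <= expR (lam * z.1) by rewrite -expR0 ler_expR mulr_ge0// ltW.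
have key : m * (2 * beta * expR (lam * z.1) / lam) <= beta / 4 * expR (lam * z.1).
  rewrite (_ : m * _ = (m / lam * 8) * (beta / 4 * expR (lam * z.1))); last by field; rewrite gt_eqF.
  rewrite ler_piMl//; first by rewrite mulr_ge0 ?expR_ge0// divr_ge0.
  by rewrite mulrAC ler_pdivrMr// mul1r /lam mulrC lerDl.
have K4 : K0 <= beta / 4 * expR (lam * z.1).
  rewrite (_ : beta / 4 = K0); last by rewrite /beta; field.
  by rewrite ler_peMr.
have := ler_wpM2l m0 j1; have := ler_wpM2l m0 j2; rewrite /duhP /duhQ.
have nJ f : `|m * J b f z| = m * `|J b f z| by rewrite normrM ger0_norm.
move=> h2 h1; split.
  by rewrite (le_trans (ler_normD _ _))// nJ; have := bP0 b (z.2 - sg b * z.1); lra.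
by rewrite (le_trans (ler_normB _ _))// nJ; have := bQ0 b (z.2 - sg b * z.1); lra.
Qed.

Lemma step_tame P Q : tame P Q -> tame (stepP P Q) (stepQ P Q).
Proof.
move=> tPQ b; have [mG1 mG2] := measurable_duh b tPQ.
have mc := measurable_cos_phase b tPQ; have ms := measurable_sin_phase b tPQ.
split; [by apply: measurable_funB; exact: measurable_funM|
        by apply: measurable_funD; exact: measurable_funM|].
move=> z z0; have [h1 h2] := duh_bound b tPQ z0.
have r1 := (rotation_bound (phase P Q b z) (duhP P Q b z) (duhQ P Q b z)).2.
have r2 := (rotation_bound (phase P Q b z) (duhQ P Q b z) (duhP P Q b z)).1.
rewrite /stepP /stepQ; split; first by lra.
by rewrite addrC; lra.
Qed.

Lemma tw_along P Q b z : tame P Q ->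
  integrable_along b (twP P Q b) z /\ integrable_along b (twQ P Q b) z.
Proof.
move=> tPQ; have [m1 m2] := measurable_tw b tPQ.
have e (s : R) : 0 <= s <= z.1 -> 2 * beta * expR (lam * s) <= 2 * beta * expR (lam * z.1).
  by move=> /andP[s0 sz]; rewrite ler_wpM2l ?mulr_ge0// ler_expR ler_wpM2l// ltW.
split; apply: (@bounded_along _ _ _ (2 * beta * expR (lam * z.1))) => // s y /[dup] sz /andP[s0 _].
  exact: le_trans (tw_bound b (z := (s, y)) tPQ s0).1 (e s sz).
exact: le_trans (tw_bound b (z := (s, y)) tPQ s0).2 (e s sz).
Qed.

Definition strip_dist (T L gam : R) (P Q P' Q' : bool -> R * R -> R) :=
  forall b (z : R * R), 0 <= z.1 <= T ->
    `|P b z - P' b z| <= gam * expR (L * z.1) /\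
    `|Q b z - Q' b z| <= gam * expR (L * z.1).

Lemma rotation_lip (t t' x x' y y' B : R) : `|x| <= B -> `|y| <= B ->
  `|(cos t * x + sin t * y) - (cos t' * x' + sin t' * y')| <=
     2 * B * `|t - t'| + `|x - x'| + `|y - y'| /\
  `|(cos t * x - sin t * y) - (cos t' * x' - sin t' * y')| <=
     2 * B * `|t - t'| + `|x - x'| + `|y - y'|.
Proof.
move=> xB yB; have [dc ds] := sin_cos_lip t' t.
have c1 : `|cos t'| <= 1 by rewrite ler_norml cos_geN1 cos_le1.
have s1 : `|sin t'| <= 1 by rewrite ler_norml sin_geN1 sin_le1.
have B0' : 0 <= B by exact: le_trans xB.
have h1 : `|(cos t - cos t') * x| <= B * `|t - t'| by rewrite normrM mulrC ler_pM.
have h2 : `|(sin t - sin t') * y| <= B * `|t - t'| by rewrite normrM mulrC ler_pM.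
have h3 : `|cos t' * (x - x')| <= `|x - x'| by rewrite normrM ler_piMl.
have h4 : `|sin t' * (y - y')| <= `|y - y'| by rewrite normrM ler_piMl.
split.
  have -> : (cos t * x + sin t * y) - (cos t' * x' + sin t' * y') =
    ((cos t - cos t') * x + cos t' * (x - x')) +
    ((sin t - sin t') * y + sin t' * (y - y')) by ring.
  have := ler_normD ((cos t - cos t') * x + cos t' * (x - x'))
    ((sin t - sin t') * y + sin t' * (y - y')).
  have := ler_normD ((cos t - cos t') * x) (cos t' * (x - x')).
  have := ler_normD ((sin t - sin t') * y) (sin t' * (y - y')).
  lra.
have -> : (cos t * x - sin t * y) - (cos t' * x' - sin t' * y') =
  ((cos t - cos t') * x + cos t' * (x - x')) -
  ((sin t - sin t') * y + sin t' * (y - y')) by ring.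
have := ler_normB ((cos t - cos t') * x + cos t' * (x - x'))
  ((sin t - sin t') * y + sin t' * (y - y')).
have := ler_normD ((cos t - cos t') * x) (cos t' * (x - x')).
have := ler_normD ((sin t - sin t') * y) (sin t' * (y - y')).
lra.
Qed.

(** Each occurrence of the unknown in the step lies under an integral [J], which gains [1 / L]. The
    step is Lipschitz only on bounded sets, which the [tame] bound provides, and [L] depends on [T]
    through it. *)
Lemma step_contraction (T : R) : 0 <= T -> exists2 L, 0 < L &
  forall P Q P' Q' gam, tame P Q -> tame P' Q' -> 0 <= gam ->
    strip_dist T L gam P Q P' Q' ->
    strip_dist T L (gam / 2) (stepP P Q) (stepQ P Q) (stepP P' Q') (stepQ P' Q').
Proof.
move=> T0; pose M := beta * expR (lam * T).
have M0 : 0 <= M by rewrite mulr_ge0// expR_ge0.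
(* Relative to [gam], [A] bounds the change of the potential and of the phase, and [A2] that of the
   twisted spinor: [2 * M * A] through the phase and [1] for each component. [L] exceeds twice the
   sum of all contributions to the step. *)
pose A := 4 * M; pose A2 := 2 * M * A + 2.
have A0 : 0 <= A by rewrite mulr_ge0.
have A20 : 0 <= A2 by rewrite addr_ge0// mulr_ge0// mulr_ge0.
pose L := 2 * (2 * M * A + 2 * m * A2) + 1.
have L1 : 1 <= L by rewrite /L lerDr !(mulr_ge0, addr_ge0).
have L0 : 0 < L by exact: lt_le_trans L1.
exists L => // P Q P' Q' gam tPQ tPQ' gam0 dist.
have st := tame_bounded T tPQ; have st' := tame_bounded T tPQ'.
have sub (z : R * R) (s : R) : 0 <= z.1 <= T -> 0 <= s <= z.1 -> 0 <= s <= T.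
  by move=> /andP[_ zT] /andP[-> sz]; exact: le_trans zT.
(* Nested integrals gain several factors [1 / L]; a single one is enough, so inner gains are
   discarded. *)
have divL (x : R) : 0 <= x -> x / L <= x by move=> x0; rewrite ler_pdivrMr// ler_peMr.
have E0 (s : R) : 0 <= expR (L * s) by exact: expR_ge0.
pose w := mod2 (fun b z => P b z - P' b z) (fun b z => Q b z - Q' b z).
have hw (s y : R) : 0 <= s <= T -> `|w (s, y)| <= 4 * gam * expR (L * s).
  move=> sT; have [d1 d2] := dist true (s, y) sT; have [d3 d4] := dist false (s, y) sT.
  by rewrite ger0_norm ?mod2_ge0// /w /mod2 /mod1; rewrite /= in d1 d2 d3 d4; lra.
have mw : mfun2 w by exact: (measurable_mod2 st st').
have gam4 : 0 <= 4 * gam by rewrite mulr_ge0.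
have dgauge b (s y : R) : 0 <= s <= T ->
    `|gauge B0 P Q b (s, y) - gauge B0 P' Q' b (s, y)| <= A * gam * expR (L * s).
  move=> sT; have := gauge_difference B0 B0 st st' b (z := (s, y)) sT.
  rewrite subrr normr0 add0r => /le_trans; apply.
  have s0 : 0 <= ((s, y) : R * R).1 by case/andP: sT.
  have := J_expR_bound b mw L0 gam4 s0 (fun r u rs => hw r u (sub (s, y) r sT rs)).
  rewrite ger0_norm; last by apply: J_ge0 => z; exact: mod2_ge0.
  move=> /le_trans/(_ (divL _ _)); rewrite -/w => h.
  have {}h : J b w (s, y) <= 4 * gam * expR (L * s) by apply: h; rewrite mulr_ge0.
  rewrite (le_trans (ler_wpM2l M0 h))// le_eqVlt; apply/orP; left; apply/eqP.
  by rewrite /A; ring.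
have dphase b (s y : R) : 0 <= s <= T ->
    `|phase P Q b (s, y) - phase P' Q' b (s, y)| <= A * gam * expR (L * s) / L.
  move=> sT; rewrite /phase -JB; last 2 first.
  - exact: (gauge_integrable (z := (s, y)) b p1 mB nB st sT).
  - exact: (gauge_integrable (z := (s, y)) b p1 mB nB st' sT).
  have s0 : 0 <= ((s, y) : R * R).1 by case/andP: sT.
  have Ag : 0 <= A * gam by rewrite mulr_ge0.
  apply: (J_expR_bound (z := (s, y)) b _ L0 Ag s0).
    by apply: measurable_funB; [exact: measurable_gauge st|exact: measurable_gauge st'].
  by move=> r u rs; apply: dgauge; exact: (sub (s, y) r sT rs).
have dtw b (s y : R) : 0 <= s <= T ->
    `|twP P Q b (s, y) - twP P' Q' b (s, y)| <= A2 * gam * expR (L * s) /\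
    `|twQ P Q b (s, y) - twQ P' Q' b (s, y)| <= A2 * gam * expR (L * s).
  move=> sT; have [d1 d2] := dist (~~ b) (s, y) sT.
  have [_ _ /(_ (s, y) sT)[b1 b2]] := st (~~ b).
  have := dphase b s y sT => /le_trans/(_ (divL _ _)) dp.
  have {}dp := dp _; have {}dp : `|phase P Q b (s, y) - phase P' Q' b (s, y)| <= A * gam * expR (L * s).
    by apply: dp; rewrite !mulr_ge0.
  have M20 : 0 <= 2 * M by rewrite mulr_ge0.
  have dp2 := ler_wpM2l M20 dp.
  have r1 := (rotation_lip (B := M) (phase P Q b (s, y)) (phase P' Q' b (s, y))
    (P' (~~ b) (s, y)) (Q' (~~ b) (s, y)) b1 b2).1.
  have r2 := (rotation_lip (B := M) (phase P Q b (s, y)) (phase P' Q' b (s, y))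
    (Q' (~~ b) (s, y)) (P' (~~ b) (s, y)) b2 b1).2.
  have e : A2 * gam * expR (L * s) = 2 * M * (A * gam * expR (L * s)) +
    gam * expR (L * s) + gam * expR (L * s) by rewrite /A2; ring.
  by rewrite e /twP /twQ; rewrite /= in d1 d2; split; lra.
move=> b z zT; have z0 : 0 <= z.1 by case/andP: zT.
have [mt1 mt2] := measurable_tw b tPQ; have [mt1' mt2'] := measurable_tw b tPQ'.
have A2g : 0 <= A2 * gam by rewrite mulr_ge0.
have [I1 I2] := tw_along b z tPQ; have [I1' I2'] := tw_along b z tPQ'.
have j1 : `|J b (twP P Q b) z - J b (twP P' Q' b) z| <= A2 * gam * expR (L * z.1) / L.
  rewrite -JB//; apply: J_expR_bound => //; first exact: measurable_funB.
  by move=> s y sz; exact: (dtw b s y (sub z s zT sz)).1.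
have j2 : `|J b (twQ P Q b) z - J b (twQ P' Q' b) z| <= A2 * gam * expR (L * z.1) / L.
  rewrite -JB//; apply: J_expR_bound => //; first exact: measurable_funB.
  by move=> s y sz; exact: (dtw b s y (sub z s zT sz)).2.
have e1 : `|duhP P Q b z - duhP P' Q' b z| <= m * (A2 * gam * expR (L * z.1) / L).
  rewrite /duhP opprD addrACA subrr add0r -mulrBr normrM (ger0_norm m0).
  exact: ler_wpM2l.
have e2 : `|duhQ P Q b z - duhQ P' Q' b z| <= m * (A2 * gam * expR (L * z.1) / L).
  rewrite /duhQ opprB addrACA [_ + (_ - _)]addrC.
  rewrite (_ : _ + _ = m * (J b (twP P' Q' b) z - J b (twP P Q b) z)); last by ring.
  by rewrite normrM (ger0_norm m0) distrC; exact: ler_wpM2l.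
have [g1 g2] := duh_bound b tPQ z0.
have eM : beta / 2 * expR (lam * z.1) <= M.
  apply: (@le_trans _ _ (beta * expR (lam * z.1))).
    by rewrite ler_wpM2r ?expR_ge0//; move: beta0; lra.
  by rewrite /M ler_wpM2l// ler_expR ler_wpM2l ?(ltW lam0)//; case/andP: zT.
have dp := dphase b z.1 z.2 zT; rewrite -surjective_pairing in dp.
have M20 : 0 <= 2 * M by rewrite mulr_ge0.
have dp2 := ler_wpM2l M20 dp.
have r1 := (rotation_lip (phase P Q b z) (phase P' Q' b z) (duhP P' Q' b z) (duhQ P' Q' b z)
  (le_trans g1 eM) (le_trans g2 eM)).2.
have r2 := (rotation_lip (phase P Q b z) (phase P' Q' b z) (duhQ P' Q' b z) (duhP P' Q' b z)
  (le_trans g2 eM) (le_trans g1 eM)).1.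
have final : 2 * M * (A * gam * expR (L * z.1) / L) + m * (A2 * gam * expR (L * z.1) / L) +
    m * (A2 * gam * expR (L * z.1) / L) <= gam / 2 * expR (L * z.1).
  have -> : 2 * M * (A * gam * expR (L * z.1) / L) + m * (A2 * gam * expR (L * z.1) / L) +
    m * (A2 * gam * expR (L * z.1) / L) =
    ((2 * (2 * M * A + 2 * m * A2)) / L) * (gam / 2 * expR (L * z.1)) by field; rewrite gt_eqF.
  rewrite ler_piMl//; first by rewrite mulr_ge0// divr_ge0.
  by rewrite ler_pdivrMr// mul1r /L lerDl.
rewrite /stepP /stepQ; split; first by lra.
rewrite [X in `|X - _|]addrC [X in `|_ - X|]addrC; lra.
Qed.

Lemma half_pow_small (C e : R) : 0 < e -> exists n, C * 2^-1 ^+ n < e.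
Proof.
move=> e0; have h : `|2^-1 : R| < 1 by rewrite gtr0_norm ?invr_gt0// invf_lt1// ltr1n.
have /cvgr0_norm_lt/(_ e e0) := cvg_geometric C h.
move=> [n _ /(_ n)/=]; rewrite leqnn => /(_ isT) hn.
by exists n; exact: le_lt_trans (ler_norm _) hn.
Qed.

Lemma half_pow_eq0 (C x : R) : (forall n, `|x| <= C * 2^-1 ^+ n) -> x = 0.
Proof.
move=> h; apply/eqP; rewrite -normr_eq0 eq_le normr_ge0 andbT leNgt.
apply/negP => /(half_pow_small C)[n]; by rewrite ltNge h.
Qed.

(** [e n = 2 * C / 2 ^ n] is the tail of the geometric bound, so the intervals of radius [e n]
    around [u n] are nested. Their common point is the limit, with an explicit rate. *)
Lemma dyadic_cauchy (u : nat -> R) (C : R) :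
  (forall n, `|u n.+1 - u n| <= C * 2^-1 ^+ n) ->
  u @ \oo --> limn u /\ forall n, `|limn u - u n| <= 2 * C * 2^-1 ^+ n.
Proof.
move=> hu; pose e n : R := 2 * C * 2^-1 ^+ n.
have eS n : e n.+1 = C * 2^-1 ^+ n by rewrite /e exprS; field.
have e2 n : e n = 2 * (C * 2^-1 ^+ n) by rewrite /e mulrA.
have C0 : 0 <= C by have := hu 0%N; rewrite expr0 mulr1; exact: le_trans.
have e0 n : 0 <= e n by rewrite /e mulr_ge0 ?mulr_ge0// exprn_ge0// invr_ge0.
pose a n := u n - e n; pose d n := u n + e n.
have aS n : a n <= a n.+1.
  by rewrite /a eS e2; have := hu n; rewrite ler_norml => /andP[? _]; lra.
have dS n : d n.+1 <= d n.
  by rewrite /d eS e2; have := hu n; rewrite ler_norml => /andP[_ ?]; lra.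
have amono : {homo a : n k / (n <= k)%N >-> n <= k} by exact/nondecreasing_seqP.
have dmono : {homo d : n k / (n <= k)%N >-> n >= k} by exact/nonincreasing_seqP.
have ad n k : a n <= d k.
  apply: (le_trans (amono _ _ (leq_maxl n k))).
  apply: (le_trans _ (dmono _ _ (leq_maxr n k))).
  by rewrite /a /d; have := e0 (maxn n k); lra.
pose l := sup (range a).
have la n : a n <= l by apply: ub_le_sup; [exists (d 0%N) => _ [k _ <-]; exact: ad|exists n].
have ld n : l <= d n by apply: ge_sup; [exists (a 0%N); exists 0%N|move=> _ [k _ <-]; exact: ad].
have lu n : `|l - u n| <= e n.
  by rewrite ler_norml; have := la n; have := ld n; rewrite /a /d => ? ?; apply/andP; split; lra.
have ul : u @ \oo --> l.
  apply/cvgrPdist_le => r r0; have [n en] := half_pow_small (2 * C) r0.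
  exists n => // k /= nk; apply: (le_trans (lu k)); apply: le_trans (ltW en).
  rewrite /e ler_wpM2l ?mulr_ge0//.
  by apply: ler_wiXn2l => //; rewrite ?invr_ge0// invf_le1// ler1n.
by rewrite (cvg_lim _ ul).
Qed.

(** Picard iterates converge at every point, and the limit is taken pointwise. The rate [L] depends
    on the time horizon but the limit does not, so the horizon can be [z.1] itself. *)
Lemma step_fixpoint : exists PQ : (bool -> R * R -> R) * (bool -> R * R -> R),
  tame PQ.1 PQ.2 /\ forall b (z : R * R), 0 <= z.1 ->
    PQ.1 b z = stepP PQ.1 PQ.2 b z /\ PQ.2 b z = stepQ PQ.1 PQ.2 b z.
Proof.
pose X := fix X n : (bool -> R * R -> R) * (bool -> R * R -> R) :=
  if n is k.+1 then (stepP (X k).1 (X k).2, stepQ (X k).1 (X k).2)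
  else (fun _ _ => 0, fun _ _ => 0).
have tX n : tame (X n).1 (X n).2.
  elim: n => [b|n IH]; last exact: step_tame.
  split; [exact: measurable_cst|exact: measurable_cst|].
  by move=> z z0; rewrite /= normr0 mulr_ge0// expR_ge0.
(* The value zero at negative times keeps the limit measurable on the whole plane, where no
   convergence is claimed. *)
pose P b (z : R * R) : R := if 0 <= z.1 then limn (fun n => (X n).1 b z) else 0.
pose Q b (z : R * R) : R := if 0 <= z.1 then limn (fun n => (X n).2 b z) else 0.
have main (T : R) : 0 <= T -> exists L C : R, [/\ 0 <= C, 0 < L,
    forall P Q P' Q' gam, tame P Q -> tame P' Q' -> 0 <= gam ->
      strip_dist T L gam P Q P' Q' ->
      strip_dist T L (gam / 2) (stepP P Q) (stepQ P Q) (stepP P' Q') (stepQ P' Q') &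
    forall b (z : R * R) n, 0 <= z.1 <= T ->
    [/\ (X n).1 b z @[n --> \oo] --> P b z, (X n).2 b z @[n --> \oo] --> Q b z,
      `|P b z - (X n).1 b z| <= C * 2^-1 ^+ n * expR (L * z.1) &
      `|Q b z - (X n).2 b z| <= C * 2^-1 ^+ n * expR (L * z.1)]].
  move=> T0; have [L L0 contr] := step_contraction T0.
  pose M := beta * expR (lam * T).
  have M0 : 0 <= M by rewrite mulr_ge0// expR_ge0.
  have dX n : strip_dist T L (M * 2^-1 ^+ n) (X n.+1).1 (X n.+1).2 (X n).1 (X n).2.
    elim: n => [|n IH].
      move=> b z zT; have z0 : 0 <= z.1 by case/andP: zT.
      have [_ _ /(_ z z0)[h1 h2]] := tX 1%N b.
      have h : beta * expR (lam * z.1) <= M * 2^-1 ^+ 0 * expR (L * z.1).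
        rewrite expr0 mulr1 -[leLHS]mulr1; apply: ler_pM.
        - by rewrite mulr_ge0// expR_ge0.
        - exact: ler01.
        - by rewrite /M ler_wpM2l// ler_expR ler_wpM2l ?(ltW lam0)//; case/andP: zT.
        - by rewrite -expR0 ler_expR mulr_ge0// ltW.
      by rewrite /= !subr0; split; [exact: le_trans h1 h|exact: le_trans h2 h].
    rewrite exprSr mulrA; apply: (contr _ _ _ _ _ (tX n.+1) (tX n) _ IH).
    by rewrite mulr_ge0// exprn_ge0// invr_ge0.
  exists L, (2 * M); split => //; first by rewrite mulr_ge0.
  move=> b z n zT; have z0 : 0 <= z.1 by case/andP: zT.
  have h1 k : `|(X k.+1).1 b z - (X k).1 b z| <= M * expR (L * z.1) * 2^-1 ^+ k.
    by rewrite mulrAC; exact: (dX k b z zT).1.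
  have h2 k : `|(X k.+1).2 b z - (X k).2 b z| <= M * expR (L * z.1) * 2^-1 ^+ k.
    by rewrite mulrAC; exact: (dX k b z zT).2.
  have [c1 d1] := dyadic_cauchy (u := fun n => (X n).1 b z) h1.
  have [c2 d2] := dyadic_cauchy (u := fun n => (X n).2 b z) h2.
  rewrite /P /Q z0; split => //.
    by rewrite (_ : 2 * M * _ * _ = 2 * (M * expR (L * z.1)) * 2^-1 ^+ n)//; ring.
  by rewrite (_ : 2 * M * _ * _ = 2 * (M * expR (L * z.1)) * 2^-1 ^+ n)//; ring.
have tPQ : tame P Q.
  move=> b.
  have mcut (f : R * R -> R) (g : nat -> R * R -> R) : (forall n, mfun2 (g n)) ->
      (forall z : R * R, 0 <= z.1 -> g n z @[n --> \oo] --> f z) ->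
      (forall z : R * R, ~~ (0 <= z.1) -> f z = 0) -> mfun2 f.
    move=> mg h1 h2.
    apply: (@measurable_fun_cvg _ _ _ _ (fun n (z : R * R) => if 0 <= z.1 then g n z else 0)).
      by move=> n; apply: measurable_fun_ifT; [apply: measurable_fun_ler|exact: mg|exact: measurable_cst].
    move=> z _; have [z0|z0] := boolP (0 <= z.1).
      exact: h1.
    by rewrite h2//; exact: cvg_cst.
  have cv (z : R * R) : 0 <= z.1 -> (X n).1 b z @[n --> \oo] --> P b z /\
      (X n).2 b z @[n --> \oo] --> Q b z.
    move=> z0; have [L [C [_ _ _ h]]] := main _ z0.
    have zz : 0 <= z.1 <= z.1 by rewrite z0 lexx.
    by have [] := h b z 0%N zz.
  split.
  - apply: (mcut _ (fun n => (X n).1 b)) => [n|z z0|z /negbTE z0].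
    + by have [] := tX n b.
    + exact: (cv z z0).1.
    + by rewrite /P z0.
  - apply: (mcut _ (fun n => (X n).2 b)) => [n|z z0|z /negbTE z0].
    + by have [] := tX n b.
    + exact: (cv z z0).2.
    + by rewrite /Q z0.
  - move=> z z0; have [c1 c2] := cv z z0.
    have lim_le (u : nat -> R) (l : R) : u @ \oo --> l ->
        (forall n, `|u n| <= beta * expR (lam * z.1)) -> `|l| <= beta * expR (lam * z.1).
      move=> ul hu; have ul' : `|u n| @[n --> \oo] --> `|l| by exact: cvg_norm.
      rewrite -(cvg_lim _ ul')//; apply: limr_le; first by apply/cvg_ex; exists `|l|.
      exact: nearW.
    by split; [apply: lim_le c1 _|apply: lim_le c2 _] => n; have [_ _ /(_ z z0)[]] := tX n b.
exists (P, Q); split => // b z z0 /=.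
have [L [C [C0 L0 contr h]]] := main _ z0.
have zz : 0 <= z.1 <= z.1 by rewrite z0 lexx.
have cn n : strip_dist z.1 L (C * 2^-1 ^+ n / 2) (stepP P Q) (stepQ P Q) (X n.+1).1 (X n.+1).2.
  apply: (contr _ _ _ _ _ tPQ (tX n)); first by rewrite mulr_ge0// exprn_ge0// invr_ge0.
  by move=> b' z' zT'; have [] := h b' z' n zT'.
(* The pair and its image are both close to iterate [n.+1]: half of [C / 2 ^ n] comes from the
   convergence, half from the contraction. *)
have key n : `|P b z - stepP P Q b z| <= C * expR (L * z.1) * 2^-1 ^+ n /\
    `|Q b z - stepQ P Q b z| <= C * expR (L * z.1) * 2^-1 ^+ n.
  have [_ _ g1 g2] := h b z n.+1 zz; have [s1 s2] := cn n b z zz.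
  have e : C * 2^-1 ^+ n.+1 * expR (L * z.1) + C * 2^-1 ^+ n / 2 * expR (L * z.1) =
     C * expR (L * z.1) * 2^-1 ^+ n by rewrite exprS; field.
  have d1 := ler_normB (P b z - (X n.+1).1 b z) (stepP P Q b z - (X n.+1).1 b z).
  have d2 := ler_normB (Q b z - (X n.+1).2 b z) (stepQ P Q b z - (X n.+1).2 b z).
  have sB (u v w : R) : u - w - (v - w) = u - v by ring.
  by rewrite sB in d1; rewrite sB in d2; split; lra.
split; apply/eqP; rewrite -subr_eq0; apply/eqP; apply: (half_pow_eq0 (C := C * expR (L * z.1))).
  by move=> n; exact: (key n).1.
by move=> n; exact: (key n).2.
Qed.
Lemma J_time0 b (f : R * R -> R) (x : R) : J b f (0, x) = 0.
Proof. by rewrite /J /= set_itv1 Rintegral_set1. Qed.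

(** Along a characteristic the phase and the terms of [duh] are primitives, so [step] is
    differentiated by the product and chain rules. The fixed point is an identity at every point,
    hence so are the equations. *)
Lemma fixpoint_solution P Q : tame P Q ->
  (forall b (z : R * R), 0 <= z.1 ->
     P b z = stepP P Q b z /\ Q b z = stepQ P Q b z) ->
  forall b (z : R * R), 0 <= z.1 ->
    P b z = P0 b (z.2 - sg b * z.1) + J b (forceP m (gauge B0 P Q) P Q b) z /\
    Q b z = Q0 b (z.2 - sg b * z.1) + J b (forceQ m (gauge B0 P Q) P Q b) z.
Proof.
move=> tPQ fixPQ b [t x] /= t0.
have st := tame_bounded t tPQ.
have tt : 0 <= ((t, x) : R * R).1 <= t by rewrite /= t0 lexx.
pose ch (s : R) : R * R := (s, x - sg b * (t - s)).
have Ig := gauge_integrable (z := (t, x)) b p1 mB nB st tt.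
have [IP IQ] := tw_along b (t, x) tPQ.
have pTh : prim t (fun s => phase P Q b (ch s)) (fun s => gauge B0 P Q (~~ b) (ch s)).
  apply: eq_prim (prim_J 0 t0 Ig) => s //=; exact: add0r.
have base (s : R) : x - sg b * (t - s) - sg b * s = x - sg b * t by ring.
have pG : prim t (fun s => duhP P Q b (ch s)) (fun s => m * twQ P Q b (ch s)).
  have h := prim_J (P0 b (x - sg b * t)) t0 (alongZ m IQ).
  split; first exact: h.1.
  move=> s /[dup] sT /andP[s0 st']; have := h.2 s sT; rewrite /duhP /ch /=.
  have Is : integrable_along b (twQ P Q b) (s, x - sg b * (t - s)).
    exact: (tw_along b _ tPQ).2.
  have I0 : integrable_along b (twQ P Q b) (0, x - sg b * (t - 0)).
    exact: (tw_along b _ tPQ).2.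
  by rewrite (JZ m Is) (JZ m I0) !base.
have pH : prim t (fun s => duhQ P Q b (ch s)) (fun s => - m * twP P Q b (ch s)).
  have h := prim_J (Q0 b (x - sg b * t)) t0 (alongZ (- m) IP).
  split; first exact: h.1.
  move=> s /[dup] sT /andP[s0 st']; have := h.2 s sT; rewrite /duhQ /ch /=.
  have Is : integrable_along b (twP P Q b) (s, x - sg b * (t - s)).
    exact: (tw_along b _ tPQ).1.
  have I0 : integrable_along b (twP P Q b) (0, x - sg b * (t - 0)).
    exact: (tw_along b _ tPQ).1.
  by rewrite (JZ (- m) Is) (JZ (- m) I0) !mulNr !base.
have pc := prim_cos t0 pTh; have ps := prim_sin t0 pTh.
have := prim_lin 1 (-1) (prim_mul t0 pc pG) (prim_mul t0 ps pH).
have := prim_lin 1 1 (prim_mul t0 ps pG) (prim_mul t0 pc pH).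
move=> [_ /(_ t)]; rewrite t0 lexx => /(_ isT) EQ.
move=> [_ /(_ t)]; rewrite t0 lexx => /(_ isT) EP.
have ct : ch t = (t, x) by rewrite /ch subrr mulr0 subr0.
have phase0 : phase P Q b (ch 0) = 0 by exact: J_time0.
have duhP0 : duhP P Q b (ch 0) = P0 b (x - sg b * t).
  by rewrite /duhP /ch J_time0 /= !mulr0 addr0 !subr0.
have duhQ0 : duhQ P Q b (ch 0) = Q0 b (x - sg b * t).
  by rewrite /duhQ /ch J_time0 /= !mulr0 !subr0.
have [fP fQ] := fixPQ b (t, x) t0.
move: EP EQ; rewrite /= ct phase0 duhP0 duhQ0 cos0 sin0 => EP EQ.
split.
  rewrite fP /stepP -[X in X - _]mul1r -[X in _ - X]mul1r -mulNr EP.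
  rewrite !(mul1r, mul0r, mulr0, addr0, subr0); congr (_ + _).
  rewrite /J; apply: eq_Rintegral => s; rewrite inE/= in_itv/= => /andP[s0 _].
  (* The terms with the potential assemble to [stepQ], which is [Q b]; undoing the twist leaves the
     mass term times [cs * cs + sn * sn = 1]. *)
  have [_ fQs] := fixPQ b (ch s) s0.
  rewrite /forceP -/(ch s) fQs /stepQ /twP /twQ.
  have := cos2Dsin2 (phase P Q b (ch s)); rewrite !expr2.
  move: (cos _) (sin _) => cs sn e.
  have -> : m * Q (~~ b) (ch s) = m * (cs * cs + sn * sn) * Q (~~ b) (ch s) by rewrite e mulr1.
  ring.
rewrite fQ /stepQ -[X in X + _]mul1r -[X in _ + X]mul1r EQ.
rewrite !(mul1r, mul0r, mulr0, addr0, add0r); congr (_ + _).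
rewrite /J; apply: eq_Rintegral => s; rewrite inE/= in_itv/= => /andP[s0 _].
have [fPs _] := fixPQ b (ch s) s0.
rewrite /forceQ -/(ch s) fPs /stepP /twP /twQ.
have := cos2Dsin2 (phase P Q b (ch s)); rewrite !expr2.
move: (cos _) (sin _) => cs sn e.
have -> : m * P (~~ b) (ch s) = m * (cs * cs + sn * sn) * P (~~ b) (ch s) by rewrite e mulr1.
ring.
Qed.

End PhaseMap.

(** * Continuity in time *)

Section Translation.
Context {R : realType}.
Local Notation mu := (@lebesgue_measure R).
Local Notation mR := (measurableTypeR R).
Local Notation mfun1 := (measurable_fun [set: mR]).

Lemma small_integral (f : nat -> R -> R) (D : set mR) (e : R) : 0 < e ->
  (\int[mu]_(x in D) `|(f n x)%:E| @[n --> \oo] --> 0)%E ->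
  exists n, (\int[mu]_(x in D) `|f n x|%:E <= e%:E)%E.
Proof.
move=> e0 /fine_cvgP[[n1 _ h1]] /cvgr0_norm_lt/(_ e e0)[n2 _ h2].
exists (maxn n1 n2).
have /= h1' := h1 _ (leq_maxl n1 n2); have /= h2' := h2 _ (leq_maxr n1 n2).
have <- : (\int[mu]_(x in D) `|(f (maxn n1 n2) x)%:E|)%E = (\int[mu]_(x in D) `|f (maxn n1 n2) x|%:E)%E by [].
by rewrite -(fineK h1') lee_fin (le_trans (ler_norm _))// ltW.
Qed.

(** Continuity under the integral sign in the shift [h] on []-1, 1[]: there only values of [g] on
    [[-a - 1, a + 1]] occur, which gives a constant majorant. *)
Lemma continuous_translation (g : R -> R) (a : R) : continuous g -> forall e : R, 0 < e ->
  exists2 d : R, 0 < d & forall h : R, `|h| < d ->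
    (\int[mu]_(x in `[(- a)%R, a]) `|g (x + h) - g x|%:E <= e%:E)%E.
Proof.
move=> cg e e0; pose B : set mR := `[- a, a]%classic.
have mB : measurable B by exact: measurable_itv.
have mg : mfun1 g by exact: continuous_measurable_fun.
have gcont (h : R) : continuous (fun x => `|g (x + h) - g x|).
  move=> x; apply: cvg_norm; apply: cvgB; last exact: cg.
  by apply: (cvg_comp _ g _ (cg (x + h))); apply: cvgD; [exact: cvg_id|exact: cvg_cst].
have mgh (h : R) : mfun1 (fun x => `|g (x + h) - g x|).
  by apply: continuous_measurable_fun; exact: gcont.
have [M hM] : exists M : R, forall y : R, - a - 1 <= y <= a + 1 -> `|g y| <= M.
  have [ab|ba] := leP (- a - 1) (a + 1); last first.
    by exists 0 => y /andP[/le_trans h /h]; rewrite leNgt ba.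
  have cn : {within `[- a - 1, a + 1], continuous (fun x => `|g x|)}.
    by apply: continuous_subspaceT => x; apply: cvg_norm; exact: cg.
  have [c _ hc] := EVT_max ab cn.
  by exists `|g c| => y yI; apply: hc; rewrite in_itv.
have bnd (h x : R) : `]-1, 1[%classic h -> - a <= x <= a -> `|(`|g (x + h) - g x|)| <= M + M.
  rewrite /= in_itv/= => /andP[h1 h2] /andP[x1 x2].
  rewrite normr_id (le_trans (ler_normB _ _))//; apply: lerD; apply: hM.
    by apply/andP; split; lra.
  by apply/andP; split; lra.
have Ih (h : R) : `]-1, 1[%classic h -> mu.-integrable B (EFin \o (fun x => `|g (x + h) - g x|)).
  by move=> hI; apply: (@bounded_integrable R _ _ (M + M)) => // s /(bnd h s hI).
have cont := @continuity_under_integral R _ mR mu (fun h x => `|g (x + h) - g x|) B mB (-1) 1 Ih.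
have : {in `]-1, 1[%classic, continuous (fun h : R => \int[mu]_(x in B) `|g (x + h) - g x|)}.
  apply: (cont _ (fun=> M + M)).
  - apply: aeW => x _ h _; apply: cvg_norm; apply: cvgB; last exact: cvg_cst.
    by apply: (cvg_comp _ g _ (cg (x + h))); apply: cvgD; [exact: cvg_cst|exact: cvg_id].
  - apply: (@bounded_integrable R _ _ `|M + M| (fun=> M + M)) => //; exact: measurable_cst.
  - by move=> h hI; apply: aeW => x; rewrite /B /= in_itv/= => /(bnd h x hI).
have I0 : (0 : R) \in `]-1, 1[%classic by rewrite inE/= in_itv/= ltrN10 ltr01.
move=> /(_ 0 I0) /cvgrPdist_lt/(_ e e0); rewrite near_nbhs => /nbhs_ballP[d /= d0 hd].
exists (Num.min d 1); first by rewrite lt_min d0 ltr01.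
move=> h; rewrite lt_min => /andP[hd1 h1].
have hI : `]-1, 1[%classic h by rewrite /= in_itv/= -ltr_norml.
have := hd h; rewrite /ball/= sub0r normrN => /(_ hd1).
have -> : \int[mu]_(x in B) `|g (x + 0) - g x| = 0.
  rewrite (@eq_Rintegral _ _ _ _ _ (fun=> 0)) ?Rintegral_cst ?mul0r// => x _.
  by rewrite addr0 subrr normr0.
rewrite sub0r normrN => h2.
have -> : (\int[mu]_(x in `[(- a)%R, a]) `|g (x + h) - g x|%:E)%E =
   (\int[mu]_(x in B) `|g (x + h) - g x|)%:E.
  by rewrite /Rintegral fineK//; apply: integrable_fin_num => //; exact: Ih.
by rewrite lee_fin (le_trans (ler_norm _))// ltW.
Qed.

(** Density of continuous functions in [L^1] of an interval, with a third of [e] for each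
    approximation error and for the translation of the approximant. *)
Lemma bounded_translation (v : R -> R) (N : R) : mfun1 v ->
  (forall x : R, `|v x| <= N) -> (forall x : R, N < `|x| -> v x = 0) ->
  forall e : R, 0 < e -> exists2 d : R, 0 < d & forall h : R, `|h| < d ->
    (\int[mu]_x `|v (x + h) - v x|%:E <= e%:E)%E.
Proof.
move=> mv vN v0 e e0.
have N0 : 0 <= N by exact: le_trans (vN 0).
(* A margin for [|h| < 1]: if [|x| <= N + 1], both [x] and [x + h] lie in [E]; otherwise [v]
   vanishes at both. *)
pose a := N + 2; pose E : set mR := `[- a, a]%classic.
have mE : measurable E by exact: measurable_itv.
have Iv : mu.-integrable E (EFin \o v) by apply: (@bounded_integrable R _ _ N) => // s _.
have muE : (mu E < +oo)%E.
  by rewrite [X in (X < _)%E]lebesgue_measure_cc ?ltry// /a; lra.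
have [g_ [cg_ Ig_ g_v]] := approximation_continuous_integrable mE muE Iv.
have e3 : 0 < e / 3 by rewrite divr_gt0.
have [n] := small_integral (f := fun n x => v x - g_ n x) e3 g_v.
set g := g_ n => hg; have cg : continuous g := cg_ n.
have mg : mfun1 g by exact: continuous_measurable_fun.
have [d d0 hd] := continuous_translation a cg e3.
exists (Num.min d 1); first by rewrite lt_min d0 ltr01.
move=> h; rewrite lt_min => /andP[hd1 h1].
pose phi (x : mR) : R := `|v x - g x| * \1_E x.
pose psi (x : mR) : R := `|g (x + h) - g x| * \1_E x.
have mI : mfun1 (\1_E : mR -> R) by exact: measurable_indic.
have msh (f : R -> R) : mfun1 f -> mfun1 (fun x => f (x + h)).
  by move=> mf; apply: (measurableT_comp mf); exact: measurable_funD.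
have mphi : mfun1 phi.
  by apply: measurable_funM => //; apply: measurableT_comp => //; exact: measurable_funB.
have mpsi : mfun1 psi.
  apply: measurable_funM => //; apply: measurableT_comp => //.
  by apply: measurable_funB => //; exact: msh.
have phi0 x : 0 <= phi x by rewrite mulr_ge0 ?indicE.
have psi0 x : 0 <= psi x by rewrite mulr_ge0 ?indicE.
have dom (x : R) : `|v (x + h) - v x| <= phi (x + h) + (psi x + phi x).
  have [xa|xa] := leP `|x| (N + 1).
    have xE : x \in E by rewrite inE /E/= in_itv/= -ler_norml; rewrite /a; lra.
    have xhE : x + h \in E.
      rewrite inE /E/= in_itv/= -ler_norml (le_trans (ler_normD _ _))// /a; lra.
    rewrite /phi /psi !indicE xE xhE !mulr1.
    have := ler_normD (v (x + h) - g (x + h)) ((g (x + h) - g x) + (g x - v x)).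
    have := ler_normD (g (x + h) - g x) (g x - v x).
    rewrite (distrC (g x)) (_ : v (x + h) - g (x + h) + _ = v (x + h) - v x); last by ring.
    lra.
  rewrite !v0 ?subrr ?normr0 ?addr_ge0//; first by lra.
  have := ler_normB (x + h) h; rewrite addrK; lra.
apply: (@le_trans _ _ (\int[mu]_x ((phi (x + h))%:E + ((psi x)%:E + (phi x)%:E)))%E).
  apply: ge0_le_integral => //.
  - apply/measurable_EFinP; apply: measurableT_comp => //.
    by apply: measurable_funB => //; exact: msh.
  - apply: emeasurable_funD; first by apply/measurable_EFinP; exact: (msh phi).
    by apply: emeasurable_funD; apply/measurable_EFinP.
  - by move=> x _; rewrite -!EFinD lee_fin; exact: dom.
rewrite ge0_integralD//=; last 4 first.
- by move=> x _; rewrite lee_fin.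
- by apply/measurable_EFinP; exact: (msh phi).
- by move=> x _; rewrite adde_ge0 ?lee_fin.
- by apply: emeasurable_funD; apply/measurable_EFinP.
rewrite ge0_integralD//=; last 4 first.
- by move=> x _; rewrite lee_fin.
- by apply/measurable_EFinP.
- by move=> x _; rewrite lee_fin.
- by apply/measurable_EFinP.
rewrite (@ge0_integral_shift _ h (fun x => (phi x)%:E))//; last by apply/measurable_EFinP.
rewrite -[X in (X + _ <= _)%E](integral_indicM E (fun x => `|v x - g x|)).
rewrite -[X in (_ + (X + _) <= _)%E](integral_indicM E (fun x => `|g (x + h) - g x|)).
rewrite -[X in (_ + (_ + X) <= _)%E](integral_indicM E (fun x => `|v x - g x|)).
apply: (@le_trans _ _ ((e / 3)%:E + ((e / 3)%:E + (e / 3)%:E))%E).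
  by apply: leeD => //; apply: leeD => //; exact: hd.
by rewrite -!EFinD lee_fin; lra.
Qed.

(** Cut in the value and in the argument, so that one parameter yields a bounded function of bounded
    support. *)
Definition trunc (N : R) (v : R -> R) (x : R) : R :=
  if (`|v x| <= N) && (`|x| <= N) then v x else 0.

Lemma measurable_trunc N v : mfun1 v -> mfun1 (trunc N v).
Proof.
move=> mv; apply: measurable_fun_ifT => //.
apply: measurable_and; apply: measurable_fun_ler => //; exact: measurableT_comp.
Qed.

Lemma trunc_bound N v x : 0 <= N -> `|trunc N v x| <= N.
Proof. by move=> N0; rewrite /trunc; case: ifP => [/andP[]|_]//; rewrite normr0. Qed.

Lemma trunc_support N v x : N < `|x| -> trunc N v x = 0.
Proof. by move=> Nx; rewrite /trunc [_ <= N]leNgt [`|x| <= N]leNgt Nx andbF. Qed.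

Lemma trunc_approx (r c : R) (v : R -> R) : 1 <= r -> mfun1 v -> nle r%:E c v ->
  forall e : R, 0 < e -> exists2 N : R, 0 < N & nle r%:E e (fun x => v x - trunc N v x).
Proof.
move=> r1 mv nv e e0; have r0 : 0 < r by exact: lt_le_trans r1.
have c0 := nle_ge0 nv; move/(nle_finP _ r1 c0) : nv => hv.
pose f n (x : R) : R := `|v x - trunc n.+1%:R v x| `^ r.
have mf n : mfun1 (f n).
  by apply/measurable_EFinP; apply: measurable_powR_norm; apply: measurable_funB => //; exact: measurable_trunc.
have Ig : mu.-integrable setT (fun x => (`|v x| `^ r)%:E).
  apply/integrableP; split; first exact: measurable_powR_norm.
  under eq_integral do rewrite gee0_abs ?lee_fin ?powR_ge0//.
  exact: le_lt_trans hv (ltry _).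
have fv n x : f n x <= `|v x| `^ r.
  apply: ge0_ler_powR; rewrite ?nnegrE ?(ltW r0)//.
  by rewrite /trunc; case: ifP => _; rewrite ?subrr ?normr0 ?subr0.
have fcv x : f n x @[n --> \oo] --> (0 : R).
  apply: cvg_near_cst; exists (Num.bound (`|v x| + `|x|)) => // n /= hn.
  have := @archi_boundP R (`|v x| + `|x|) (addr_ge0 (normr_ge0 _) (normr_ge0 _)).
  have : (Num.bound (`|v x| + `|x|))%:R <= n.+1%:R :> R by rewrite ler_nat ltnW.
  move=> h1 h2; have h3 := normr_ge0 (v x); have h4 := normr_ge0 x.
  rewrite /f /trunc.
  have -> : `|v x| <= n.+1%:R by lra.
  have -> : `|x| <= n.+1%:R by lra.
  by rewrite subrr normr0 powR0// gt_eqF.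
have mf' n : measurable_fun setT (fun x : mR => (f n x)%:E) by apply/measurable_EFinP.
have fx0 n x : 0 <= f n x by exact: powR_ge0.
have acv : {ae mu, forall x : mR, [set: mR] x -> (f n x)%:E @[n --> \oo] --> cst 0%E x}.
  by apply: aeW => x _; apply: cvg_EFin; [exact: nearW|exact: fcv].
have adom : {ae mu, forall (x : mR) n, [set: mR] x -> (`|(f n x)%:E| <= (`|v x| `^ r)%:E)%E}.
  by apply: aeW => x n _; rewrite gee0_abs lee_fin.
have [_ h _] := @dominated_convergence _ mR R mu setT measurableT
  (fun n x => (f n x)%:E) (cst 0%E) (fun x => (`|v x| `^ r)%:E) mf' (measurable_cst _) acv Ig adom.
have er0 : 0 < e `^ r by exact: powR_gt0.
have [|n hn] := small_integral (f := f) (D := setT) er0.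
  move: h; rewrite (_ : (fun n : nat => _) = (fun n => \int[mu]_x `|(f n x)%:E|)%E)//.
  by apply/funext => n /=; apply: eq_integral => x _; rewrite /= subr0.
exists n.+1%:R => //; apply/(nle_finP _ r1 (ltW e0)); apply: le_trans hn.
by rewrite le_eqVlt; apply/orP; left; apply/eqP; apply: eq_integral => x _; rewrite (ger0_norm (fx0 n x)).
Qed.

(** For a truncated function the increment [D] satisfies [|D| ^ r <= (2 * N) ^ (r - 1) * |D|], which
    reduces [L^r] to the [L^1] statement; the truncation error is unchanged by translation. *)
Lemma translation_continuous (r c : R) (v : R -> R) : 1 <= r -> mfun1 v -> nle r%:E c v ->
  forall e : R, 0 < e -> exists2 d : R, 0 < d & forall h : R, `|h| < d ->
    nle r%:E e (fun x => v (x + h) - v x).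
Proof.
move=> r1 mv nv e e0; have r0 : 0 < r by exact: lt_le_trans r1.
have r1E : (1 <= r%:E)%E by rewrite lee_fin.
have e3 : 0 < e / 3 by rewrite divr_gt0.
have [N N0 hN] := trunc_approx r1 mv nv e3; set w := trunc N v in hN.
have mw : mfun1 w by exact: measurable_trunc.
have D0 : 0 < 2 * N by rewrite mulr_gt0.
pose e' := (e / 3) `^ r / (2 * N) `^ (r - 1).
have e'0 : 0 < e' by rewrite divr_gt0// powR_gt0.
have [d d0 hd] := bounded_translation mw (fun x => trunc_bound v x (ltW N0))
  (fun x => @trunc_support N v x) e'0.
exists d => // h hhd.
have msh (f : R -> R) : mfun1 f -> mfun1 (fun x => f (x + h)).
  by move=> mf; apply: (measurableT_comp mf); exact: measurable_funD.
have mdw : mfun1 (fun x => w (x + h) - w x) by apply: measurable_funB => //; exact: msh.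
have nw : nle r%:E (e / 3) (fun x => w (x + h) - w x).
  apply/(nle_finP _ r1 (ltW e3)).
  apply: (@le_trans _ _ (\int[mu]_x (((2 * N) `^ (r - 1))%:E * `|w (x + h) - w x|%:E))%E).
    apply: ge0_le_integral => //.
    - exact: measurable_powR_norm.
    - apply/measurable_EFinP; apply: measurable_funM => //; exact: measurableT_comp.
    - move=> x _; rewrite -EFinM lee_fin.
      have dD : `|w (x + h) - w x| <= 2 * N.
        rewrite (le_trans (ler_normB _ _))// mulr_natl mulr2n.
        by apply: lerD; apply: trunc_bound; exact: ltW.
      rewrite -(mulr_powRB1 (normr_ge0 _) r0) mulrC.
      rewrite ler_wpM2r// ge0_ler_powR// ?subr_ge0// nnegrE//.
      exact: ltW.
  rewrite ge0_integralZl_EFin//; last by rewrite powR_ge0.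
    apply: (@le_trans _ _ (((2 * N) `^ (r - 1))%:E * e'%:E)%E).
      by rewrite lee_wpmul2l ?lee_fin ?powR_ge0//; exact: hd.
    by rewrite -EFinM lee_fin /e' mulrC divfK// gt_eqF// powR_gt0.
  by apply/measurable_EFinP; exact: measurableT_comp.
have mvw : mfun1 (fun x => v x - w x) by exact: measurable_funB.
have n1 := nle_shift h r1E mvw hN.
have n3 := nleZ (-1) r1E mvw hN.
have m3 : mfun1 (fun x => -1 * (v x - w x)) by exact: measurable_funM.
have := nle_add r1E (msh _ mvw) (measurable_funD mdw m3) n1 (nle_add r1E mdw m3 nw n3).
rewrite normrN normr1 mul1r (_ : e / 3 + _ = e); last by field.
by rewrite (_ : (fun x => _) = (fun x => v (x + h) - v x))//; apply/funext => x /=; ring.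
Qed.

(** Every [L^p] function, [p = oo] included, becomes integrable when restricted to
    [[-(M + 1), M + 1]]. For [|h| < 1] the restriction is invisible on [[-M, M]]. *)
Lemma local_translation (p : \bar R) (c : R) (v : R -> R) : (1 <= p)%E -> mfun1 v -> nle p c v ->
  forall M e : R, 0 <= M -> 0 < e -> exists2 d : R, 0 < d & forall h : R, `|h| < d ->
    (\int[mu]_(x in `[(- M)%R, M]) `|v (x + h) - v x|%:E <= e%:E)%E.
Proof.
move=> p1 mv nv M e M0 e0.
pose E : set mR := `[- (M + 1), M + 1]%classic.
have mE : measurable E by exact: measurable_itv.
pose v1 (x : mR) : R := v x * \1_E x.
have mv1 : mfun1 v1 by apply: measurable_funM => //; exact: measurable_indic.
have c0 := nle_ge0 nv.
have ab : - (M + 1) <= M + 1 by lra.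
have hl := nle_loc p1 mv ab nv.
have c1 : 0 <= (1 + (M + 1 - - (M + 1))) * c by rewrite mulr_ge0//; lra.
have nv1 : nle 1%:E ((1 + (M + 1 - - (M + 1))) * c) v1.
  apply/(nle_finP _ (lexx _) c1); rewrite powRr1//; apply: le_trans hl.
  rewrite (integral_indicM _ (fun x => `|v x|)) le_eqVlt; apply/orP; left; apply/eqP.
  by apply: eq_integral => x _; rewrite powRr1// normrM indicE [`|_%:R|]ger0_norm.
have [d d0 hd] := translation_continuous (lexx _) mv1 nv1 e0.
exists (Num.min d 1); first by rewrite lt_min d0 ltr01.
move=> h; rewrite lt_min => /andP[hd1 h1].
have /(nle_finP _ (lexx _) (ltW e0)) := hd h hd1; rewrite powRr1 ?(ltW e0)//; apply: le_trans.
have msh (f : R -> R) : mfun1 f -> mfun1 (fun x => f (x + h)).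
  by move=> mf; apply: (measurableT_comp mf); exact: measurable_funD.
have mB (f : R -> R) : mfun1 f -> mfun1 (fun x => f (x + h) - f x).
  by move=> mf; apply: measurable_funB => //; exact: msh.
apply: (@le_trans _ _ (\int[mu]_(x in `[(- M)%R, M]) (`|v1 (x + h) - v1 x| `^ 1)%:E)%E).
  apply: ge0_le_integral => //.
  - by apply/measurable_EFinP; apply: measurable_funTS; apply: measurableT_comp => //; exact: mB.
  - by apply: measurable_funTS; exact: measurable_powR_norm (mB _ mv1).
  - move=> x; rewrite /= in_itv/= => xM; rewrite powRr1// lee_fin.
    have xM' : `|x| <= M by rewrite ler_norml.
    have xE : x \in E by rewrite inE /E/= in_itv/= -ler_norml; lra.
    have xhE : x + h \in E.
      by rewrite inE /E/= in_itv/= -ler_norml (le_trans (ler_normD _ _))//; lra.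
    by rewrite /v1 !indicE xE xhE !mulr1.
by apply: ge0_subset_integral => //; exact: measurable_powR_norm (mB _ mv1).
Qed.

End Translation.

(** * Continuous curves in [L^p] *)

Section Curves.
Context {R : realType}.
Local Notation mu := (@lebesgue_measure R).
Local Notation mR := (measurableTypeR R).
Local Notation mfun1 := (measurable_fun [set: mR]).
Local Notation mfun2 := (measurable_fun [set: (mR * mR)%type]).

Lemma LpP (p : \bar R) (f : R -> R) : Lp p f <-> mfun1 f /\ exists c, nle p c f.
Proof.
rewrite /Lp /= /Lfun; split.
  move=> /andP[/= mf]; rewrite inE/= /finite_norm => hf.
  split; first by move: mf; rewrite inE.
  exists (fine 'N[mu]_p[EFin \o f]).
  by rewrite /nle fineK// ge0_fin_numE// Lnorm_ge0.
move=> [mf [c hc]]; apply/andP; split; rewrite inE//=.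
by rewrite /finite_norm; exact: le_lt_trans hc (ltry _).
Qed.

Definition norm_continuous (r : R) (u : R * R -> R) :=
  forall t0 e : R, 0 <= t0 -> 0 < e -> exists2 d : R, 0 < d &
    forall t : R, 0 <= t -> `|t - t0| < d -> nle r%:E e (fun x => u (t, x) - u (t0, x)).

Definition loc_continuous (u : R * R -> R) :=
  forall t0 M e : R, 0 <= t0 -> 0 <= M -> 0 < e -> exists2 d : R, 0 < d &
    forall t : R, 0 <= t -> `|t - t0| < d ->
      (\int[mu]_(x in `[(- M)%R, M]) `|u (t, x) - u (t0, x)|%:E <= e%:E)%E.

Definition loc_bounded (p : \bar R) (u : R * R -> R) :=
  forall T : R, exists c, forall t : R, 0 <= t <= T -> nle p c (fun x => u (t, x)).

(* For [p = oo] there is no norm continuity; [loc_continuous] and [loc_bounded]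
   imply weak-* continuity. *)
Definition curve (p : \bar R) (u : R * R -> R) :=
  [/\ mfun2 u, loc_bounded p u, (forall r, p = r%:E -> norm_continuous r u) &
      loc_continuous u].

Lemma loc_norm_add (M A B : R) (f g : R -> R) : mfun1 f -> mfun1 g ->
  (\int[mu]_(x in `[(- M)%R, M]) `|f x|%:E <= A%:E)%E ->
  (\int[mu]_(x in `[(- M)%R, M]) `|g x|%:E <= B%:E)%E ->
  (\int[mu]_(x in `[(- M)%R, M]) `|f x + g x|%:E <= (A + B)%:E)%E.
Proof.
move=> mf mg hf hg.
have mn (h : R -> R) : mfun1 h -> measurable_fun (`[- M, M]%classic : set mR) (fun x => `|h x|%:E).
  by move=> mh; apply/measurable_EFinP; apply: measurable_funTS; exact: measurableT_comp.
apply: (@le_trans _ _ (\int[mu]_(x in `[(- M)%R, M]) (`|f x|%:E + `|g x|%:E))%E).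
  apply: ge0_le_integral => //.
  - by apply: (mn (fun x => f x + g x)); exact: measurable_funD.
  - by apply: emeasurable_funD; exact: mn.
  - by move=> x _; rewrite -EFinD lee_fin ler_normD.
by rewrite ge0_integralD//= ?EFinD; [exact: leeD|exact: mn|exact: mn].
Qed.

Lemma loc_normZ (M A k : R) (f : R -> R) : mfun1 f ->
  (\int[mu]_(x in `[(- M)%R, M]) `|f x|%:E <= A%:E)%E ->
  (\int[mu]_(x in `[(- M)%R, M]) `|k * f x|%:E <= (`|k| * A)%:E)%E.
Proof.
move=> mf hf; under eq_integral do rewrite normrM EFinM.
rewrite ge0_integralZl_EFin//; first by rewrite EFinM lee_wpmul2l// lee_fin.
by apply/measurable_EFinP; apply: measurable_funTS; exact: measurableT_comp.
Qed.

Section Mild.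
Variables (p : \bar R) (b : bool) (a : R -> R) (f u : R * R -> R).
Hypotheses (p1 : (1 <= p)%E) (mU : mfun2 u) (mf : mfun2 f).
Hypotheses (bu : loc_bounded p u) (bf : loc_bounded p f).
Hypothesis If : forall z : R * R, 0 <= z.1 -> integrable_along b f z.
Hypothesis mild : forall z : R * R, 0 <= z.1 -> u z = a (z.2 - sg b * z.1) + J b f z.

(** Comparing points on one characteristic cancels the free wave, for which no rate in time is
    available; what remains is the integral of [f] between the two times. *)
Lemma mild_step (T C t1 t2 : R) : 0 < C ->
  (forall t : R, 0 <= t <= T -> nle p C (fun x => f (t, x))) ->
  0 <= t1 -> t1 <= t2 -> t2 <= T ->
  nle p (C * (t2 - t1)) (fun x => u (t2, x) - u (t1, x - sg b * (t2 - t1))).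
Proof.
move=> C0 hC t10 t12 t2T; have t20 := le_trans t10 t12.
have mI : measurable (`]t1, t2]%classic : set mR) by exact: measurable_itv.
apply: (@nle_int _ p `]t1, t2]%classic (fun=> C) _ (fun z => `|f (z.1, z.2 - sg b * (t2 - z.1))|)) => //.
- rewrite integral_cst//= lebesgue_measure_itv/= lte_fin.
  case: ltP => [_|t21]; first by rewrite -EFinB -EFinM.
  by rewrite (_ : t2 - t1 = 0) ?mulr0 ?mule0//; lra.
- apply: measurableT_comp => //; apply: (measurableT_comp mf).
  apply: measurable_fun_pair => //; apply: measurable_funB => //.
  by apply: measurable_funM => //; exact: measurable_funB.
- move=> s /=; rewrite in_itv/= => /andP[s1 s2].
  have s0 : 0 <= s by exact: le_trans t10 (ltW s1).
  have sT : 0 <= s <= T by rewrite s0 (le_trans s2).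
  have := nle_shift (- (sg b * (t2 - s))) p1 (measurable_slice s mf) (hC s sT).
  by apply: nle_norm => //; apply: (measurableT_comp (measurable_slice s mf)); exact: measurable_funD.
- apply: measurable_funB; first exact: measurable_slice.
  apply: (measurableT_comp (measurable_slice t1 mU)).
  exact: measurable_funD.
- apply: aeW => x.
  have pr := prim_J 0 t20 (If (z := (t2, x)) t20).
  have := prim_increment pr t10 t12 (lexx _).
  rewrite !add0r subrr mulr0 subr0 => inc.
  have -> : u (t2, x) - u (t1, x - sg b * (t2 - t1)) =
      J b f (t2, x) - J b f (t1, x - sg b * (t2 - t1)).
    rewrite !mild//= (_ : x - sg b * (t2 - t1) - sg b * t1 = x - sg b * t2); last by ring.
    by ring.
  rewrite inc.
  have Ic : mu.-integrable `]t1, t2] (EFin \o (fun r => f (r, x - sg b * (t2 - r)))).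
    apply: integrableS (If (z := (t2, x)) t20) => //.
    by apply: subset_itv; rewrite bnd_simp.
  have := le_normr_Rintegral mI Ic.
  rewrite -lee_fin => /le_trans; apply.
  rewrite /Rintegral fineK//.
  apply: integrable_fin_num => //.
  exact: (integrable_norm_itv Ic).
Qed.

Lemma mild_increment (T C t t0 : R) : 0 < C ->
  (forall s : R, 0 <= s <= T -> nle p C (fun x => f (s, x))) ->
  0 <= t <= T -> 0 <= t0 <= T ->
  nle p (C * `|t - t0|) (fun x => u (t, x) - u (t0, x - sg b * (t - t0))).
Proof.
move=> C0 hC /andP[t0' tT] /andP[t00 t0T]; have [le|lt] := leP t0 t.
  by rewrite ger0_norm ?subr_ge0//; exact: mild_step hC _ _ _.
rewrite ltr0_norm ?subr_lt0// opprB.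
have h := mild_step C0 hC t0' (ltW lt) t0T.
have ms s (k : R) : mfun1 (fun x => u (s, x + k)).
  by apply: (measurableT_comp (measurable_slice s mU)); exact: measurable_funD.
have mh : mfun1 (fun x => u (t0, x) - u (t, x - sg b * (t0 - t))).
  by apply: measurable_funB; [exact: measurable_slice|exact: ms].
have := nleZ (-1) p1 _ (nle_shift (sg b * (t0 - t)) p1 mh h).
rewrite normrN normr1 mul1r (_ : (fun x => -1 * _) =
  (fun x => u (t, x) - u (t0, x - sg b * (t - t0)))).
  apply; apply: measurable_funB; first exact: ms.
  rewrite (_ : (fun x => _) = (fun x => u (t, x))); first exact: measurable_slice.
  by apply/funext => x; rewrite addrK.
by apply/funext => x; rewrite addrK mulN1r opprB; congr (_ - u (_, _)); ring.
Qed.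

(** [u t - u t0] is an increment along characteristics, of order [|t - t0|], plus a translation
    increment of the fixed function [u t0]. The latter is small in [L^p] for finite [p], and locally
    in [L^1] for every [p]. *)
Lemma mild_curve : curve p u.
Proof.
have hf (t0 : R) : 0 <= t0 -> exists C : R, 0 < C /\
    forall t : R, 0 <= t <= t0 + 1 -> nle p C (fun x => f (t, x)).
  move=> t00; have [C hC] := bf (t0 + 1).
  have C0 : 0 <= C by apply: (nle_ge0 (hC t0 _)); rewrite t00 lerDl ler01.
  exists (C + 1); split; first by lra.
  by move=> t /hC; apply: nle_weak; rewrite lerDl.
have near1 (t t0 : R) : 0 <= t -> `|t - t0| < 1 -> 0 <= t <= t0 + 1.
  by move=> ->; rewrite ltr_norml => /andP[_ h] /=; lra.
have refl (t0 : R) : 0 <= t0 -> 0 <= t0 <= t0 + 1 by move=> ->; rewrite lerDl ler01.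
have ssh (d t t0 : R) : `|t - t0| < d -> `|- (sg b * (t - t0))| < d.
  by rewrite normrN normrM sg_norm mul1r.
have ms s (k : R) : mfun1 (fun x => u (s, x + k)).
  by apply: (measurableT_comp (measurable_slice s mU)); exact: measurable_funD.
have mA t t0 : mfun1 (fun x => u (t, x) - u (t0, x - sg b * (t - t0))).
  by apply: measurable_funB; [exact: measurable_slice|exact: ms].
have mB (t0 k : R) : mfun1 (fun x => u (t0, x + k) - u (t0, x)).
  by apply: measurable_funB; [exact: ms|exact: measurable_slice].
split => //.
- move=> r pr t0 e t00 e0; have [C [C0 hC]] := hf _ t00.
  have [c hc] := bu t0; have tt : 0 <= t0 <= t0 by rewrite t00 lexx.
  have r1 : 1 <= r by rewrite -lee_fin -pr.
  have e2 : 0 < e / 2 by rewrite divr_gt0.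
  have hc0 : nle r%:E c (fun x => u (t0, x)) by rewrite -pr; exact: hc.
  have [d d0 hd] := translation_continuous r1 (measurable_slice t0 mU) hc0 e2.
  exists (Num.min d (Num.min 1 (e / 2 / C))).
    by rewrite !lt_min d0 ltr01 divr_gt0.
  move=> t t0'; rewrite !lt_min => /and3P[h1 h2 h3].
  have n1 := mild_increment C0 hC (near1 _ _ t0' h2) (refl _ t00).
  have n2 := hd _ (ssh _ _ _ h1); rewrite -pr in n2 *.
  have := nle_add p1 (mA t t0) (mB t0 (- (sg b * (t - t0)))) n1 n2.
  rewrite (_ : (fun x => _) = (fun x => u (t, x) - u (t0, x))); last by apply/funext => x; ring.
  apply: nle_weak; rewrite ltr_pdivlMr// mulrC in h3; lra.
- move=> t0 M e t00 M0 e0; have [C [C0 hC]] := hf _ t00.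
  have [c hc] := bu t0; have tt : 0 <= t0 <= t0 by rewrite t00 lexx.
  have e2 : 0 < e / 2 by rewrite divr_gt0.
  have [d d0 hd] := local_translation p1 (measurable_slice t0 mU) (hc t0 tt) M0 e2.
  pose L := (1 + (M - - M)) * C.
  have L0 : 0 < L by rewrite mulr_gt0//; lra.
  exists (Num.min d (Num.min 1 (e / 2 / L))).
    by rewrite !lt_min d0 ltr01 divr_gt0.
  move=> t t0'; rewrite !lt_min => /and3P[h1 h2 h3].
  have n1 := mild_increment C0 hC (near1 _ _ t0' h2) (refl _ t00).
  have MM : - M <= M by lra.
  have i1 := nle_loc p1 (mA t t0) MM n1.
  have i2 := hd _ (ssh _ _ _ h1).
  have := loc_norm_add (mA t t0) (mB t0 (- (sg b * (t - t0)))) i1 i2.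
  rewrite (_ : (fun x : mR => _) = (fun x => `|u (t, x) - u (t0, x)|%:E)); last first.
    by apply/funext => x; congr (`|_|%:E); ring.
  move=> /le_trans; apply; rewrite lee_fin mulrA -/L.
  rewrite ltr_pdivlMr// mulrC in h3; lra.
Qed.

End Mild.

(** [psi] and [A] mix the two families, so their components have no mild form of their own. *)
Lemma curve_lin p (k l : R) (u v : R * R -> R) : (1 <= p)%E -> curve p u -> curve p v ->
  curve p (fun z => k * u z + l * v z).
Proof.
move=> p1 [mU bU nU lU] [mV bV nV lV].
have mU' t := measurable_slice t mU; have mV' t := measurable_slice t mV.
have mdU t t0 : mfun1 (fun x => u (t, x) - u (t0, x)) by exact: measurable_funB.
have mdV t t0 : mfun1 (fun x => v (t, x) - v (t0, x)) by exact: measurable_funB.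
have mZ (a : R) (f : R -> R) : mfun1 f -> mfun1 (fun x => a * f x) by move=> mf; exact: measurable_funM.
pose K := `|k| + `|l| + 1.
have K0 : 0 < K by rewrite ltr_wpDl// addr_ge0.
have small (e : R) : 0 < e -> 0 < e / K by move=> e0; rewrite divr_gt0.
have sumE (e : R) : 0 < e -> `|k| * (e / K) + `|l| * (e / K) <= e.
  by move=> e0; rewrite -mulrDl mulrCA ger_pMr// ler_pdivrMr// mul1r lerDl.
have dE t t0 : (fun x : R => k * (u (t, x) - u (t0, x)) + l * (v (t, x) - v (t0, x))) =
    (fun x : R => k * u (t, x) + l * v (t, x) - (k * u (t0, x) + l * v (t0, x))).
  by apply/funext => x; ring.
split.
- by apply: measurable_funD; exact: measurable_funM.
- move=> T; have [c hc] := bU T; have [d hd] := bV T.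
  exists (`|k| * c + `|l| * d) => t tT.
  by apply: nle_add => //; [exact: mZ|exact: mZ|exact: nleZ (hc t tT)|exact: nleZ (hd t tT)].
- move=> r pr t0 e t00 e0.
  have [d d0 hd] := nU r pr t0 _ t00 (small e e0); have [d' d'0 hd'] := nV r pr t0 _ t00 (small e e0).
  exists (Num.min d d'); first by rewrite lt_min d0.
  move=> t t1; rewrite lt_min => /andP[h1 h2].
  have n1 := hd t t1 h1; have n2 := hd' t t1 h2; rewrite -pr in n1 n2 *.
  rewrite -dE; apply: (nle_weak (sumE e e0)).
  by apply: nle_add => //; [exact: mZ|exact: mZ|exact: nleZ|exact: nleZ].
- move=> t0 M e t00 M0 e0.
  have [d d0 hd] := lU t0 M _ t00 M0 (small e e0); have [d' d'0 hd'] := lV t0 M _ t00 M0 (small e e0).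
  exists (Num.min d d'); first by rewrite lt_min d0.
  move=> t t1; rewrite lt_min => /andP[h1 h2].
  have := loc_norm_add (mZ k _ (mdU t t0)) (mZ l _ (mdV t t0))
    (loc_normZ k (mdU t t0) (hd t t1 h1)) (loc_normZ l (mdV t t0) (hd' t t1 h2)).
  rewrite (_ : (fun x : mR => _) = (fun x => `|k * u (t, x) + l * v (t, x) -
    (k * u (t0, x) + l * v (t0, x))|%:E)); last first.
    by apply/funext => x; congr (`|_|%:E); ring.
  by move=> /le_trans; apply; rewrite lee_fin; exact: sumE.
Qed.

Lemma curve_bounded p u : curve p u -> loc_bounded +oo%E u -> curve +oo%E u.
Proof. by move=> [mU bU nU lU] b; split. Qed.

Lemma nle1P (c : R) (f : R -> R) : nle 1%E c f <-> (\int[mu]_x `|f x|%:E <= c%:E)%E.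
Proof. by rewrite /nle Lnorm1. Qed.

(** Split [g] into its truncation [w] and the rest: [w] pairs with the local [L^1] distance of the
    slices, and the rest is small in [L^1] against the uniform bound [2 * K]. *)
Lemma curve_weak_continuous u g (t0 : R) : curve +oo%E u -> Lp 1%E g -> 0 <= t0 ->
  forall e : R, 0 < e -> exists2 d : R, 0 < d & forall t : R, 0 <= t -> `|t - t0| < d ->
    `|\int[mu]_x (u (t, x) * g x) - \int[mu]_x (u (t0, x) * g x)| <= e.
Proof.
move=> [mU bU _ lU] /LpP[mg [cg ng]] t00 e e0.
have [K0 hK0] := bU (t0 + 1).
pose K := `|K0| + 1.
have K1 : 0 < K by rewrite ltr_wpDl.
have hK (t : R) : 0 <= t <= t0 + 1 -> {ae mu, forall x, `|u (t, x)| <= K}.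
  move=> tT; have /nle_inftyP := hK0 t tT; apply: filterS => x /le_trans; apply.
  by rewrite (le_trans (ler_norm _))// /K lerDl.
have Iug t : 0 <= t <= t0 + 1 -> mu.-integrable setT (EFin \o (fun x => u (t, x) * g x)).
  move=> tT; apply/integrableP; split.
    apply/measurable_EFinP; apply: measurable_funM => //; exact: measurable_slice.
  apply: (@le_lt_trans _ _ (\int[mu]_x (K%:E * `|g x|%:E))%E).
    apply: ae_ge0_le_integral => //.
    - apply/measurable_EFinP; apply: measurableT_comp => //.
      by apply: measurable_funM => //; exact: measurable_slice.
    - by move=> x _; rewrite mule_ge0// lee_fin ltW.
    - by apply/measurable_EFinP; apply: measurable_funM => //; exact: measurableT_comp.
    - by move: (hK t tT); apply: filterS => x h _; rewrite /= -EFinM lee_fin normrM ler_wpM2r.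
  rewrite ge0_integralZl_EFin//; last 2 first.
  - by apply/measurable_EFinP; exact: measurableT_comp.
  - exact: ltW.
  move/nle1P in ng; apply: (@le_lt_trans _ _ (K%:E * cg%:E)%E); last exact: ltry.
  by rewrite lee_wpmul2l// lee_fin ltW.
(* [e / (4 * K)] against [2 * K], and below [e / (2 * N)] against [N], give [e / 2] each. *)
have e1 : 0 < e / (4 * K) by rewrite divr_gt0// mulr_gt0.
have [N N0 hN] := trunc_approx (lexx _) mg ng e1; set w := trunc N g in hN.
have mw : mfun1 w by exact: measurable_trunc.
have e2 : 0 < e / (2 * N) by rewrite divr_gt0// mulr_gt0.
have [d d0 hd] := lU t0 N _ t00 (ltW N0) e2.
exists (Num.min d 1); first by rewrite lt_min d0 ltr01.
move=> t t1; rewrite lt_min => /andP[h1 h2].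
have tT : 0 <= t <= t0 + 1 by rewrite t1; move: h2; rewrite ltr_norml => /andP[_ h2] /=; lra.
have t0T : 0 <= t0 <= t0 + 1 by rewrite t00 lerDl ler01.
rewrite -RintegralB//; [|exact: Iug|exact: Iug].
have ID : mu.-integrable setT (EFin \o (fun x => u (t, x) * g x - u (t0, x) * g x)).
  by apply: integrableBR => //; exact: Iug.
apply: (le_trans (le_normr_Rintegral measurableT ID)).
rewrite -lee_fin /Rintegral fineK; last first.
  by apply: integrable_fin_num => //; exact: (integrable_norm ID).
pose E : set mR := `[- N, N]%classic.
have mE : measurable E by exact: measurable_itv.
pose D (x : mR) : R := `|u (t, x) - u (t0, x)|.
have mD : mfun1 D by apply: measurableT_comp => //; apply: measurable_funB; exact: measurable_slice.
have mgw : mfun1 (fun x => `|g x - w x|) by apply: measurableT_comp => //; exact: measurable_funB.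
have mDE : mfun1 (fun x => D x * \1_E x) by apply: measurable_funM => //; exact: measurable_indic.
have DE0 x : 0 <= D x * \1_E x by rewrite mulr_ge0 ?indicE// normr_ge0.
have K20 : 0 <= 2 * K by rewrite mulr_ge0// ltW.
have N1 := ltW N0.
apply: (@le_trans _ _ (\int[mu]_x (N%:E * (D x * \1_E x)%:E + (2 * K)%:E * `|g x - w x|%:E))%E).
  apply: ae_ge0_le_integral => //.
  - apply/measurable_EFinP; apply: measurableT_comp => //.
    by apply: measurable_funB; apply: measurable_funM => //; exact: measurable_slice.
  - by move=> x _; rewrite -!EFinM -EFinD lee_fin; apply: addr_ge0; apply: mulr_ge0.
  - by apply/measurable_EFinP; apply: measurable_funD; exact: measurable_funM.
  move: (hK t tT) (hK t0 t0T); apply: filterS2 => x k1 k2 _.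
  rewrite -!EFinM -EFinD lee_fin -mulrBl normrM -/(D x).
  have D2 : D x <= 2 * K by rewrite (le_trans (ler_normB _ _))//; lra.
  have D0 : 0 <= D x by exact: normr_ge0.
  have gw : `|g x| <= `|w x| + `|g x - w x|.
    by have := ler_normD (w x) (g x - w x); rewrite addrC subrK.
  apply: (le_trans (ler_wpM2l D0 gw)); rewrite mulrDr; apply: lerD; last by rewrite ler_wpM2r.
  rewrite [leRHS]mulrCA; apply: ler_wpM2l => //; rewrite indicE.
  have [xE|xE] := boolP (x \in E); first by rewrite mulr1; exact: trunc_bound (ltW N0).
  rewrite mulr0 /w trunc_support ?normr0// ltNge; apply: contra xE.
  by rewrite inE /E/= in_itv/= -ler_norml.
rewrite ge0_integralD//=; last 4 first.
- by move=> x _; rewrite -EFinM lee_fin; apply: mulr_ge0.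
- by apply/measurable_EFinP; exact: measurable_funM.
- by move=> x _; rewrite -EFinM lee_fin; apply: mulr_ge0.
- by apply/measurable_EFinP; exact: measurable_funM.
rewrite !ge0_integralZl_EFin//; last 3 first.
- by apply/measurable_EFinP.
- by move=> x _; rewrite lee_fin.
- by apply/measurable_EFinP.
move/nle1P in hN.
rewrite -(integral_indicM E D).
apply: (@le_trans _ _ (N%:E * (e / (2 * N))%:E + (2 * K)%:E * (e / (4 * K))%:E)%E).
  apply: leeD; apply: lee_wpmul2l => //; exact: hd.
rewrite -!EFinM -EFinD lee_fin le_eqVlt; apply/orP; left; apply/eqP; field.
by rewrite !gt_eqF.
Qed.

Lemma cvg_within0 (F : R -> \bar R) (t0 : R) :
  (forall t, (0 <= F t)%E) ->
  (forall e : R, 0 < e -> exists2 d : R, 0 < d & forall t : R, 0 <= t -> `|t - t0| < d -> (F t <= e%:E)%E) ->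
  F t @[t --> within `[0, +oo[ (nbhs t0)] --> 0%E.
Proof.
move=> F0 h.
have near_d (P : R -> Prop) (d : R) : 0 < d -> (forall t : R, 0 <= t -> `|t - t0| < d -> P t) ->
    \forall t \near within `[0, +oo[ (nbhs t0), P t.
  move=> d0 hP; rewrite near_withinE; apply/nbhs_ballP; exists d => // t.
  by rewrite /ball/= in_itv/= andbT distrC => td t0'; exact: hP.
apply/fine_cvgP; split.
  have [d d0 hd] := h 1 ltr01; apply: (near_d _ d d0) => t t1 td.
  by rewrite ge0_fin_numE// (le_lt_trans (hd t t1 td))// ltry.
apply/cvgrPdist_le => e e0; have [d d0 hd] := h e e0.
apply: (near_d _ d d0) => t t1 td /=; rewrite sub0r normrN ger0_norm ?fine_ge0//.
rewrite -lee_fin fineK; first exact: hd.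
by rewrite ge0_fin_numE// (le_lt_trans (hd t t1 td))// ltry.
Qed.

Lemma curve_CLp p u : (1 <= p)%E -> curve p u -> CLp p u.
Proof.
move=> p1 cu; have [mU bU nU lU] := cu; split.
- exact: measurable_funTS.
- move=> t t0; apply/LpP; split; first exact: measurable_slice.
  by have [c hc] := bU t; exists c; apply: hc; rewrite t0 lexx.
rewrite /Lp_continuous; case: eqP => [pE|pN].
  rewrite pE in cu bU; split; first by move=> T; exact: bU.
  move=> g hg; apply/subspace_continuousP => t0 /=; rewrite in_itv/= andbT => t00.
  apply/cvgrPdist_le => e e0.
  have [d d0 hd] := curve_weak_continuous cu hg t00 e0.
  rewrite near_withinE; apply/nbhs_ballP; exists d => // t.
  by rewrite /ball/= in_itv/= andbT distrC => td t0'; rewrite distrC; exact: hd.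
move=> t0 t00; apply: cvg_within0; first by move=> t; exact: Lnorm_ge0.
case: p p1 cu bU nU pN => [r| |]//= p1 cu bU nU _ e e0.
exact: nU.
Qed.

End Curves.

(** * Existence for the real system *)

Section Existence.
Context {R : realType}.
Local Notation mu := (@lebesgue_measure R).
Local Notation mR := (measurableTypeR R).
Local Notation mfun1 := (measurable_fun [set: mR]).
Local Notation mfun2 := (measurable_fun [set: (mR * mR)%type]).

Lemma gauge0 b (z : R * R) :
  gauge (fun _ _ => 0) (fun _ _ => 0) (fun _ _ => 0) b z = 0 :> R.
Proof.
rewrite /gauge (_ : J b _ z = 0) ?mulr0 ?subrr// /J.
rewrite (@eq_Rintegral _ _ _ _ _ (fun=> 0)); first by rewrite Rintegral_cst// mul0r.
by move=> s _; rewrite /rho !expr0n/= !addr0 mulr0.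
Qed.

Lemma ae_nle_pt (p : \bar R) (c : R) (f g : R -> R) : (1 <= p)%E -> mfun1 f -> mfun1 g ->
  (forall x, `|f x| <= g x) -> nle p c g -> nle p c f.
Proof.
move=> p1 mf mg fg; apply: ae_nle => //; apply: aeW => x.
by rewrite (le_trans (fg x))// ler_norm.
Qed.

(** The fixed point is constructed with sup bounds only; its [L^p] bounds come afterwards from the
    estimates for solutions. They make the forces locally bounded in [L^p], as [mild_curve]
    demands. *)
Lemma real_existence (m K0 d : R) (p : \bar R) (P0 Q0 B0 : bool -> R -> R) :
  0 <= m -> (1 <= p)%E ->
  (forall b, mfun1 (P0 b)) -> (forall b, mfun1 (Q0 b)) -> (forall b, mfun1 (B0 b)) ->
  (forall b x, `|P0 b x| <= K0) -> (forall b x, `|Q0 b x| <= K0) ->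
  (forall b, nle p d (P0 b)) -> (forall b, nle p d (Q0 b)) -> (forall b, nle p d (B0 b)) ->
  exists P Q, [/\ forall T : R, exists K, bounded_state T K P Q,
    forall T : R, real_solution m T P0 Q0 B0 P Q &
    forall b, [/\ curve p (P b), curve +oo%E (P b), curve p (Q b), curve +oo%E (Q b) &
      curve p (gauge B0 P Q b)]].
Proof.
move=> m0 p1 mP0 mQ0 mB bP0 bQ0 nP0 nQ0 nB.
have K00 : 0 <= K0 by exact: le_trans (bP0 true 0).
have [[P Q] /= [tPQ fixPQ]] := step_fixpoint m0 p1 K00 mP0 mQ0 bP0 bQ0 mB nB.
have sol := fixpoint_solution m0 p1 K00 mB nB tPQ fixPQ.
pose K T : R := 4 * K0 * expR ((8 * m + 1) * T).
have st T : bounded_state T (K T) P Q := tame_bounded m0 K00 T tPQ.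
have KT0 T : 0 <= K T by rewrite mulr_ge0// ?expR_ge0// mulr_ge0.
have rsol T : real_solution m T P0 Q0 B0 P Q.
  by move=> b t /andP[t0 _]; apply: aeW => x; exact: (sol b (t, x) t0).
exists P, Q; split => [T||b]; [by exists (K T)|exact: rsol|].
have d0 : 0 <= d := nle_ge0 (nP0 true).
have mP b' : mfun2 (P b') by have [] := st 0 b'.
have mQ b' : mfun2 (Q b') by have [] := st 0 b'.
have mmod : mfun2 (mod2 P Q) by apply: measurable_funD; exact: measurable_mod1 (st 0).
have mg b' : mfun2 (gauge B0 P Q b') := measurable_gauge b' mB (st 0).
have T0 (T t : R) : 0 <= t <= T -> 0 <= T by move=> /andP[]; exact: le_trans.
have nmod T (t : R) : 0 <= t <= T -> nle p (apriori_cst m T * d) (fun x => mod2 P Q (t, x)).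
  by move=> tT; exact: (apriori_solution m0 p1 p1 (T0 _ _ tT) mP0 mQ0 mB nP0 nQ0 nB (st T) (rsol T) tT).
have Pmod b' z : `|P b' z| <= mod2 P Q z.
  by apply: le_trans (mod1_le_mod2 P Q b' z); rewrite lerDl.
have Qmod b' z : `|Q b' z| <= mod2 P Q z.
  by apply: le_trans (mod1_le_mod2 P Q b' z); rewrite lerDr.
have bP b' : loc_bounded p (P b').
  move=> T; exists (apriori_cst m T * d) => t tT.
  by apply: ae_nle_pt (nmod T t tT) => //; exact: measurable_slice.
have bQ b' : loc_bounded p (Q b').
  move=> T; exists (apriori_cst m T * d) => t tT.
  by apply: ae_nle_pt (nmod T t tT) => //; exact: measurable_slice.
(* The stability estimate against the zero solution, whose potential vanishes. *)
have bg b' : loc_bounded p (gauge B0 P Q b').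
  move=> T; exists ((1 + K T * stability_cst m (K T) T) * d) => t tT.
  have [st0 sol0] := zero_solution m T (KT0 T).
  have m00 (b'' : bool) : mfun1 (fun=> 0 : R) by exact: measurable_cst.
  have n00 (b'' : bool) : nle p 0 (fun=> 0 : R) by exact: nle0.
  have sub0 (f : bool -> R -> R) : (forall b, nle p d (f b)) ->
      forall b, nle p d (fun x => f b x - 0).
    by move=> nf b''; rewrite (_ : (fun x => _) = f b'')//; apply/funext => x; rewrite subr0.
  have := gauge_stability m0 p1 (T0 _ _ tT) mP0 mQ0 m00 m00 mB nB m00 n00 (st T) st0 (rsol T) sol0
    (sub0 _ nB) (sub0 _ nP0) (sub0 _ nQ0) b' tT.
  rewrite (_ : (fun x => _) = (fun x => gauge B0 P Q b' (t, x)))//.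
  by apply/funext => x; rewrite gauge0 subr0.
have binf (u : R * R -> R) : (forall T, forall z : R * R, 0 <= z.1 <= T -> `|u z| <= K T) ->
    loc_bounded +oo%E u.
  by move=> hu T; exists (K T) => t tT; apply/nle_inftyP; apply: aeW => x; exact: (hu T (t, x)).
have [mF mG] := force_measurable m b mB (st 0).
have force_bound (F u v : R * R -> R) : mfun2 F -> mfun2 u -> mfun2 v ->
    loc_bounded p u -> loc_bounded p v ->
    (forall T, forall z : R * R, 0 <= z.1 <= T -> `|F z| <= K T * `|u z| + m * `|v z|) ->
    loc_bounded p F.
  move=> mF' mu' mv' bu bv hF T; have [c hc] := bu T; have [c' hc'] := bv T.
  exists (K T * c + m * c') => t tT.
  have mn (w : R * R -> R) : mfun2 w -> mfun1 (fun x => `|w (t, x)|).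
    by move=> mw; apply: measurableT_comp => //; exact: measurable_slice.
  have mZ (k : R) (f : R -> R) : mfun1 f -> mfun1 (fun x => k * f x).
    by move=> mf; exact: measurable_funM.
  apply: (@ae_nle_pt _ _ _ (fun x => K T * `|u (t, x)| + m * `|v (t, x)|)) => //.
  - exact: measurable_slice.
  - by apply: measurable_funD; apply: mZ; exact: mn.
  - by move=> x; exact: (hF T (t, x)).
  - apply: nle_add => //; try by apply: mZ; exact: mn.
      by apply: nle_pZ => //; [exact: mn|apply: nle_norm => //; [exact: measurable_slice|exact: hc]].
    by apply: nle_pZ => //; [exact: mn|apply: nle_norm => //; [exact: measurable_slice|exact: hc']].
have bF : loc_bounded p (forceP m (gauge B0 P Q) P Q b).
  apply: (force_bound _ (gauge B0 P Q (~~ b)) (Q (~~ b))) => // T z zT.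
  have [_ _ /(_ z zT)[_ hQ]] := st T b.
  rewrite /forceP (le_trans (ler_normD _ _))// normrN !normrM (ger0_norm m0) lerD2r mulrC.
  exact: ler_wpM2r.
have bG : loc_bounded p (forceQ m (gauge B0 P Q) P Q b).
  apply: (force_bound _ (gauge B0 P Q (~~ b)) (P (~~ b))) => // T z zT.
  have [_ _ /(_ z zT)[hP _]] := st T b.
  rewrite /forceQ (le_trans (ler_normB _ _))// !normrM (ger0_norm m0) lerD2r mulrC.
  exact: ler_wpM2r.
have zz (z : R * R) : 0 <= z.1 -> 0 <= z.1 <= z.1 by move=> ->; rewrite lexx.
have cP : curve p (P b).
  apply: (mild_curve (b := b) (a := P0 b) p1 (mP b) mF (bP b) bF) => z z0.
    exact: (force_integrable m p1 b mB nB (st z.1) (zz z z0)).1.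
  exact: (sol b z z0).1.
have cQ : curve p (Q b).
  apply: (mild_curve (b := b) (a := Q0 b) p1 (mQ b) mG (bQ b) bG) => z z0.
    exact: (force_integrable m p1 b mB nB (st z.1) (zz z z0)).2.
  exact: (sol b z z0).2.
have mr : mfun2 (rho P Q) := measurable_rho (st 0).
(* The density is quadratic: one factor is bounded by [K T], the other is in [L^p]. *)
have br : loc_bounded p (fun z => - sg b * rho P Q z).
  move=> T; exists (K T * (apriori_cst m T * d)) => t tT.
  have ms : mfun1 (fun x => mod2 P Q (t, x)) by exact: measurable_slice.
  apply: (@ae_nle_pt _ _ _ (fun x => K T * mod2 P Q (t, x))) => //.
  - by apply: measurable_funM => //; exact: measurable_slice.
  - by exact: measurable_funM.
  - move=> x; rewrite normrM normrN sg_norm mul1r.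
    have sq (y : R) : `|y| <= K T -> y ^+ 2 <= K T * `|y|.
      by move=> yK; rewrite -(real_normK (num_real y)) expr2 ler_wpM2r.
    have hs b' : P b' (t, x) ^+ 2 + Q b' (t, x) ^+ 2 <= K T * mod1 P Q b' (t, x).
      have [_ _ /(_ (t, x) tT)[hP hQ]] := st T b'.
      by rewrite /mod1 mulrDr; apply: lerD; exact: sq.
    rewrite ger0_norm; last by rewrite mulr_ge0// !addr_ge0// sqr_ge0.
    have := hs true; have := hs false; rewrite /rho /mod2.
    have := mulr_ge0 (KT0 T) (mod2_ge0 P Q (t, x)); rewrite /mod2 mulrDr; lra.
  - by apply: nle_pZ => //; exact: nmod.
have cg : curve p (gauge B0 P Q b).
  have Ir (z : R * R) : 0 <= z.1 -> integrable_along b (rho P Q) z.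
    move=> z0; apply: (@bounded_along _ _ _ (2 * K z.1 ^+ 2)) => // s y sz.
    exact: (rho_bound (st z.1)).
  apply: (mild_curve (b := b) (a := B0 b) (f := fun z => - sg b * rho P Q z) p1 (mg b) _ (bg b) br) => [|z z0|z z0].
  - exact: measurable_funM.
  - exact: alongZ (Ir z z0).
  - by rewrite /gauge (JZ _ (Ir z z0)) mulNr.
have binfP : loc_bounded +oo%E (P b).
  by apply: binf => T z zT; have [_ _ /(_ z zT)[]] := st T b.
have binfQ : loc_bounded +oo%E (Q b).
  by apply: binf => T z zT; have [_ _ /(_ z zT)[]] := st T b.
by split; [exact: cP|exact: curve_bounded cP binfP|exact: cQ|exact: curve_bounded cQ binfQ|].
Qed.

End Existence.

(** * Weak solutions *)

Section Reduction.
Context {R : realType}.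
Local Notation mu := (@lebesgue_measure R).
Local Notation mR := (measurableTypeR R).
Local Notation mfun1 := (measurable_fun [set: mR]).
Local Notation mfun2 := (measurable_fun [set: (mR * mR)%type]).

(** By [ae_char], functions that agree almost everywhere at each time agree almost everywhere along
    almost every characteristic. *)
Lemma J_ae_eq b (f g : R * R -> R) (t : R) : mfun2 f -> mfun2 g ->
  (forall s : R, 0 <= s <= t -> {ae mu, forall y, f (s, y) = g (s, y)}) ->
  {ae mu, forall x, J b f (t, x) = J b g (t, x)}.
Proof.
move=> mf mg fg; have := @ae_char R b t _ (measurable_eq_set mf mg) fg.
apply: filterS => x hx; rewrite /J /Rintegral; congr fine.
apply: ae_eq_integral => //=.
- by apply/measurable_EFinP; apply: measurable_funTS; exact: measurable_char.
- by apply/measurable_EFinP; apply: measurable_funTS; exact: measurable_char.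
- by move: hx; apply: filterS => s /= hs; rewrite in_itv/= => /hs ->.
Qed.

(* A representative that is bounded everywhere: [bounded_state] is not stable
   under changes on null sets. *)
Definition cut (T K : R) (P : bool -> R * R -> R) b (z : R * R) : R :=
  if (0 <= z.1 <= T) && (`|P b z| <= K) then P b z else 0.

Lemma measurable_cut T K P b : mfun2 (P b) -> mfun2 (cut T K P b).
Proof.
move=> mP; apply: measurable_fun_ifT => //; apply: measurable_and.
  by apply: measurable_and; apply: measurable_fun_ler.
by apply: measurable_fun_ler => //; exact: measurableT_comp.
Qed.

Variables (m T K : R) (P Q B : bool -> R * R -> R) (P0 Q0 B0 : bool -> R -> R).
Hypotheses (K0 : 0 <= K) (mP : forall b, mfun2 (P b)) (mQ : forall b, mfun2 (Q b)).
Hypotheses (mB : forall b, mfun2 (B b)) (mB0 : forall b, mfun1 (B0 b)).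
Hypothesis bound : forall b (t : R), 0 <= t <= T ->
  {ae mu, forall x, `|P b (t, x)| <= K /\ `|Q b (t, x)| <= K}.
Hypothesis eqs : forall b (t : R), 0 <= t <= T -> {ae mu, forall x,
  [/\ P b (t, x) = P0 b (x - sg b * t) + J b (forceP m B P Q b) (t, x),
      Q b (t, x) = Q0 b (x - sg b * t) + J b (forceQ m B P Q b) (t, x) &
      B b (t, x) = gauge B0 P Q b (t, x)]}.

Lemma cut_bounded : bounded_state T K (cut T K P) (cut T K Q).
Proof.
move=> b; split; [exact: measurable_cut|exact: measurable_cut|].
move=> z zT; rewrite /cut zT /=.
by split; case: ifP => // _; rewrite normr0.
Qed.

Lemma cut_ae b (t : R) : 0 <= t <= T -> {ae mu, forall x,
  cut T K P b (t, x) = P b (t, x) /\ cut T K Q b (t, x) = Q b (t, x)}.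
Proof. by move=> tT; apply: ae_mono (bound b tT) => x [h1 h2]; rewrite /cut tT h1 h2. Qed.

Lemma cut_gauge b (t : R) : 0 <= t <= T ->
  {ae mu, forall x, B b (t, x) = gauge B0 (cut T K P) (cut T K Q) b (t, x)}.
Proof.
move=> tT.
have rE (s : R) : 0 <= s <= t ->
    {ae mu, forall y, rho P Q (s, y) = rho (cut T K P) (cut T K Q) (s, y)}.
  move=> /andP[s0 st]; have sT : 0 <= s <= T by rewrite s0 (le_trans st)//; case/andP: tT.
  apply: ae_mono (ae_conj (cut_ae true sT) (cut_ae false sT)) => y [[h1 h2] [h3 h4]].
  by rewrite /rho h1 h2 h3 h4.
have mr : mfun2 (rho P Q).
  apply: measurable_funM => //.
  by apply: measurable_funD; apply: measurable_funD; exact: measurable_funX.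
have := J_ae_eq b mr (measurable_rho cut_bounded) rE.
move=> h; apply: ae_mono (ae_conj h (eqs b tT)) => x [h1 [_ _ ->]].
by rewrite /gauge h1.
Qed.

Lemma cut_solution : real_solution m T P0 Q0 B0 (cut T K P) (cut T K Q).
Proof.
move=> b t tT.
have sT (s : R) : 0 <= s <= t -> 0 <= s <= T.
  by move=> /andP[-> st]; case/andP: tT => _; exact: le_trans.
have FE (s : R) : 0 <= s <= t -> {ae mu, forall y,
    forceP m B P Q b (s, y) =
      forceP m (gauge B0 (cut T K P) (cut T K Q)) (cut T K P) (cut T K Q) b (s, y) /\
    forceQ m B P Q b (s, y) =
      forceQ m (gauge B0 (cut T K P) (cut T K Q)) (cut T K P) (cut T K Q) b (s, y)}.
  move=> /sT {}sT.
  apply: ae_mono (ae_conj (ae_conj (cut_ae b sT) (cut_ae (~~ b) sT)) (cut_gauge (~~ b) sT)).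
  by move=> y [[[h1 h2] [h3 h4]] h5]; rewrite /forceP /forceQ h1 h2 h3 h4 h5.
have [mF mG] := force_measurable m b mB0 cut_bounded.
have mF' : mfun2 (forceP m B P Q b).
  apply: measurable_funD; last exact: measurable_funM.
  by apply: measurableT_comp => //; exact: measurable_funM.
have mG' : mfun2 (forceQ m B P Q b) by apply: measurable_funB; exact: measurable_funM.
have h1 := J_ae_eq (t := t) b mF' mF.
have {}h1 := h1 (fun s st => ae_mono (fun y (h : _ /\ _) => proj1 h) (FE s st)).
have h2 := J_ae_eq (t := t) b mG' mG.
have {}h2 := h2 (fun s st => ae_mono (fun y (h : _ /\ _) => proj2 h) (FE s st)).
apply: ae_mono (ae_conj (ae_conj h1 h2) (ae_conj (cut_ae b tT) (eqs b tT))).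
by move=> x [[e1 e2] [[-> ->] [-> -> _]]]; rewrite e1 e2.
Qed.

End Reduction.

(** * Complex and real formulations *)

Section Bridge.
Context {R : realType}.
Local Notation mu := (@lebesgue_measure R).
Local Notation mR := (measurableTypeR R).
Local Notation mfun1 := (measurable_fun [set: mR]).
Local Notation mfun2 := (measurable_fun [set: (mR * mR)%type]).

(** The index type [T] is [R] for data and [R * R] for solutions. *)
Definition Pof T (psi : T -> spinor R) b (z : T) : R := complex.Re (spinor_pm (sg b) (psi z)).
Definition Qof T (psi : T -> spinor R) b (z : T) : R := complex.Im (spinor_pm (sg b) (psi z)).
Definition Bof T (A : T -> potential R) b (z : T) : R := potential_pm (sg b) (A z).

Lemma PofE T (psi : T -> spinor R) b z :
  Pof psi b z = complex.Re (psi z).1 + sg b * complex.Re (psi z).2.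
Proof. by rewrite /Pof /spinor_pm; case: (psi z) => [[? ?] [? ?]] /=; ring. Qed.

Lemma QofE T (psi : T -> spinor R) b z :
  Qof psi b z = complex.Im (psi z).1 + sg b * complex.Im (psi z).2.
Proof. by rewrite /Qof /spinor_pm; case: (psi z) => [[? ?] [? ?]] /=; ring. Qed.

Lemma BofE T (A : T -> potential R) b z : Bof A b z = (A z).1 - sg b * (A z).2.
Proof. by []. Qed.

Lemma densityE (z : spinor R) : density z =
  complex.Re z.1 ^+ 2 + complex.Im z.1 ^+ 2 + (complex.Re z.2 ^+ 2 + complex.Im z.2 ^+ 2).
Proof.
rewrite /density; case: z => [[a b] [c d]] /=.
by rewrite !sqr_sqrtr// addr_ge0// sqr_ge0.
Qed.

(** Parallelogram identity for [psi_1 + psi_2] and [psi_1 - psi_2]: the origin of the factor [2^-1]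
    in [rho]. *)
Lemma rho_density (psi : R * R -> spinor R) z : rho (Pof psi) (Qof psi) z = density (psi z).
Proof. by rewrite /rho densityE !PofE !QofE /sg; field. Qed.

Lemma Re_force (m b1 : R) (u v : complex R) :
  complex.Re (b1%:C%C * u - m%:C%C * v) = b1 * complex.Re u - m * complex.Re v.
Proof. by case: u v => [? ?] [? ?] /=; ring. Qed.

Lemma Im_force (m b1 : R) (u v : complex R) :
  complex.Im (b1%:C%C * u - m%:C%C * v) = b1 * complex.Im u - m * complex.Im v.
Proof. by case: u v => [? ?] [? ?] /=; ring. Qed.

Lemma iCplx (u v w : complex R) : u = v + Complex 0 1 * w <->
  complex.Re u = complex.Re v - complex.Im w /\ complex.Im u = complex.Im v + complex.Re w.
Proof.
case: u v w => [a a'] [b b'] [c c'] /=; split.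
  by move=> [-> ->]; split; ring.
by move=> [-> ->]; congr Complex; ring.
Qed.

Variables (m : R) (psi0 : R -> spinor R) (A0 : R -> potential R).
Variables (psi : R * R -> spinor R) (A : R * R -> potential R).
Local Notation P := (Pof psi).
Local Notation Q := (Qof psi).
Local Notation B := (Bof A).

Lemma dirac_eqP b : dirac_eq m (sg b) psi0 psi A <->
  forall t : R, 0 <= t -> {ae mu, forall x,
    (integrable_along b (forceP m B P Q b) (t, x) /\
     integrable_along b (forceQ m B P Q b) (t, x)) /\
    P b (t, x) = Pof psi0 b (x - sg b * t) + J b (forceP m B P Q b) (t, x) /\
    Q b (t, x) = Qof psi0 b (x - sg b * t) + J b (forceQ m B P Q b) (t, x)}.
Proof.
have key t x : (let F s := let z := (s, x - sg b * (t - s)) in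
      (potential_pm (- sg b) (A z))%:C%C * spinor_pm (sg b) (psi z)
      - m%:C%C * spinor_pm (- sg b) (psi z) in
    Cintegrable `[0, t] F /\
    spinor_pm (sg b) (psi (t, x)) =
      spinor_pm (sg b) (psi0 (x - sg b * t)) + Complex 0 1 * Cintegral `[0, t] F) <->
    ((integrable_along b (forceP m B P Q b) (t, x) /\
     integrable_along b (forceQ m B P Q b) (t, x)) /\
    P b (t, x) = Pof psi0 b (x - sg b * t) + J b (forceP m B P Q b) (t, x) /\
    Q b (t, x) = Qof psi0 b (x - sg b * t) + J b (forceQ m B P Q b) (t, x)).
  set F := fun s : R => _ => /=.
  (* [F] is the integrand before multiplication by [i], so its real part drives [Q], and its
     imaginary part is the negative of what drives [P]. *)
  have reF s : complex.Re (F s) = forceQ m B P Q b (s, x - sg b * (t - s)).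
    by rewrite /F Re_force -sgN.
  have imF s : complex.Im (F s) = - forceP m B P Q b (s, x - sg b * (t - s)).
    by rewrite /F Im_force -sgN /forceP opprD opprK.
  rewrite iCplx /Cintegrable /Cintegral /=.
  have intQ : mu.-integrable `[0, t] (fun s => (complex.Re (F s))%:E) <->
      integrable_along b (forceQ m B P Q b) (t, x).
    rewrite (_ : (fun s => _) = EFin \o (fun s => forceQ m B P Q b (s, x - sg b * (t - s))))//.
    by apply/funext => s; rewrite reF.
  have intP : mu.-integrable `[0, t] (fun s => (complex.Im (F s))%:E) <->
      integrable_along b (forceP m B P Q b) (t, x).
    rewrite (_ : (fun s => _) = EFin \o (fun s => - forceP m B P Q b (s, x - sg b * (t - s)))); last first.
      by apply/funext => s; rewrite imF.
    split => h.
      rewrite /integrable_along (_ : _ \o _ = EFin \o (fun s =>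
        -1 * - forceP m B P Q b (s, x - sg b * (t - s)))).
        exact: (integrableZR (-1) (measurable_itvR _) h).
      by apply/funext => s /=; rewrite mulN1r opprK.
    rewrite (_ : _ \o _ = EFin \o (fun s => -1 * forceP m B P Q b (s, x - sg b * (t - s)))).
      exact: (integrableZR (-1) (measurable_itvR _) h).
    by apply/funext => s /=; rewrite mulN1r.
  have JQ : \int[mu]_(s in `[0, t]) complex.Re (F s) = J b (forceQ m B P Q b) (t, x).
    by apply: eq_Rintegral => s _; rewrite reF.
  have JP : integrable_along b (forceP m B P Q b) (t, x) ->
      \int[mu]_(s in `[0, t]) complex.Im (F s) = - J b (forceP m B P Q b) (t, x).
    move=> h; rewrite -mulN1r -(JZ (-1) h); apply: eq_Rintegral => s _.
    by rewrite imF mulN1r.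
  rewrite intQ intP JQ; split.
    by move=> [[i1 i2]]; rewrite (JP i2) opprK.
  by move=> [[i1 i2]]; rewrite (JP i1) opprK.
by split => h t t0; have := h t t0; apply: ae_mono => x /key.
Qed.

Lemma chern_simons_eqP b : chern_simons_eq (sg b) A0 psi A <->
  forall t : R, 0 <= t -> {ae mu, forall x, integrable_along b (rho P Q) (t, x) /\
    B b (t, x) = gauge (Bof A0) P Q b (t, x)}.
Proof.
have E t x : (fun s => density (psi (s, x - sg b * (t - s)))) =
    (fun s => rho P Q (s, x - sg b * (t - s))).
  by apply/funext => s; rewrite rho_density.
by split => h t t0; have := h t t0; apply: ae_mono => x /=;
  rewrite /integrable_along /gauge /J /= E.
Qed.

Lemma weak_solutionP : weak_solution m psi0 A0 psi A <->
  forall b, dirac_eq m (sg b) psi0 psi A /\ chern_simons_eq (sg b) A0 psi A.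
Proof.
split=> [[h1 h2 h3 h4] [|]|h].
- exact: (conj h1 h3).
- exact: (conj h2 h4).
- exact: (And4 (h true).1 (h false).1 (h true).2 (h false).2).
Qed.

End Bridge.

(** * Norms of the data and of their components *)

Section DataNorm.
Context {R : realType}.
Local Notation mu := (@lebesgue_measure R).
Local Notation mR := (measurableTypeR R).
Local Notation mfun1 := (measurable_fun [set: mR]).
Local Notation mfun2 := (measurable_fun [set: (mR * mR)%type]).

Lemma sqrt_le_sq (x y : R) : 0 <= y -> x <= y ^+ 2 -> Num.sqrt x <= y.
Proof.
by move=> y0 xy; rewrite (le_trans (ler_wsqrtr xy))// sqrtr_sqr ger0_norm.
Qed.

Lemma coord_le_sqrt (x s : R) : x ^+ 2 <= s -> `|x| <= Num.sqrt s.
Proof. by move=> h; rewrite -sqrtr_sqr; exact: ler_wsqrtr. Qed.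

Lemma sum2_sq_le (a b : R) : a ^+ 2 + b ^+ 2 <= (`|a| + `|b|) ^+ 2.
Proof.
rewrite -(real_normK (num_real a)) -(real_normK (num_real b)) sqrrD lerD2r lerDl.
by rewrite mulrn_wge0// mulr_ge0.
Qed.

Lemma sum4_sq_le (a b c d : R) :
  a ^+ 2 + b ^+ 2 + (c ^+ 2 + d ^+ 2) <= (`|a| + `|b| + (`|c| + `|d|)) ^+ 2.
Proof.
apply: (le_trans (lerD (sum2_sq_le a b) (sum2_sq_le c d))).
by rewrite [leRHS]sqrrD lerD2r lerDl mulrn_wge0// mulr_ge0// addr_ge0.
Qed.

Lemma PQ_le_spinor_norm T (psi : T -> spinor R) b z :
  `|Pof psi b z| <= 2 * spinor_norm (psi z) /\ `|Qof psi b z| <= 2 * spinor_norm (psi z).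
Proof.
have sq (x : R) := sqr_ge0 x.
have h x : x ^+ 2 <= density (psi z) -> `|x| <= spinor_norm (psi z) by exact: coord_le_sqrt.
rewrite densityE in h.
have := sq (complex.Re (psi z).1); have := sq (complex.Re (psi z).2).
have := sq (complex.Im (psi z).1); have := sq (complex.Im (psi z).2) => s1 s2 s3 s4.
have h1 : `|complex.Re (psi z).1| <= spinor_norm (psi z) by apply: h; lra.
have h2 : `|complex.Re (psi z).2| <= spinor_norm (psi z) by apply: h; lra.
have h3 : `|complex.Im (psi z).1| <= spinor_norm (psi z) by apply: h; lra.
have h4 : `|complex.Im (psi z).2| <= spinor_norm (psi z) by apply: h; lra.
rewrite PofE QofE; split; rewrite (le_trans (ler_normD _ _))// normrM sg_norm mul1r; lra.
Qed.

Lemma spinor_norm_le T (psi : T -> spinor R) z : spinor_norm (psi z) <=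
  `|Pof psi true z| + `|Qof psi true z| + (`|Pof psi false z| + `|Qof psi false z|).
Proof.
apply: sqrt_le_sq; first by rewrite !addr_ge0.
apply: le_trans (sum4_sq_le _ _ _ _); rewrite densityE !PofE !QofE /sg.
have := sqr_ge0 (complex.Re (psi z).1 ); have := sqr_ge0 (complex.Re (psi z).2).
have := sqr_ge0 (complex.Im (psi z).1 ); have := sqr_ge0 (complex.Im (psi z).2).
nra.
Qed.

Lemma B_le_potential_norm T (A : T -> potential R) b z :
  `|Bof A b z| <= 2 * potential_norm (A z).
Proof.
have h x : x ^+ 2 <= (A z).1 ^+ 2 + (A z).2 ^+ 2 -> `|x| <= potential_norm (A z).
  exact: coord_le_sqrt.
have h1 : `|(A z).1| <= potential_norm (A z) by apply: h; rewrite lerDl sqr_ge0.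
have h2 : `|(A z).2| <= potential_norm (A z) by apply: h; rewrite lerDr sqr_ge0.
rewrite BofE (le_trans (ler_normB _ _))// normrM sg_norm mul1r; lra.
Qed.

Lemma potential_norm_le T (A : T -> potential R) z :
  potential_norm (A z) <= `|Bof A true z| + `|Bof A false z|.
Proof.
apply: sqrt_le_sq; first by rewrite addr_ge0.
apply: le_trans (sum2_sq_le _ _); rewrite !BofE /sg.
have := sqr_ge0 (A z).1; have := sqr_ge0 (A z).2; nra.
Qed.

Lemma PofB T (psi psi' : T -> spinor R) b z :
  Pof (fun x => psi x - psi' x) b z = Pof psi b z - Pof psi' b z.
Proof. by rewrite !PofE; case: (psi z) (psi' z) => [[? ?] [? ?]] [[? ?] [? ?]] /=; ring. Qed.

Lemma QofB T (psi psi' : T -> spinor R) b z :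
  Qof (fun x => psi x - psi' x) b z = Qof psi b z - Qof psi' b z.
Proof. by rewrite !QofE; case: (psi z) (psi' z) => [[? ?] [? ?]] [[? ?] [? ?]] /=; ring. Qed.

Lemma BofB T (A A' : T -> potential R) b z :
  Bof (fun x => A x - A' x) b z = Bof A b z - Bof A' b z.
Proof. by rewrite !BofE /=; ring. Qed.

(** For differences of data or solutions, size is expressed by [data_norm]; this records the
    measurability alone. *)
Definition data_fun (psi0 : R -> spinor R) (A0 : R -> potential R) :=
  spinor_in (mfun1 : set (R -> R)) psi0 /\ potential_in (mfun1 : set (R -> R)) A0.

Lemma data_spaceW p psi0 A0 : data_space p psi0 A0 -> data_fun psi0 A0.
Proof.
move=> [[[/LpP[m1 _] _] [/LpP[m2 _] _] [/LpP[m3 _] _] [/LpP[m4 _] _]] [/LpP[m5 _] /LpP[m6 _]]].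
by split; split.
Qed.

Lemma data_funB psi0 A0 psi0' A0' : data_fun psi0 A0 -> data_fun psi0' A0' ->
  data_fun (fun x => psi0 x - psi0' x) (fun x => A0 x - A0' x).
Proof.
move=> [[a1 a2 a3 a4] [a5 a6]] [[b1 b2 b3 b4] [b5 b6]].
have reB (u v : complex R) : complex.Re (u - v) = complex.Re u - complex.Re v by case: u v => [? ?] [].
have imB (u v : complex R) : complex.Im (u - v) = complex.Im u - complex.Im v by case: u v => [? ?] [].
by split; split => /=; under eq_fun do rewrite ?reB ?imB; exact: measurable_funB.
Qed.

Lemma data_fun_measurable psi0 A0 : data_fun psi0 A0 ->
  [/\ forall b, mfun1 (Pof psi0 b), forall b, mfun1 (Qof psi0 b), forall b, mfun1 (Bof A0 b),
      mfun1 (spinor_norm \o psi0) & mfun1 (potential_norm \o A0)].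
Proof.
move=> [[a1 a2 a3 a4] [a5 a6]].
have msqrt : measurable_fun setT (@Num.sqrt R).
  by apply: continuous_measurable_fun; exact: sqrt_continuous.
split.
- by move=> b; rewrite (funext (PofE psi0 b)); apply: measurable_funD => //; exact: measurable_funM.
- by move=> b; rewrite (funext (QofE psi0 b)); apply: measurable_funD => //; exact: measurable_funM.
- by move=> b; apply: measurable_funB => //; exact: measurable_funM.
- apply: (measurableT_comp msqrt); rewrite (funext (fun x => densityE (psi0 x))).
  by apply: measurable_funD; apply: measurable_funD; exact: measurable_funX.
- apply: (measurableT_comp msqrt).
  by apply: measurable_funD; exact: measurable_funX.
Qed.

Lemma data_norm_le p psi0 A0 (M : R) : (1 <= p)%E -> data_fun psi0 A0 ->
  (data_norm p psi0 A0 <= M%:E)%E ->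
  [/\ 0 <= M, forall b, nle p (2 * M) (Pof psi0 b) /\ nle +oo%E (2 * M) (Pof psi0 b),
    forall b, nle p (2 * M) (Qof psi0 b) /\ nle +oo%E (2 * M) (Qof psi0 b) &
    forall b, nle p (2 * M) (Bof A0 b)].
Proof.
move=> p1 df dM; have [mP mQ mB ms mp] := data_fun_measurable df.
have N0 q f : (0 <= 'N[mu]_q[f])%E by exact: Lnorm_ge0.
have n1 : nle p M (spinor_norm \o psi0).
  by apply: le_trans dM; rewrite /data_norm -addeA leeDl// adde_ge0.
have n2 : nle +oo%E M (spinor_norm \o psi0).
  by apply: le_trans dM; rewrite /data_norm addeAC leeDr// adde_ge0.
have n3 : nle p M (potential_norm \o A0).
  by apply: le_trans dM; rewrite /data_norm leeDr// adde_ge0.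
have M0 := nle_ge0 n1.
have dbl (q : \bar R) (f g : R -> R) : (1 <= q)%E -> mfun1 f -> mfun1 g -> (forall x, `|f x| <= 2 * g x) ->
    nle q M g -> nle q (2 * M) f.
  move=> q1 mf mg fg ng; apply: (ae_nle_pt q1 mf _ fg); first exact: measurable_funM.
  exact: nle_pZ.
split => //.
- by move=> b; split; apply: (dbl _ _ _ _ (mP b) ms); rewrite ?leey// => x; exact: (PQ_le_spinor_norm psi0 b x).1.
- by move=> b; split; apply: (dbl _ _ _ _ (mQ b) ms); rewrite ?leey// => x; exact: (PQ_le_spinor_norm psi0 b x).2.
- by move=> b; apply: (dbl _ _ _ _ (mB b) mp) => // x; exact: B_le_potential_norm.
Qed.

Lemma data_norm_fin p psi0 A0 : (1 <= p)%E -> data_space p psi0 A0 ->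
  exists M : R, (data_norm p psi0 A0 <= M%:E)%E.
Proof.
move=> p1 ds; have df := data_spaceW ds; have [mP mQ mB ms mp] := data_fun_measurable df.
move: ds => [[[/LpP[m1 [c1 n1]] /LpP[_ [d1 o1]]] [/LpP[m2 [c2 n2]] /LpP[_ [d2 o2]]]
  [/LpP[m3 [c3 n3]] /LpP[_ [d3 o3]]] [/LpP[m4 [c4 n4]] /LpP[_ [d4 o4]]]]
  [/LpP[m5 [c5 n5]] /LpP[m6 [c6 n6]]]].
have mn (f : R -> R) : mfun1 f -> mfun1 (fun x => `|f x|) by move=> mf; exact: measurableT_comp.
have sum4 q a1 a2 a3 a4 : (1 <= q)%E ->
    nle q a1 (fun x => complex.Re (psi0 x).1) -> nle q a2 (fun x => complex.Im (psi0 x).1) ->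
    nle q a3 (fun x => complex.Re (psi0 x).2) -> nle q a4 (fun x => complex.Im (psi0 x).2) ->
    nle q (a1 + a2 + (a3 + a4)) (spinor_norm \o psi0).
  move=> q1 h1 h2 h3 h4; apply: (ae_nle_pt q1 ms _ _
    (nle_add q1 _ _ (nle_add q1 _ _ (nle_norm q1 m1 h1) (nle_norm q1 m2 h2))
                    (nle_add q1 _ _ (nle_norm q1 m3 h3) (nle_norm q1 m4 h4)))).
  - by apply: measurable_funD; apply: measurable_funD; exact: mn.
  - move=> x; rewrite ger0_norm ?sqrtr_ge0//; apply: sqrt_le_sq; first by rewrite !addr_ge0.
    by rewrite densityE; exact: sum4_sq_le.
  - by apply: measurable_funD; exact: mn.
  - by apply: measurable_funD; exact: mn.
  - exact: mn.
  - exact: mn.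
  - exact: mn.
  - exact: mn.
have n7 : nle p (c5 + c6) (potential_norm \o A0).
  apply: (ae_nle_pt p1 mp _ _ (nle_add p1 _ _ (nle_norm p1 m5 n5) (nle_norm p1 m6 n6))).
  - by apply: measurable_funD; exact: mn.
  - move=> x; rewrite ger0_norm ?sqrtr_ge0//; apply: sqrt_le_sq; first by rewrite addr_ge0.
    exact: sum2_sq_le.
  - exact: mn.
  - exact: mn.
have s1 := sum4 p _ _ _ _ p1 n1 n2 n3 n4.
have s2 := sum4 +oo%E _ _ _ _ (leey _) o1 o2 o3 o4.
eexists; rewrite /data_norm; apply: (leeD (leeD s1 s2) n7).
Qed.

End DataNorm.

(** * Bounded real representatives of weak solutions *)

Section RealForm.
Context {R : realType}.
Local Notation mu := (@lebesgue_measure R).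
Local Notation mR := (measurableTypeR R).
Local Notation mfun1 := (measurable_fun [set: mR]).
Local Notation mfun2 := (measurable_fun [set: (mR * mR)%type]).

(** Solutions are measurable only on [t >= 0], the real system is posed on the whole plane, and [J]
    never looks at negative times. *)
Definition future (f : bool -> R * R -> R) b (z : R * R) : R := if 0 <= z.1 then f b z else 0.

Lemma futureE f b (z : R * R) : 0 <= z.1 -> future f b z = f b z.
Proof. by rewrite /future => ->. Qed.

Lemma measurable_future (f : bool -> R * R -> R) b :
  measurable_fun (`[0, +oo[ `*` setT : set (mR * mR)) (f b) -> mfun2 (future f b).
Proof.
have mD : measurable (`[0, +oo[ `*` setT : set (mR * mR)) by apply: measurableX.
move=> /(measurable_restrictT (f b) mD); rewrite (_ : _ \_ _ = future f b)//.
apply/funext => z; rewrite /patch /future.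
have -> : (z \in `[0, +oo[ `*` [set: mR]) = (0 <= z.1).
  apply/idP/idP; first by rewrite inE => -[/=]; rewrite in_itv/= andbT.
  by move=> z0; rewrite inE; split => //=; rewrite in_itv/= z0.
by case: ifP.
Qed.

Lemma J_future b (f g : R * R -> R) (z : R * R) :
  (forall u : R * R, 0 <= u.1 -> f u = g u) -> J b f z = J b g z.
Proof.
by move=> fg; apply: eq_Rintegral => s; rewrite inE/= in_itv/= => /andP[s0 _]; rewrite fg.
Qed.

Lemma CLp_infty_ae (u : R * R -> R) (T : R) : CLp +oo%E u -> exists M : R, 0 <= M /\
  forall t : R, 0 <= t <= T -> {ae mu, forall x, `|u (t, x)| <= M}.
Proof.
move=> [_ _]; rewrite /Lp_continuous eqxx => -[/(_ T)[M hM] _].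
exists `|M|; split => // t tT; have /nle_inftyP := hM t tT.
by apply: ae_mono => x /le_trans; apply; exact: ler_norm.
Qed.

(** The first cut uses a bound [K] taken from the solution, with no uniformity; it makes the a
    priori estimate applicable. The second cut uses the resulting [K'], which depends only on [m],
    [T] and [M]. *)
Lemma solution_real (m M T : R) (p : \bar R) psi0 A0 psi A : 0 <= m -> (1 <= p)%E ->
  0 <= T -> data_fun psi0 A0 -> (data_norm p psi0 A0 <= M%:E)%E ->
  global_weak_solution m p psi0 A0 psi A ->
  exists P Q, [/\ bounded_state T (apriori_cst m T * (2 * M)) P Q,
    real_solution m T (Pof psi0) (Qof psi0) (Bof A0) P Q &
    forall b (t : R), 0 <= t <= T -> {ae mu, forall x, [/\ P b (t, x) = Pof psi b (t, x),
      Q b (t, x) = Qof psi b (t, x) &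
      gauge (Bof A0) P Q b (t, x) = Bof A b (t, x)]}].
Proof.
move=> m0 p1 T0 df dM [[[[p1r q1r] [p1i q1i] [p2r q2r] [p2i q2i]] [cA0 cA1]] /weak_solutionP ws].
have [mP0 mQ0 mB0 _ _] := data_fun_measurable df.
have [M0 nP0 nQ0 nB0] := data_norm_le p1 df dM.
have [[m1 _ _] [m2 _ _] [m3 _ _] [m4 _ _]] := And4 p1r p1i p2r p2i.
have [m5 _ _] := cA0; have [m6 _ _] := cA1.
pose P1 := future (Pof psi); pose Q1 := future (Qof psi); pose B1 := future (Bof A).
have mP1 b : mfun2 (P1 b).
  apply: measurable_future; rewrite (funext (PofE psi b)).
  by apply: measurable_funD => //; exact: measurable_funM.
have mQ1 b : mfun2 (Q1 b).
  apply: measurable_future; rewrite (funext (QofE psi b)).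
  by apply: measurable_funD => //; exact: measurable_funM.
have mB1 b : mfun2 (B1 b).
  by apply: measurable_future; apply: measurable_funB => //; exact: measurable_funM.
have [K1 [K10 h1]] := CLp_infty_ae T q1r; have [K2 [K20 h2]] := CLp_infty_ae T q1i.
have [K3 [K30 h3]] := CLp_infty_ae T q2r; have [K4 [K40 h4]] := CLp_infty_ae T q2i.
pose K := K1 + K2 + (K3 + K4).
have K0 : 0 <= K by rewrite !addr_ge0.
have bound b (t : R) : 0 <= t <= T -> {ae mu, forall x, `|P1 b (t, x)| <= K /\ `|Q1 b (t, x)| <= K}.
  move=> tT; have t0 : 0 <= t by case/andP: tT.
  apply: ae_mono (ae_conj (ae_conj (h1 t tT) (h2 t tT)) (ae_conj (h3 t tT) (h4 t tT))).
  move=> x [[k1 k2] [k3 k4]]; rewrite /P1 /Q1 !futureE// PofE QofE.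
  by split; rewrite (le_trans (ler_normD _ _))// normrM sg_norm mul1r /K; lra.
have eqs b (t : R) : 0 <= t <= T -> {ae mu, forall x,
    [/\ P1 b (t, x) = Pof psi0 b (x - sg b * t) + J b (forceP m B1 P1 Q1 b) (t, x),
        Q1 b (t, x) = Qof psi0 b (x - sg b * t) + J b (forceQ m B1 P1 Q1 b) (t, x) &
        B1 b (t, x) = gauge (Bof A0) P1 Q1 b (t, x)]}.
  move=> tT; have t0 : 0 <= t by case/andP: tT.
  have [/dirac_eqP/(_ t t0) d1 /chern_simons_eqP/(_ t t0) d2] := ws b.
  apply: ae_mono (ae_conj d1 d2) => x [[_ [e1 e2]] [_ e3]].
  have E1 : P1 b (t, x) = Pof psi b (t, x) by exact: futureE.
  have E2 : Q1 b (t, x) = Qof psi b (t, x) by exact: futureE.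
  have E3 : B1 b (t, x) = Bof A b (t, x) by exact: futureE.
  split.
  - rewrite E1 e1; congr (_ + _); apply: J_future => u u0.
    by rewrite /forceP /B1 /P1 /Q1 !futureE.
  - rewrite E2 e2; congr (_ + _); apply: J_future => u u0.
    by rewrite /forceQ /B1 /P1 /Q1 !futureE.
  - rewrite E3 e3 /gauge; congr (_ - _ * _).
    by apply: J_future => u u0; rewrite /rho /P1 /Q1 !futureE.
have st1 : bounded_state T K (cut T K P1) (cut T K Q1) := cut_bounded T K0 mP1 mQ1.
have sol1 := cut_solution K0 mP1 mQ1 mB1 mB0 bound eqs.
pose K' := apriori_cst m T * (2 * M).
have ninf (t : R) : 0 <= t <= T -> nle +oo%E K' (fun x => mod2 (cut T K P1) (cut T K Q1) (t, x)).
  move=> tT; exact: (apriori_solution m0 (leey _) p1 T0 mP0 mQ0 mB0 (fun b => (nP0 b).2)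
    (fun b => (nQ0 b).2) nB0 st1 sol1 tT).
have K'0 : 0 <= K' by apply: (nle_ge0 (ninf 0 _)); rewrite lexx.
have bound' b (t : R) : 0 <= t <= T -> {ae mu, forall x, `|P1 b (t, x)| <= K' /\ `|Q1 b (t, x)| <= K'}.
  move=> tT; have /nle_inftyP h := ninf t tT.
  apply: ae_mono (ae_conj h (cut_ae bound b tT)) => x [h' [<- <-]].
  move: h'; rewrite ger0_norm ?mod2_ge0// => h'; have := mod1_le_mod2 (cut T K P1) (cut T K Q1) b (t, x).
  by rewrite /mod1 => k; split; apply: (le_trans _ (le_trans k h')); rewrite ?lerDl ?lerDr.
exists (cut T K' P1), (cut T K' Q1); split.
- exact: (cut_bounded T K'0 mP1 mQ1).
- exact: (cut_solution K'0 mP1 mQ1 mB1 mB0 bound' eqs).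
- move=> b t tT; have t0 : 0 <= t by case/andP: tT.
  apply: ae_mono (ae_conj (cut_ae bound' b tT) (cut_gauge K'0 mP1 mQ1 bound' eqs b tT)).
  by move=> x [[-> ->] <-]; rewrite /P1 /Q1 /B1 !futureE.
Qed.

End RealForm.

(** * Lipschitz dependence on the data *)

Section MainParts.
Context {R : realType}.
Local Notation mu := (@lebesgue_measure R).
Local Notation mR := (measurableTypeR R).
Local Notation mfun1 := (measurable_fun [set: mR]).
Local Notation mfun2 := (measurable_fun [set: (mR * mR)%type]).

(** Component bounds are twice the data norm. The two spinor norms contribute [2 * S] each, with [S]
    the stability constant, and the potential [4 * (1 + K * S)]. The absolute value and [1] make the
    constant positive. *)
Definition lipschitz_cst (m T M : R) : R :=
  let K := apriori_cst m T * (2 * M) in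
  `|4 * stability_cst m K T + 4 * (1 + K * stability_cst m K T)| + 1.

Lemma solution_slice (p : \bar R) psi A (t : R) : solution_space p psi A -> 0 <= t ->
  data_space p (fun x : R => psi (t, x)) (fun x : R => A (t, x)).
Proof.
move=> [[[p1r q1r] [p1i q1i] [p2r q2r] [p2i q2i]] [cA0 cA1]] t0.
have sl q (u : R * R -> R) : CLp q u -> Lp q (u \o pair t) by move=> [_ + _]; exact.
split; first by split; split; [exact: sl p1r|exact: sl q1r|exact: sl p1i|exact: sl q1i|
  exact: sl p2r|exact: sl q2r|exact: sl p2i|exact: sl q2i].
by split; [exact: sl cA0|exact: sl cA1].
Qed.

Lemma solution_lipschitz (m T M : R) (p : \bar R) psi0 psi0' A0 A0' psi psi' A A' :
  0 <= m -> (1 <= p)%E -> data_space p psi0 A0 -> data_space p psi0' A0' ->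
  (data_norm p psi0 A0 <= M%:E)%E -> (data_norm p psi0' A0' <= M%:E)%E ->
  global_weak_solution m p psi0 A0 psi A ->
  global_weak_solution m p psi0' A0' psi' A' ->
  forall t : R, 0 <= t <= T ->
    (data_norm p (fun x : R => psi (t, x) - psi' (t, x))%R
                 (fun x : R => A (t, x) - A' (t, x))%R
     <= (lipschitz_cst m T M)%:E * data_norm p (fun x : R => psi0 x - psi0' x)%R
                           (fun x : R => A0 x - A0' x)%R)%E.
Proof.
move=> m0 p1 ds ds' dM dM' gws gws' t tT.
have T0 : 0 <= T by case/andP: tT; exact: le_trans.
have t0 : 0 <= t by case/andP: tT.
have L0 : 0 < lipschitz_cst m T M by rewrite /lipschitz_cst ltr_wpDl.
set D := data_norm p (fun x : R => psi0 x - psi0' x) _.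
have N0 q (f : R -> \bar R) : (0 <= 'N[mu]_q[f])%E by exact: Lnorm_ge0.
have D0 : (0 <= D)%E by rewrite /D /data_norm !adde_ge0.
(* An infinite right-hand side is absorbed by the positivity of the constant. *)
have [Dfin|Dinf] := boolP (D \is a fin_num); last first.
  have -> : D = +oo%E by move: D0 Dinf; case: (D) => //.
  by rewrite gt0_muley// leey.
rewrite -(fineK Dfin); set d := fine D.
have dD : (D <= d%:E)%E by rewrite fineK.
have df := data_spaceW ds; have df' := data_spaceW ds'.
have [mP0 mQ0 mB0 _ _] := data_fun_measurable df.
have [mP0' mQ0' mB0' _ _] := data_fun_measurable df'.
have [M0 nP0 nQ0 nB0] := data_norm_le p1 df dM.
have [_ nP0' nQ0' nB0'] := data_norm_le p1 df' dM'.
have [d0 dP dQ dB] := data_norm_le p1 (data_funB df df') dD.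
have [P [Q [st sol eqs]]] := solution_real m0 p1 T0 df dM gws.
have [P' [Q' [st' sol' eqs']]] := solution_real m0 p1 T0 df' dM' gws'.
set K := apriori_cst m T * (2 * M) in st st'.
have ndP q : q = p \/ q = +oo%E -> forall b, nle q (2 * d) (fun x => Pof psi0 b x - Pof psi0' b x).
  by move=> qp b; rewrite -(funext (PofB psi0 psi0' b)); case: qp => ->; have [] := dP b.
have ndQ q : q = p \/ q = +oo%E -> forall b, nle q (2 * d) (fun x => Qof psi0 b x - Qof psi0' b x).
  by move=> qp b; rewrite -(funext (QofB psi0 psi0' b)); case: qp => ->; have [] := dQ b.
have ndB b : nle p (2 * d) (fun x => Bof A0 b x - Bof A0' b x).
  by rewrite -(funext (BofB A0 A0' b)); exact: dB.
have stab q (qp : q = p \/ q = +oo%E) := stability_estimate m0 p1 T0 mP0 mQ0 mP0' mQ0'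
  mB0 nB0 mB0' nB0' st st' sol sol' ndB qp (ndP q qp) (ndQ q qp) tT.
have gstab b := gauge_stability m0 p1 T0 mP0 mQ0 mP0' mQ0'
  mB0 nB0 mB0' nB0' st st' sol sol' ndB (ndP p (or_introl erefl)) (ndQ p (or_introl erefl)) b tT.
have dft := data_funB (data_spaceW (solution_slice gws.1 t0)) (data_spaceW (solution_slice gws'.1 t0)).
have [_ _ mBt ms mp] := data_fun_measurable dft.
set w := mod2 _ _ in stab.
have mw : mfun2 w by exact: (measurable_mod2 st st').
have ae2 := ae_conj (ae_conj (eqs true t tT) (eqs false t tT)) (ae_conj (eqs' true t tT) (eqs' false t tT)).
have spin q : (1 <= q)%E -> q = p \/ q = +oo%E -> nle q (stability_cst m K T * (2 * d))
    (spinor_norm \o (fun x : R => psi (t, x) - psi' (t, x))).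
  move=> q1 qp; apply: (ae_nle q1 ms _ _ (stab q qp)).
    apply: measurable_funD; first exact: measurable_slice.
    by apply: measurable_funD; apply: measurable_slice; exact: measurable_J.
  apply: ae_mono ae2 => x [[[e1 e2 _] [e3 e4 _]] [[e1' e2' _] [e3' e4' _]]].
  rewrite ger0_norm ?sqrtr_ge0//; apply: le_trans (ler_norm _).
  apply: (@le_trans _ _ (w (t, x))); last first.
    by rewrite lerDl addr_ge0// J_ge0// => z; exact: mod2_ge0.
  apply: (le_trans (spinor_norm_le (fun x : R => psi (t, x) - psi' (t, x)) x)).
  rewrite !PofB !QofB /w /mod2 /mod1 e1 e2 e3 e4 e1' e2' e3' e4'.
  exact: lexx.
have pot : nle p (2 * ((1 + K * stability_cst m K T) * (2 * d)))
    (potential_norm \o (fun x : R => A (t, x) - A' (t, x))).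
  have mg b : mfun1 (fun x => gauge (Bof A0) P Q b (t, x) - gauge (Bof A0') P' Q' b (t, x)).
    apply: measurable_funB; apply: measurable_slice.
      exact: measurable_gauge st.
    exact: measurable_gauge st'.
  have mgn b : mfun1 (fun x => `|gauge (Bof A0) P Q b (t, x) - gauge (Bof A0') P' Q' b (t, x)|).
    exact: measurableT_comp.
  apply: (ae_nle p1 mp _ _ (nle_sum2 p1 mgn (fun b => nle_norm p1 (mg b) (gstab b)))).
    exact: measurable_funD.
  apply: ae_mono ae2 => x [[[_ _ e1] [_ _ e2]] [[_ _ e1'] [_ _ e2']]].
  rewrite ger0_norm ?sqrtr_ge0//; apply: le_trans (ler_norm _).
  apply: (le_trans (potential_norm_le (fun x : R => A (t, x) - A' (t, x)) x)).
  by rewrite !BofB e1 e2 e1' e2'.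
have q1 := spin p p1 (or_introl erefl); have q2 := spin +oo%E (leey _) (or_intror erefl).
apply: (le_trans (leeD (leeD q1 q2) pot)).
rewrite -!EFinD -EFinM lee_fin /lipschitz_cst -/K.
set S := stability_cst m K T.
rewrite (_ : S * (2 * d) + S * (2 * d) + 2 * ((1 + K * S) * (2 * d)) =
  (4 * S + 4 * (1 + K * S)) * d); last by ring.
by rewrite ler_wpM2r// (le_trans (ler_norm _))// lerDl.
Qed.

End MainParts.

(** * Uniqueness and existence *)

Section MainTheorem.
Context {R : realType}.
Local Notation mu := (@lebesgue_measure R).
Local Notation mR := (measurableTypeR R).
Local Notation mfun1 := (measurable_fun [set: mR]).
Local Notation mfun2 := (measurable_fun [set: (mR * mR)%type]).

Lemma nle0_ae (p : \bar R) (f : R -> R) : (1 <= p)%E -> mfun1 f -> nle p 0 f ->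
  {ae mu, forall x, f x = 0}.
Proof.
move=> p1 mf nf.
have N0 : ('N[mu]_p[EFin \o f] = 0)%E.
  by apply/eqP; rewrite eq_le Lnorm_ge0 andbT.
have p0 : (0 < p)%E by exact: lt_le_trans p1.
have mf' : measurable_fun [set: mR] (EFin \o f) by exact/measurable_EFinP.
have := Lnorm_eq0_eq0 mf' p0 N0; apply: ae_mono => x /= h.
by case: (h I).
Qed.

Lemma spinor_pm_inj T (psi psi' : T -> spinor R) z :
  (forall b, Pof psi b z = Pof psi' b z /\ Qof psi b z = Qof psi' b z) -> psi z = psi' z.
Proof.
move=> h; have [] := h true; have [] := h false; rewrite !PofE !QofE /sg.
case: (psi z) (psi' z) => [[? ?] [? ?]] [[? ?] [? ?]] /= e1 e2 e3 e4.
by congr (Complex _ _, Complex _ _); lra.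
Qed.

Lemma potential_pm_inj T (A A' : T -> potential R) z :
  (forall b, Bof A b z = Bof A' b z) -> A z = A' z.
Proof.
move=> h; have := h true; have := h false; rewrite !BofE /sg.
by case: (A z) (A' z) => [? ?] [? ?] /= e1 e2; congr (_, _); lra.
Qed.

(** The Lipschitz estimate with equal data, taken on [[0, t]] for each [t]: a zero norm means zero
    almost everywhere. *)
Lemma solution_unique (m : R) (p : \bar R) psi0 A0 psi A psi' A' : 0 <= m -> (1 <= p)%E ->
  data_space p psi0 A0 -> global_weak_solution m p psi0 A0 psi A ->
  global_weak_solution m p psi0 A0 psi' A' -> same_curve psi psi' /\ same_curve A A'.
Proof.
move=> m0 p1 ds gws gws'; have [M dM] := data_norm_fin p1 ds.
suff h (t : R) : 0 <= t -> {ae mu, forall x, psi (t, x) = psi' (t, x) /\ A (t, x) = A' (t, x)}.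
  by split => t /h; apply: ae_mono => x [].
move=> t0; have tt : 0 <= t <= t by rewrite t0 lexx.
have := solution_lipschitz m0 p1 ds ds dM dM gws gws' tt.
have dft := data_funB (data_spaceW (solution_slice gws.1 t0)) (data_spaceW (solution_slice gws'.1 t0)).
have d0 : (data_norm p (fun x : R => psi0 x - psi0 x)%R (fun x : R => A0 x - A0 x)%R <= 0%:E)%E.
  have N00 q : (1 <= q)%E -> ('N[mu]_q[cst 0%:E] = 0)%E.
    by move=> q1; rewrite Lnorm0// gt_eqF// (lt_le_trans _ q1).
  rewrite /data_norm.
  rewrite (_ : EFin \o (spinor_norm \o _) = cst 0%:E); last first.
    by apply/funext => x /=; rewrite /spinor_norm densityE /= !subrr !expr0n/= !addr0 sqrtr0.
  rewrite (_ : EFin \o (potential_norm \o _) = cst 0%:E); last first.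
    by apply/funext => x /=; rewrite /potential_norm /= !subrr !expr0n/= !addr0 sqrtr0.
  by rewrite !N00// ?leey// !adde0.
have L0 : (0 <= (lipschitz_cst m t M)%:E)%E by rewrite lee_fin /lipschitz_cst addr_ge0.
move=> /le_trans/(_ (lee_wpmul2l L0 d0)); rewrite mule0 => dt.
have [_ nP nQ nB] := data_norm_le p1 dft dt; rewrite mulr0 in nP nQ nB.
have [mP mQ mB _ _] := data_fun_measurable dft.
have z1 b := ae_conj (ae_conj (nle0_ae p1 (mP b) (nP b).1) (nle0_ae p1 (mQ b) (nQ b).1))
  (nle0_ae p1 (mB b) (nB b)).
apply: ae_mono (ae_conj (z1 true) (z1 false)) => x.
rewrite !PofB !QofB !BofB => -[[[a1 a2] a3] [[b1 b2] b3]]; split.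
  apply: (spinor_pm_inj (psi := fun x => psi (t, x)) (psi' := fun x => psi' (t, x))).
  by case; split; apply/eqP; rewrite -subr_eq0; apply/eqP.
apply: (potential_pm_inj (A := fun x => A (t, x)) (A' := fun x => A' (t, x))).
by case; apply/eqP; rewrite -subr_eq0; apply/eqP.
Qed.

Lemma solution_exists (m : R) (p : \bar R) psi0 A0 : 0 <= m -> (1 <= p)%E ->
  data_space p psi0 A0 -> exists psi A, global_weak_solution m p psi0 A0 psi A.
Proof.
move=> m0 p1 ds; have [M dM] := data_norm_fin p1 ds; have df := data_spaceW ds.
have [mP0 mQ0 mB0 _ _] := data_fun_measurable df.
have [M0 nP0 nQ0 nB0] := data_norm_le p1 df dM.
pose K0 := 2 * M; have K00 : 0 <= K0 by rewrite mulr_ge0.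
(* The fixed point needs data bounded at every point, while [L^oo] data are so only almost
   everywhere. The clamped data change the equations on a null set of [x] at each time. *)
pose clamp (f : bool -> R -> R) b (x : R) : R := if `|f b x| <= K0 then f b x else 0.
have mclamp f b : mfun1 (f b) -> mfun1 (clamp f b).
  move=> mf; apply: measurable_fun_ifT => //.
  by apply: measurable_fun_ler => //; exact: measurableT_comp.
have bclamp f b x : `|clamp f b x| <= K0.
  by rewrite /clamp; case: ifP => // _; rewrite normr0.
have nclamp (f : bool -> R -> R) b : mfun1 (f b) -> nle p K0 (f b) -> nle p K0 (clamp f b).
  move=> mf; apply: ae_nle => //; first exact: mclamp.
  by apply: aeW => x; rewrite /clamp; case: ifP => // _; rewrite normr0.
have eclamp (f : bool -> R -> R) b a : nle +oo%E K0 (f b) ->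
    {ae mu, forall x, clamp f b (x + a) = f b (x + a)}.
  by move=> /nle_inftyP/(ae_shift a); apply: ae_mono => x; rewrite /clamp => ->.
have [P [Q [bst sol cur]]] := @real_existence R m K0 K0 p
  (clamp (Pof psi0)) (clamp (Qof psi0)) (Bof A0) m0 p1
  (fun b => mclamp _ b (mP0 b)) (fun b => mclamp _ b (mQ0 b)) mB0 (bclamp _) (bclamp _)
  (fun b => nclamp _ b (mP0 b) (nP0 b).1) (fun b => nclamp _ b (mQ0 b) (nQ0 b).1) nB0.
pose B := gauge (Bof A0) P Q.
(* Inversion of [psi_b = psi_1 + b psi_2] and, below, of [A_b = A_0 - b A_1], written in the form
   [k * u + l * v] of [curve_lin]. *)
pose psi (z : R * R) : spinor R :=
  (Complex (2^-1 * P true z + 2^-1 * P false z) (2^-1 * Q true z + 2^-1 * Q false z),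
   Complex (2^-1 * P true z + - 2^-1 * P false z) (2^-1 * Q true z + - 2^-1 * Q false z)).
pose A (z : R * R) : potential R :=
  (2^-1 * B true z + 2^-1 * B false z, - 2^-1 * B true z + 2^-1 * B false z).
have PE : Pof psi = P by apply/funext => b; apply/funext => z; rewrite PofE /=; case: b; rewrite /sg; field.
have QE : Qof psi = Q by apply/funext => b; apply/funext => z; rewrite QofE /=; case: b; rewrite /sg; field.
have BE : Bof A = B by apply/funext => b; apply/funext => z; rewrite BofE /=; case: b; rewrite /sg; field.
exists psi, A; split.
  have [cPt cPt' cQt cQt' cBt] := cur true; have [cPf cPf' cQf cQf' cBf] := cur false.
  have lin (q : \bar R) (k l : R) (u v : R * R -> R) : (1 <= q)%E ->
      curve q u -> curve q v -> CLp q (fun z => k * u z + l * v z).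
    by move=> q1 cu cv; apply: curve_CLp => //; exact: curve_lin.
  have oo1 : (1 <= +oo :> \bar R)%E by exact: leey.
  split; last by split; [exact: (lin p 2^-1 2^-1 _ _ p1 cBt cBf)|exact: (lin p (- 2^-1) 2^-1 _ _ p1 cBt cBf)].
  split; split.
  - exact: (lin p 2^-1 2^-1 _ _ p1 cPt cPf).
  - exact: (lin +oo%E 2^-1 2^-1 _ _ oo1 cPt' cPf').
  - exact: (lin p 2^-1 2^-1 _ _ p1 cQt cQf).
  - exact: (lin +oo%E 2^-1 2^-1 _ _ oo1 cQt' cQf').
  - exact: (lin p 2^-1 (- 2^-1) _ _ p1 cPt cPf).
  - exact: (lin +oo%E 2^-1 (- 2^-1) _ _ oo1 cPt' cPf').
  - exact: (lin p 2^-1 (- 2^-1) _ _ p1 cQt cQf).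
  - exact: (lin +oo%E 2^-1 (- 2^-1) _ _ oo1 cQt' cQf').
apply/weak_solutionP => b; split.
  apply/dirac_eqP => t t0; rewrite PE QE BE.
  have tt : 0 <= t <= t by rewrite t0 lexx.
  have [K st] := bst t.
  apply: ae_mono (ae_conj (sol t b t tt) (ae_conj
    (eclamp (Pof psi0) b (- (sg b * t)) (nP0 b).2) (eclamp (Qof psi0) b (- (sg b * t)) (nQ0 b).2))).
  move=> x [[e1 e2] [e3 e4]]; split; last by rewrite e1 e2 e3 e4.
  exact: (force_integrable (z := (t, x)) m p1 b mB0 nB0 st tt).
apply/chern_simons_eqP => t t0; rewrite PE QE BE.
have tt : 0 <= t <= t by rewrite t0 lexx.
have [K st] := bst t.
apply: aeW => x; split=> //; apply: (@bounded_along _ _ _ (2 * K ^+ 2)).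
  exact: measurable_rho st.
by move=> s y sz; exact: (rho_bound st).
Qed.

End MainTheorem.
Theorem theorem1p2 (R : realType) (m : R) (p : \bar R)
    (hm : 0 < m) (hp : (1 <= p)%E) :
  (forall (psi0 : R -> spinor R) (A0 : R -> potential R),
     data_space p psi0 A0 ->
     exists (psi : R * R -> spinor R) (A : R * R -> potential R),
       global_weak_solution m p psi0 A0 psi A /\
       forall (psi' : R * R -> spinor R) (A' : R * R -> potential R),
         global_weak_solution m p psi0 A0 psi' A' ->
         same_curve psi psi' /\ same_curve A A')
  /\
  (forall T M : R, exists L : R,
     forall (psi0 psi0' : R -> spinor R) (A0 A0' : R -> potential R)
       (psi psi' : R * R -> spinor R) (A A' : R * R -> potential R),
       data_space p psi0 A0 -> data_space p psi0' A0' ->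
       (data_norm p psi0 A0 <= M%:E)%E -> (data_norm p psi0' A0' <= M%:E)%E ->
       global_weak_solution m p psi0 A0 psi A ->
       global_weak_solution m p psi0' A0' psi' A' ->
       forall t : R, 0 <= t <= T ->
         (data_norm p (fun x : R => psi (t, x) - psi' (t, x))%R
                      (fun x : R => A (t, x) - A' (t, x))%R
          <= L%:E * data_norm p (fun x : R => psi0 x - psi0' x)%R
                                (fun x : R => A0 x - A0' x)%R)%E).
Proof.
have m0 := ltW hm; split=> [psi0 A0 ds|T M].
  have [psi [A gws]] := solution_exists m0 hp ds.
  exists psi, A; split=> // psi' A' gws'.
  exact: solution_unique m0 hp ds gws gws'.
exists (lipschitz_cst m T M) => psi0 psi0' A0 A0' psi psi' A A' ds ds' dM dM' gws gws' t tT.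
exact: (solution_lipschitz m0 hp ds ds' dM dM' gws gws' tT).
Qed.
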